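(* Let $R$ be a skew-invertible involutive symmetry of bi-rank $(m|0)$ and $\mathbf{Y}(R)$ the associated braided Yangian with generating matrix $L(u)$. Then: (1) (Cayley-Hamilton-Newton) $\displaystyle(-1)^{k+1}k\,L^{\wedge k}(u)=\sum_{p=0}^{k-1}(-1)^pL^{[k-p]}(u-p)\,e_p(u)$ for all $k\ge1$; (2) (Cayley-Hamilton) $\displaystyle\sum_{p=0}^m(-1)^pL^{[m-p]}(u-p)\,e_p(u)=0$, where $L^{[0]}(u)=I$; (3) (Newton) for all $k\ge1$, $ke_k(u)-p_1(u-k+1)e_{k-1}(u)+p_2(u-k+2)e_{k-2}(u)+\dots+(-1)^kp_k(u)=0$, i.e. $ke_k(u)+\sum_{j=1}^k(-1)^jp_j(u-k+j)e_{k-j}(u)=0$; (4) the determinant $e_m(u)$ commutes with the generating matrix: $e_m(u)L(v)=L(v)e_m(u)$ for all $u,v$; therefore the Laurent coefficients of $e_m(u)$ are central elements of $\mathbf{Y}(R)$.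
   Context: Conventions. $V$ is an $N$-dimensional vector space over $\mathbb{K}=\mathbb{R}$ or $\mathbb{C}$ with a fixed basis $\{x_i\}$. An operator $R$ on $V^{\otimes 2}$ has matrix given by $R(x_i\otimes x_j)=R_{ij}^{ks}x_k\otimes x_s$ (summation over repeated indices); matrix products are $(AB)_i^j=A_i^kB_k^j$. $R_k=R_{k\,k+1}$ is $R$ acting in tensor factors $k,k+1$; lower indices on operators indicate the tensor factors where they act; $L_1=L\otimes I$. Involutive symmetry: $R_{12}R_{23}R_{12}=R_{23}R_{12}R_{23}$ and $R^2=I$. Skew-invertible: there is $\Psi$ on $V^{\otimes 2}$ with $R_{ij}^{kl}\Psi_{lp}^{jq}=\delta_i^{q}\delta_p^k$. Put $C_i^j=\Psi_{ik}^{jk}$; $\mathrm{Tr}_R(X)=\mathrm{Tr}(XC)=C_i^jX_j^i$ for a matrix $X$ with entries in any algebra, and $\mathrm{Tr}_{R(a\dots b)}$ is the $R$-trace over tensor factors $a,\dots,b$. Skew-symmetrizers: $\mathcal{P}^{(1)}=I$, $\mathcal{P}^{(k+1)}_{1\dots k+1}=\frac{k}{k+1}\mathcal{P}^{(k)}_{1\dots k}\big(\frac1kI-R_k\big)\mathcal{P}^{(k)}_{1\dots k}$. $R$ has bi-rank $(m|0)$, $m\ge2$, if $\mathcal{P}^{(m)}\neq0$ and $\mathcal{P}^{(k)}=0$ for all $k>m$. Braided Yangian: let $R(u,v)=R-\frac{1}{u-v}I$. $\mathbf{Y}(R)$ is the unital associative algebra generated by the entries $l_i^j[k]$ ($k\ge1$)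 of matrices $L[k]$, where $L(u)=\sum_{k\ge0}L[k]u^{-k}$, $L[0]=I$, subject to the relations obtained by expanding $R(u,v)L_1(u)RL_1(v)=L_1(v)RL_1(u)R(u,v)$. Shifted series $L(u-c)$ are re-expanded in $u^{-1}$. Notation: $L_{\overline1}(u)=L_1(u)$, $L_{\overline{k+1}}(u)=R_kL_{\overline k}(u)R_k^{-1}$. Skew-symmetric powers: $L^{\wedge1}(u)=L(u)$, $L^{\wedge k}(u)=\mathrm{Tr}_{R(2\dots k)}\big(\mathcal{P}^{(k)}_{1\dots k}L_{\overline1}(u)L_{\overline2}(u-1)\cdots L_{\overline k}(u-k+1)\big)$, $k\ge2$. Matrix powers: $L^{[k]}(u)=\mathrm{Tr}_{R(2\dots k)}\big(L_{\overline1}(u-k+1)L_{\overline2}(u-k+2)\cdots L_{\overline k}(u)R_{k-1}R_{k-2}\cdots R_1\big)$, $k\ge1$. Elementary symmetric polynomials and power sums: $e_0(u)=1$, $e_k(u)=\mathrm{Tr}_RL^{\wedge k}(u)$, $p_k(u)=\mathrm{Tr}_RL^{[k]}(u)$ for $k\ge1$. *)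

(* Defs.v *)
From HB Require Import structures.
From mathcomp Require Import all_boot all_order all_algebra.
From mathcomp Require Import boolp monalg.

Set Implicit Arguments.
Unset Strict Implicit.
Unset Printing Implicit Defensive.

Import GRing.Theory.
Local Open Scope ring_scope.

(** Formal power series in u^-1 over a possibly noncommutative ring:
    a : fps A stands for \sum_n (a n) u^-n. *)

Record fps (A : Type) := Fps { fps_coef :> nat -> A }.

Lemma fpsP (A : Type) (a b : fps A) : a =1 b -> a = b.
Proof. by case: a b => [a] [b] /= /funext ->. Qed.

HB.instance Definition _ (A : Type) := gen_eqMixin (fps A).
HB.instance Definition _ (A : Type) := gen_choiceMixin (fps A).

Section FpsZmodule.
Variable A : zmodType.
Implicit Types a b : fps A.

Definition fps_zero : fps A := Fps (fun=> 0).
Definition fps_opp a : fps A := Fps (fun n => - a n).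
Definition fps_add a b : fps A := Fps (fun n => a n + b n).

Fact fps_addA : associative fps_add.
Proof. by move=> a b c; apply/fpsP => n; exact: addrA. Qed.
Fact fps_addC : commutative fps_add.
Proof. by move=> a b; apply/fpsP => n; exact: addrC. Qed.
Fact fps_add0 : left_id fps_zero fps_add.
Proof. by move=> a; apply/fpsP => n; exact: add0r. Qed.
Fact fps_addN : left_inverse fps_zero fps_opp fps_add.
Proof. by move=> a; apply/fpsP => n; exact: addNr. Qed.

HB.instance Definition _ := GRing.isZmodule.Build (fps A)
  fps_addA fps_addC fps_add0 fps_addN.

Lemma fpsD a b n : (a + b) n = a n + b n. Proof. by []. Qed.
Lemma fpsN a n : (- a) n = - a n. Proof. by []. Qed.
Lemma fps0 n : (0 : fps A) n = 0. Proof. by []. Qed.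
Lemma fps_sum I r (P : pred I) (F : I -> fps A) n :
  (\sum_(i <- r | P i) F i) n = \sum_(i <- r | P i) F i n.
Proof. by elim/big_rec2: _ => // i x y _ <-. Qed.

Definition fpsC (c : A) : fps A := Fps (fun n => if n is 0 then c else 0).

End FpsZmodule.

Section FpsRing.
Variable A : pzRingType.
Implicit Types a b : fps A.

Definition fps_mul a b : fps A :=
  Fps (fun n => \sum_(i < n.+1) a i * b (n - i)%N).

Fact fps_mulA : associative fps_mul.
Proof.
move=> a b c; apply/fpsP => n /=.
transitivity (\sum_(i < n.+1) \sum_(j < n.+1 | (i <= j)%N)
                 a i * (b (j - i)%N * c (n - j)%N)).
  apply: eq_bigr => i _; rewrite mulr_sumr.
  rewrite -(big_geq_mkord _ _ xpredT (fun j => a i * (b (j - i)%N * c (n - j)%N))).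
  have /= -> := big_addn 0 n.+1 i xpredT (fun j => a i * (b (j - i)%N * c (n - j)%N)).
  rewrite subSn -1?ltnS // big_mkord.
  by apply: eq_bigr => j _; rewrite addnK -subnDA [(j + i)%N]addnC.
rewrite (exchange_big_dep xpredT) //=; apply: eq_bigr => j _.
rewrite mulr_suml (big_ord_widen_cond n.+1 xpredT
  (fun i => a i * b (j - i)%N * c (n - j)%N)) //=.
by apply: eq_big => i; rewrite ?ltnS // => _; rewrite mulrA.
Qed.

Fact fps_mul1l : left_id (fpsC (1 : A)) fps_mul.
Proof.
move=> a; apply/fpsP => n; rewrite /= big_ord_recl /= mul1r subn0.
by rewrite big1 ?addr0 // => i _; rewrite mul0r.
Qed.

Fact fps_mul1r : right_id (fpsC (1 : A)) fps_mul.
Proof.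
move=> a; apply/fpsP => n; rewrite /= big_ord_recr /= subnn mulr1.
rewrite big1 ?add0r // => i _; case E: (n - i)%N => [|k]; last by rewrite mulr0.
by move/eqP: E; rewrite subn_eq0 leqNgt ltn_ord.
Qed.

Fact fps_mulDl : left_distributive fps_mul +%R.
Proof.
move=> a b c; apply/fpsP => n; rewrite fpsD /= -big_split /=.
by apply: eq_bigr => i _; exact: mulrDl.
Qed.

Fact fps_mulDr : right_distributive fps_mul +%R.
Proof.
move=> a b c; apply/fpsP => n; rewrite fpsD /= -big_split /=.
by apply: eq_bigr => i _; exact: mulrDr.
Qed.

HB.instance Definition _ := GRing.Zmodule_isPzRing.Build (fps A)
  fps_mulA fps_mul1l fps_mul1r fps_mulDl fps_mulDr.

Lemma fpsM a b n : (a * b) n = \sum_(i < n.+1) a i * b (n - i)%N.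
Proof. by []. Qed.
Lemma fps1 : (1 : fps A) = fpsC 1. Proof. by []. Qed.

(** The variable u^-1. *)
Definition fpsX : fps A := Fps (fun n => (n == 1%N)%:R).

(** The re-expansion of a(u - c) in u^-1, from
    (u - c)^-k = \sum_j 'C(k + j - 1, j) c^j u^-(k + j). *)
Definition fps_shift (c : nat) a : fps A := Fps (fun n =>
  \sum_(k < n.+1) a k *+ ('C(n.-1, n - k) * c ^ (n - k))).

End FpsRing.

Arguments fpsX {A}.

Section FpsNzRing.
Variable A : nzRingType.

Fact fps_oner_neq0 : (1 : fps A) != 0.
Proof.
apply/eqP => /(congr1 (fun f : fps A => f 0%N)) /eqP.
by rewrite fps1 fps0 /= oner_eq0.
Qed.

HB.instance Definition _ :=
  GRing.PzSemiRing_isNonZero.Build (fps A) fps_oner_neq0.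
End FpsNzRing.

Section FpsComRing.
Variable A : comPzRingType.

Fact fps_mulC : commutative (@fps_mul A).
Proof.
move=> a b; apply/fpsP => n /=; rewrite (reindex_inj rev_ord_inj) /=.
apply: eq_bigr => i _; rewrite subSS subKn; first exact: mulrC.
by rewrite -ltnS.
Qed.

HB.instance Definition _ :=
  GRing.PzRing_hasCommutativeMul.Build (fps A) fps_mulC.
End FpsComRing.

Section FpsAlgebra.
Variables (K : pzRingType) (A : algType K).
Implicit Types a b : fps A.

Definition fps_scale (c : K) a : fps A := Fps (fun n => c *: a n).

Fact fps_scaleA c d a : fps_scale c (fps_scale d a) = fps_scale (c * d) a.
Proof. by apply/fpsP => n; exact: scalerA. Qed.
Fact fps_scale1 : left_id 1 fps_scale.
Proof. by move=> a; apply/fpsP => n; exact: scale1r. Qed.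
Fact fps_scaleDr : right_distributive fps_scale +%R.
Proof. by move=> c a b; apply/fpsP => n; exact: scalerDr. Qed.
Fact fps_scaleDl a : {morph fps_scale^~ a : c d / c + d}.
Proof. by move=> c d; apply/fpsP => n; exact: scalerDl. Qed.

HB.instance Definition _ := GRing.Zmodule_isLmodule.Build K (fps A)
  fps_scaleA fps_scale1 fps_scaleDr fps_scaleDl.

Lemma fpsZ c a n : (c *: a) n = c *: a n. Proof. by []. Qed.

Fact fps_scaleAl (c : K) a b : c *: (a * b) = c *: a * b.
Proof.
apply/fpsP => n; rewrite fpsZ !fpsM scaler_sumr.
by apply: eq_bigr => i _; rewrite fpsZ scalerAl.
Qed.
HB.instance Definition _ :=
  GRing.Lmodule_isLalgebra.Build K (fps A) fps_scaleAl.

Fact fps_scaleAr (c : K) a b : c *: (a * b) = a * (c *: b).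
Proof.
apply/fpsP => n; rewrite fpsZ !fpsM scaler_sumr.
by apply: eq_bigr => i _; rewrite fpsZ scalerAr.
Qed.
HB.instance Definition _ :=
  GRing.Lalgebra_isAlgebra.Build K (fps A) fps_scaleAr.
End FpsAlgebra.

Section FpsMap.
Variables (A B : pzRingType) (f : {rmorphism A -> B}).

Definition fps_map (a : fps A) : fps B := Fps (fun n => f (a n)).

Fact fps_map_zmod : zmod_morphism fps_map.
Proof. by move=> a b; apply/fpsP => n; exact: rmorphB. Qed.
Fact fps_map_monoid : monoid_morphism fps_map.
Proof.
split=> [|a b]; apply/fpsP => n.
  by case: n => [|n]; [exact: rmorph1 | exact: rmorph0].
by rewrite /= rmorph_sum; apply: eq_bigr => i _; rewrite rmorphM.
Qed.
HB.instance Definition _ := GRing.isZmodMorphism.Build _ _ fps_map fps_map_zmod.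
HB.instance Definition _ :=
  GRing.isMonoidMorphism.Build _ _ fps_map fps_map_monoid.
End FpsMap.

(** Series in u^-1 and v^-1: (a : fps (fps A)) r s is the coefficient of
    u^-r v^-s.  A series in one variable is read in u or in v. *)

Definition in_u (A : zmodType) (a : fps A) : fps (fps A) :=
  Fps (fun r => fpsC (a r)).
Definition in_v (A : zmodType) (a : fps A) : fps (fps A) := fpsC a.

(** The two-sided ideal generated by G.  Algebras are nontrivial rings in this
    library, so the quotient below takes a proof that the ideal is proper. *)

Inductive ideal_of (F : pzRingType) (G : F -> Prop) : F -> Prop :=
| ideal_gen x : G x -> ideal_of G x
| ideal_zero : ideal_of G 0
| ideal_add x y : ideal_of G x -> ideal_of G y -> ideal_of G (x + y)
| ideal_mul a x b : ideal_of G x -> ideal_of G (a * x * b).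

Section QuotientAlgebra.
Variables (K : pzRingType) (F : algType K) (G : F -> Prop).
Hypothesis G_proper : ~ ideal_of G 1.

Definition ideal_pred : {pred F} := fun x => `[< ideal_of G x >].

Fact ideal_zmod_closed : zmod_closed ideal_pred.
Proof.
split; first by apply/asboolP; exact: ideal_zero.
move=> x y /asboolP Gx /asboolP Gy; apply/asboolP.
by apply: ideal_add => //; rewrite -[y]mulr1 -mulN1r mulrA; exact: ideal_mul.
Qed.
HB.instance Definition _ := GRing.isZmodClosed.Build F ideal_pred
  ideal_zmod_closed.

Definition quot_alg of ~ ideal_of G 1 := Quotient.quot ideal_pred.
Local Notation Q := (quot_alg G_proper).

HB.instance Definition _ := GRing.Zmodule.on Q.

Definition qpi (x : F) : Q := \pi_(Quotient.quot ideal_pred)%qT x.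
Definition qrepr (q : Q) : F := @generic_quotient.repr F (Quotient.quot ideal_pred) q.

Lemma qreprK : cancel qrepr qpi. Proof. exact: generic_quotient.reprK. Qed.

Lemma qpi_eq x y : qpi x = qpi y <-> ideal_of G (x - y).
Proof.
have E := Quotient.idealrBE ideal_pred x y.
split=> [h|h]; first by apply/asboolP; rewrite -[`[< _ >]]/(x - y \in ideal_pred) E; apply/eqP.
by apply/eqP; rewrite -E; apply/asboolP.
Qed.

Fact qpi_zmod : zmod_morphism qpi.
Proof. exact: (raddfB (\pi_(Quotient.quot ideal_pred)%qT)). Qed.
HB.instance Definition _ := GRing.isZmodMorphism.Build F Q qpi qpi_zmod.

Lemma qpi_repr x : ideal_of G (qrepr (qpi x) - x).
Proof. by apply/qpi_eq; rewrite qreprK. Qed.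

Definition qone : Q := qpi 1.
Definition qmul (p q : Q) : Q := qpi (qrepr p * qrepr q).
Definition qscale (c : K) (q : Q) : Q := qpi (c *: qrepr q).

Lemma qpiM x y : qpi (x * y) = qmul (qpi x) (qpi y).
Proof.
apply/esym/qpi_eq.
have -> : qrepr (qpi x) * qrepr (qpi y) - x * y =
  1 * (qrepr (qpi x) - x) * qrepr (qpi y) + x * (qrepr (qpi y) - y) * 1.
  by rewrite mul1r mulr1 mulrBl mulrBr addrA subrK.
by apply: ideal_add; apply: ideal_mul; exact: qpi_repr.
Qed.

Lemma qpiZ c x : qpi (c *: x) = qscale c (qpi x).
Proof.
apply/esym/qpi_eq; rewrite -scalerBr.
rewrite -[_ - x]mul1r scalerAl -[X in ideal_of _ X]mulr1.
exact/ideal_mul/qpi_repr.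
Qed.

Lemma qpiP (q : Q) : exists x, q = qpi x.
Proof. by exists (qrepr q); rewrite qreprK. Qed.

Fact qmulA : associative qmul.
Proof.
move=> p q r; have [x ->] := qpiP p; have [y ->] := qpiP q.
by have [z ->] := qpiP r; rewrite -!qpiM mulrA.
Qed.
Fact qmul1l : left_id qone qmul.
Proof. by move=> p; have [x ->] := qpiP p; rewrite -qpiM mul1r. Qed.
Fact qmul1r : right_id qone qmul.
Proof. by move=> p; have [x ->] := qpiP p; rewrite -qpiM mulr1. Qed.
Fact qmulDl : left_distributive qmul +%R.
Proof.
move=> p q r; have [x ->] := qpiP p; have [y ->] := qpiP q.
by have [z ->] := qpiP r; rewrite -raddfD -!qpiM -raddfD mulrDl.
Qed.
Fact qmulDr : right_distributive qmul +%R.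
Proof.
move=> p q r; have [x ->] := qpiP p; have [y ->] := qpiP q.
by have [z ->] := qpiP r; rewrite -raddfD -!qpiM -raddfD mulrDr.
Qed.
Fact qone_neq0 : qone != 0.
Proof.
apply/eqP; rewrite -[0](raddf0 qpi) => /qpi_eq; rewrite subr0; exact: G_proper.
Qed.
HB.instance Definition _ := GRing.Zmodule_isNzRing.Build Q
  qmulA qmul1l qmul1r qmulDl qmulDr qone_neq0.

Fact qscaleA c d q : qscale c (qscale d q) = qscale (c * d) q.
Proof. by have [x ->] := qpiP q; rewrite -!qpiZ scalerA. Qed.
Fact qscale1 : left_id 1 qscale.
Proof. by move=> q; have [x ->] := qpiP q; rewrite -qpiZ scale1r. Qed.
Fact qscaleDr : right_distributive qscale +%R.
Proof.
move=> c p q; have [x ->] := qpiP p; have [y ->] := qpiP q.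
by rewrite -raddfD -!qpiZ -raddfD scalerDr.
Qed.
Fact qscaleDl q : {morph qscale^~ q : c d / c + d}.
Proof.
move=> c d; have [x ->] := qpiP q.
by rewrite -!qpiZ -raddfD scalerDl.
Qed.
HB.instance Definition _ := GRing.Zmodule_isLmodule.Build K Q
  qscaleA qscale1 qscaleDr qscaleDl.

Fact qscaleAl (c : K) (p q : Q) : c *: (p * q) = c *: p * q.
Proof.
have [x ->] := qpiP p; have [y ->] := qpiP q.
by rewrite /GRing.scale /GRing.mul /= -!(qpiM, qpiZ) scalerAl.
Qed.
HB.instance Definition _ := GRing.Lmodule_isLalgebra.Build K Q qscaleAl.
Fact qscaleAr (c : K) (p q : Q) : c *: (p * q) = p * (c *: q).
Proof.
have [x ->] := qpiP p; have [y ->] := qpiP q.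
by rewrite /GRing.scale /GRing.mul /= -!(qpiM, qpiZ) scalerAr.
Qed.
HB.instance Definition _ := GRing.Lalgebra_isAlgebra.Build K Q qscaleAr.

Fact qpi_monoid : monoid_morphism qpi.
Proof. by split=> // x y; exact: qpiM. Qed.
HB.instance Definition _ := GRing.isMonoidMorphism.Build F Q qpi qpi_monoid.
Fact qpi_scalable : scalable qpi.
Proof. by move=> c x; exact: qpiZ. Qed.
HB.instance Definition _ := GRing.isScalable.Build K F Q _ qpi qpi_scalable.

End QuotientAlgebra.

Definition free_alg (K : comNzRingType) (X : choiceType) : Type :=
  {malg K[{fmonom X}]}.

Section FreeAlgebra.
Variables (K : comNzRingType) (X : choiceType).

HB.instance Definition _ := GRing.Lalgebra.on (free_alg K X).

Fact free_scaleAr (c : K) (x y : free_alg K X) : c *: (x * y) = x * (c *: y).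
Proof.
have C (z : free_alg K X) : z * c%:MP = c *: z.
  rewrite malgM_def fgmulgU malgZ_def; apply: eq_bigr => k _.
  by rewrite mulm1 mulrC.
by rewrite -!C mulrA.
Qed.
HB.instance Definition _ :=
  GRing.Lalgebra_isAlgebra.Build K (free_alg K X) free_scaleAr.

Definition free_gen (x : X) : free_alg K X := mkmalgU (fmu x) 1.

Definition free_aug : free_alg K X -> K :=
  @mcoeff {fmonom X} K mone.
HB.instance Definition _ := GRing.RMorphism.copy free_aug
  (@mcoeff {fmonom X} K mone).

End FreeAlgebra.

(** Operators on the n-th tensor power of V = K^N, with coefficients in A: the
    rows are indexed by the lower and the columns by the upper multi-index, so
    that X_(i_1...i_n)^(j_1...j_n) is [tentry X [tuple i_1; ...] [tuple j_1; ...]]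
    and *m is the product (X Y)_i^j = X_i^k Y_k^j. *)

Notation tensor_mx A N n := 'M[A]_#|{: n.-tuple 'I_N}|.

Definition tentry (A : Type) (N n : nat) (X : tensor_mx A N n)
  (s t : n.-tuple 'I_N) : A := X (enum_rank s) (enum_rank t).

Definition mk_tensor_mx (A : Type) (N n : nat)
  (F : n.-tuple 'I_N -> n.-tuple 'I_N -> A) : tensor_mx A N n :=
  \matrix_(a, b) F (enum_val a) (enum_val b).

Section Embeddings.
Variables (A : pzRingType) (N n : nat).

Definition agree_off (D : {pred 'I_n}) (s t : n.-tuple 'I_N) : bool :=
  [forall l, (l \notin D) ==> (tnth s l == tnth t l)].

Definition act1 (i : 'I_n) (X : 'M[A]_N) : tensor_mx A N n :=
  mk_tensor_mx (fun s t =>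
    if agree_off (pred1 i) s t then X (tnth s i) (tnth t i) else 0).

Definition act2 (i j : 'I_n) (X : tensor_mx A N 2) : tensor_mx A N n :=
  mk_tensor_mx (fun s t =>
    if agree_off (pred2 i j) s t
    then tentry X [tuple tnth s i; tnth s j] [tuple tnth t i; tnth t j]
    else 0).

(** X_(k k+1), for factors numbered from 1; meaningful for 1 <= k < n only. *)
Definition act_adj (k : nat) (X : tensor_mx A N 2) : tensor_mx A N n :=
  match insub k.-1, insub k with
  | Some i, Some j => act2 i j X
  | _, _ => 1%:M
  end.

End Embeddings.

Section Symmetry.
Variables (K : numFieldType) (N : nat).
Implicit Types R Psi : tensor_mx K N 2.

Definition involutive_symmetry R : Prop :=
  (act_adj 3 1 R *m act_adj 3 2 R *m act_adj 3 1 R =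
   act_adj 3 2 R *m act_adj 3 1 R *m act_adj 3 2 R) /\
  R *m R = 1%:M.

Definition skew_inverse R Psi : Prop := forall i k p q : 'I_N,
  \sum_(j < N) \sum_(l < N)
     tentry R [tuple i; j] [tuple k; l] * tentry Psi [tuple l; p] [tuple j; q] =
  (i == q)%:R * (p == k)%:R.

Definition Cmx Psi : 'M[K]_N :=
  \matrix_(i, j) \sum_(k < N) tentry Psi [tuple i; k] [tuple j; k].

(** The skew-symmetrizer P^(k), acting in the first k factors of the n-th
    tensor power (k <= n); P^(0) is the identity by convention. *)
Fixpoint skewsym (n : nat) R (k : nat) : tensor_mx K N n :=
  match k with
  | 0 | 1 => 1%:M
  | k'.+1 => (k'%:R / k'.+1%:R) *:
      (skewsym n R k' *m (k'%:R^-1%:M - act_adj n k' R) *m skewsym n R k')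
  end.

Definition birank_m0 R (m : nat) : Prop :=
  [/\ (2 <= m)%N, skewsym m R m != 0
    & forall k, (m < k)%N -> skewsym k R k = 0].

End Symmetry.

Lemma map_act1 (A B : pzRingType) (f : {rmorphism A -> B}) N n i (X : 'M[A]_N) :
  map_mx f (act1 (n:=n) i X) = act1 i (map_mx f X).
Proof.
apply/matrixP => p q; rewrite 2!mxE [RHS]mxE; case: ifP => _; last exact: rmorph0.
by rewrite mxE.
Qed.

Lemma map_defect (A B : pzRingType) (f : {rmorphism A -> B}) n (c d : A)
    (X Y Z : 'M[A]_n) :
  map_mx f ((c *: X - d%:M) *m Y *m X *m Z - Z *m X *m Y *m (c *: X - d%:M)) =
  (f c *: map_mx f X - (f d)%:M) *m map_mx f Y *m map_mx f X *m map_mx f Z -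
   map_mx f Z *m map_mx f X *m map_mx f Y *m (f c *: map_mx f X - (f d)%:M).
Proof. by rewrite map_mxB !map_mxM map_mxB map_mxZ map_scalar_mx. Qed.

Section BraidedYangian.
Variables (K : numFieldType) (N : nat) (R : tensor_mx K N 2).

(** For L(u) with coefficients in an algebra A, the difference of the two sides
    of R(u,v) L_1(u) R L_1(v) = L_1(v) R L_1(u) R(u,v), multiplied by
    (u - v) / (u v) = v^-1 - u^-1 so that it becomes a power series in u^-1 and
    v^-1: (v^-1 - u^-1) R(u,v) = (v^-1 - u^-1) R - u^-1 v^-1 I. *)
Definition yangian_defect (A : algType K) (L : 'M[fps A]_N) :
  tensor_mx (fps (fps A)) N 2 :=
  let x : fps (fps A) := in_u fpsX in
  let y : fps (fps A) := in_v fpsX in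
  let R' := map_mx (in_alg (fps (fps A))) R in
  let Ruv := (y - x) *: R' - (x * y)%:M in
  let L1u := act1 ord0 (map_mx (@in_u A) L) in
  let L1v := act1 ord0 (map_mx (@in_v A) L) in
  Ruv *m L1u *m R' *m L1v - L1v *m R' *m L1u *m Ruv.

(** The generator (i, j, k) is l_i^j[k.+1]. *)
Local Notation yangian_free := (free_alg K ('I_N * 'I_N * nat)%type).

Definition free_L : 'M[fps yangian_free]_N :=
  \matrix_(i, j) Fps (fun k =>
    if k is k'.+1 then free_gen K (i, j, k') else (i == j)%:R).

Definition yangian_relator (g : yangian_free) : Prop :=
  exists a b r s, g = yangian_defect free_L a b r s.

(** The augmentation L(u) -> I kills the relators. *)
Lemma yangian_proper : ~ ideal_of yangian_relator 1.
Proof.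
pose ep : {rmorphism yangian_free -> K} := @free_aug K _.
suff ep0 (x : yangian_free) : ideal_of yangian_relator x -> ep x = 0.
  by move=> /ep0/eqP; rewrite rmorph1 oner_eq0.
elim=> {x} [_ [a [b [r [s ->]]]]||x y _ Ex _ Ey|c x d _ Ex]; first last.
- by rewrite !rmorphM Ex mulr0 mul0r.
- by rewrite rmorphD Ex Ey addr0.
- exact: rmorph0.
pose phi : {rmorphism fps (fps yangian_free) -> fps (fps K)} :=
  fps_map (fps_map ep).
have epL i j n : ep (free_L i j n) = ((i == j) && (n == 0%N))%:R.
  rewrite mxE; case: n => [|n] /=; first by rewrite andbT rmorph_nat.
  by rewrite andbF /free_gen; apply: etrans (mcoeffU _ _ _) _; rewrite fm1_eq1.
have act1_1 (f : fps yangian_free -> fps (fps yangian_free)) :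
    (forall i j, phi (f (free_L i j)) = (i == j)%:R) ->
  map_mx phi (act1 (n := 2) ord0 (map_mx f free_L)) = 1%:M.
  move=> fL; apply/matrixP => p q; rewrite 2!mxE [RHS]mxE -(inj_eq enum_val_inj).
  have [Ds|Ds] := boolP (agree_off _ _ _); last first.
    rewrite rmorph0; case: eqP => // E; case/negP: Ds; rewrite E.
    by apply/forallP => l; rewrite eqxx implybT.
  rewrite (mxE _ (fun i j => f (free_L i j))) fL.
  congr ((nat_of_bool _)%:R); apply/eqP/eqP => [E|-> //].
  apply: eq_from_tnth => l; have [->//|l0] := eqVneq l ord0.
  by have /forallP/(_ l) := Ds; rewrite inE l0 => /eqP.
have phi_defect : map_mx phi (yangian_defect free_L) = 0.
  rewrite [LHS]map_defect !act1_1; first last.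
  - move=> i j; apply/fpsP => r'; apply/fpsP => s'.
    transitivity (if s' is 0 then ep (free_L i j r') else 0).
      by case: s' => [|s'] //; exact: rmorph0.
    by rewrite epL; case: (i == j); case: r'; case: s'.
  - move=> i j; apply/fpsP => r'; apply/fpsP => s'.
    transitivity (if r' is 0 then ep (free_L i j s') else 0).
      by case: r' => [|r'] //; exact: rmorph0.
    by rewrite epL; case: (i == j); case: r'; case: s'.
  rewrite !mulmx1 !mul1mx mulmxBl mulmxBr.
  by rewrite -scalemxAl -scalemxAr scalar_mxC subrr.
move/matrixP: phi_defect => /(_ a b); rewrite mxE [RHS]mxE.
exact: (congr1 (fun g : fps (fps K) => g r s)).
Qed.

Definition yangian := quot_alg yangian_proper.
HB.instance Definition _ := GRing.Algebra.on yangian.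

Definition yangian_L : 'M[fps yangian]_N :=
  \matrix_(i, j) Fps (fun k => qpi yangian_proper (free_L i j k)).

Lemma yangian_relations : yangian_defect yangian_L = 0.
Proof.
pose ph : {rmorphism fps (fps _) -> fps (fps (yangian))} :=
  fps_map (fps_map (qpi yangian_proper)).
transitivity (map_mx ph (yangian_defect free_L)); last first.
  apply/matrixP => a b; rewrite mxE [RHS]mxE.
  apply/fpsP => r; apply/fpsP => s.
  apply: etrans (_ : qpi _ 0 = 0); last exact: raddf0.
  by apply/qpi_eq; rewrite subr0; apply: ideal_gen; exists a, b, r, s.
apply/esym; rewrite [LHS]map_defect !map_act1.
have x0 : ph (in_u fpsX) = in_u fpsX.
  apply/fpsP => r; apply/fpsP => s; case: s => [|s]; last exact: raddf0.
  exact: (rmorph_nat (qpi yangian_proper)).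
have y0 : ph (in_v fpsX) = in_v fpsX.
  apply/fpsP => r; apply/fpsP => s; case: r => [|r]; last exact: raddf0.
  exact: (rmorph_nat (qpi yangian_proper)).
rewrite rmorphB rmorphM x0 y0.
have -> : map_mx ph (map_mx (in_alg _) R) = map_mx (in_alg (fps (fps yangian))) R.
  apply/matrixP => a b; rewrite mxE [LHS]/= mxE [RHS]mxE.
  apply/fpsP => r; apply/fpsP => s.
  apply: etrans (linearZ_LR (qpi yangian_proper) _ _) _.
  congr (_ *: _); case: r => [|r]; last exact: raddf0.
  by case: s => [|s]; [exact: rmorph1 | exact: raddf0].
have -> : map_mx ph (map_mx (@in_u _) free_L) = map_mx (@in_u _) yangian_L.
  apply/matrixP => a b; rewrite 2!mxE [RHS]mxE.
  apply/fpsP => r; apply/fpsP => s.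
  case: s => [|s]; last exact: raddf0.
  by apply: esym; apply: etrans (congr1 (fun g : fps _ => g r) (mxE _ _ a b)) _.
have -> : map_mx ph (map_mx (@in_v _) free_L) = map_mx (@in_v _) yangian_L.
  apply/matrixP => a b; rewrite 2!mxE [RHS]mxE.
  apply/fpsP => r; apply/fpsP => s.
  case: r => [|r]; last exact: raddf0.
  by apply: esym; apply: etrans (congr1 (fun g : fps _ => g s) (mxE _ _ a b)) _.
by [].
Qed.

End BraidedYangian.

(** In this section L stands for L(u), and [shift_mx c L] for L(u - c). *)
Section SymmetricFunctions.
Variables (K : numFieldType) (N : nat) (R Psi : tensor_mx K N 2).
Variables (A : algType K).
Local Notation B := (fps A).
Implicit Types L : 'M[B]_N.

Definition shift_mx (c : nat) L : 'M[B]_N := map_mx (fps_shift c) L.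

Definition Rtr (X : 'M[B]_N) : B :=
  \sum_(i < N) \sum_(j < N) Cmx Psi i j *: X j i.

(** Tr_R(2...n+1) X = Tr_(2...n+1) (X C_2 ... C_(n+1)). *)
Definition Rtr_but1 (n : nat) (X : tensor_mx B N n.+1) : 'M[B]_N :=
  \matrix_(i, j)
    \sum_(s : n.+1.-tuple 'I_N | tnth s ord0 == i)
    \sum_(t : n.+1.-tuple 'I_N | tnth t ord0 == j)
      (\prod_(l < n.+1 | l != ord0) Cmx Psi (tnth t l) (tnth s l))
        *: tentry X s t.

Definition Rk (n k : nat) : tensor_mx B N n :=
  map_mx (in_alg B) (act_adj n k R).
Definition Rk_inv (n k : nat) : tensor_mx B N n :=
  map_mx (in_alg B) (act_adj n k (invmx R)).

(** L with the overlined index k, for 1 <= k <= n + 1, on the tensor power of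
    order n + 1. *)
Fixpoint Lbar (n k : nat) L : tensor_mx B N n.+1 :=
  match k with
  | 0 | 1 => act1 ord0 L
  | k'.+1 => Rk n.+1 k' *m Lbar n k' L *m Rk_inv n.+1 k'
  end.

(** The skew-symmetric power of L(u); at k = 0, where it is not used, it is
    the identity. *)
Definition skew_power L (k : nat) : 'M[B]_N :=
  if k is n.+1 then
    Rtr_but1 (map_mx (in_alg B) (skewsym n.+1 R n.+1) *m
              \prod_(1 <= i < n.+2) Lbar n i (shift_mx i.-1 L))
  else 1%:M.

(** The matrix power L^[k](u), with L^[0](u) = I. *)
Definition matrix_power L (k : nat) : 'M[B]_N :=
  if k is n.+1 then
    Rtr_but1 ((\prod_(1 <= i < n.+2) Lbar n i (shift_mx (n.+1 - i) L)) *m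
              \prod_(1 <= i < n.+1) Rk n.+1 (n.+1 - i))
  else 1%:M.

Definition elem_sym L (k : nat) : B :=
  if k is 0 then 1 else Rtr (skew_power L k).

Definition power_sum L (k : nat) : B := Rtr (matrix_power L k).

End SymmetricFunctions.

(* Main.v *)
(** Write r_i for R acting on sites i, i+1 and ly_i for the matrix L(u - c)
    carried to site i by conjugation with r_0, ..., r_(i-1).  Evaluating the
    Yangian relation at v = u - d shows that inside the skew-symmetrizer P the
    spectral parameters of a word ly_0 ly_1 ... can be permuted freely.  Hence
    every summand of the Cayley-Hamilton-Newton identity is the partial R-trace
    of one and the same decreasing word times an operator in the r_i only, and
    the identity becomes the k-fold iteration of the recursion
      (k+1) P_(0..k) = P_(1..k) - k P_(1..k) r_0 P_(1..k).
    In bi-rank (m|0) this recursion degenerates to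
      P_(1..m) = m P_(1..m) r_0 P_(1..m),
    which makes the m-th skew power scalar and gives Cayley-Hamilton.  The same
    degeneracy collapses P_(1..m) R_0(u,v) R_1(u-1,v) ... R_(m-1)(u-m+1,v) to a
    scalar multiple of P_(1..m) r_0 ... r_(m-1), so that moving L(v) through the
    word of length m shows that e_m(u) commutes with L(v); no rank-one property
    of P is needed. *)

Require Import Defs.
From HB Require Import structures.
From mathcomp Require Import all_boot all_order all_algebra.
From mathcomp Require Import boolp monalg zify ring.

Set Implicit Arguments.
Unset Strict Implicit.
Unset Printing Implicit Defensive.

Import Order.TTheory GRing.Theory Num.Theory.
Local Open Scope ring_scope.

(** * Substitution in power series *)

(** The entries of L do not commute, so a trace is cyclic only for operators in the [r_i], never for
    words in L. This is why every summand is brought to one fixed word times an operator in the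
    [r_i]. The same e_q has to be traced over different groups of factors, and the bi-rank argument
    uses one factor more than the word occupies. All factors are therefore kept in one algebra: the
    identities are proved in an abstract [rtower], and [chain_tower] is the model to which they are
    applied. Its trace axioms are where skew-invertibility enters: [tr_r] comes directly from the
    skew inverse, [tr_conj] adds the braid relation and R^2 = I, and [tr_cyc] says that R commutes
    with C tensor C.

    Power series in u^-1 and v^-1 do not contain 1/(u - v), so the Yangian relation is used after
    multiplication by v^-1 - u^-1. Each substitution leaves a central scalar factor to cancel,
    whence the regularity lemmas. In the determinant argument these factors stay until the end. The
    dictionary between matrices and operators is stated for a ring morphism [g] out of the series in
    u, so that it serves L(u), L(u - q) and the setting with two independent variables alike. *)

Section FpsBasics.
Variable A : pzRingType.
Implicit Types (a b : fps A) (n k : nat).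

Lemma fpsMn a k n : (a *+ k) n = a n *+ k.
Proof. by elim: k => [//|k IH]; rewrite !mulrS fpsD IH. Qed.

Fact fpsC_zmod : zmod_morphism (@fpsC A).
Proof. by move=> a b; apply/fpsP => -[|n]; rewrite fpsD fpsN //= subr0. Qed.
Lemma fpsCM (c : A) a n : (fpsC c * a) n = c * a n.
Proof.
rewrite fpsM big_ord_recl subn0 big1 ?addr0 // => i _.
by rewrite mul0r.
Qed.

Lemma fpsMC (c : A) a n : (a * fpsC c) n = a n * c.
Proof.
rewrite fpsM big_ord_recr /= subnn big1 ?add0r // => i _.
by rewrite /fpsC /=; have := ltn_ord i; case: (n - i)%N (subn_gt0 i n) => [<- //|]; rewrite ?mulr0.
Qed.

Fact fpsC_monoid : monoid_morphism (@fpsC A).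
Proof. by split=> // a b; apply/fpsP => n; rewrite fpsCM; case: n => //= n; rewrite mulr0. Qed.
HB.instance Definition _ := GRing.isZmodMorphism.Build A (fps A) (@fpsC A) fpsC_zmod.
HB.instance Definition _ := GRing.isMonoidMorphism.Build A (fps A) (@fpsC A) fpsC_monoid.

Lemma fpsXM a n : (fpsX * a) n = if n is n'.+1 then a n' else 0.
Proof.
case: n => [|n]; rewrite fpsM.
  by rewrite big_ord_recl big_ord0 /= mul0r addr0.
rewrite !big_ord_recl /= mul0r add0r mul1r subSS subn0 big1 ?addr0 // => i _.
by rewrite mul0r.
Qed.

Lemma fpsMX a n : (a * fpsX) n = if n is n'.+1 then a n' else 0.
Proof.
case: n => [|n]; rewrite fpsM.
  by rewrite big_ord_recl big_ord0 /= mulr0 addr0.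
rewrite big_ord_recr /= subnn mulr0 addr0 big_ord_recr /= subSnn mulr1 big1 ?add0r // => i _.
rewrite (_ : (n.+1 - i == 1)%N = false) ?mulr0 //.
by have := ltn_ord i; lia.
Qed.

Lemma fpsX_central a : fpsX * a = a * fpsX.
Proof. by apply/fpsP => n; rewrite fpsXM fpsMX. Qed.

Lemma fpsXn k n : (fpsX ^+ k : fps A) n = (n == k)%:R.
Proof.
elim: k n => [|k IH] n; first by rewrite expr0 fps1; case: n.
by rewrite exprS fpsXM; case: n.
Qed.

Lemma fpsX_reg a : fpsX * a = 0 -> a = 0.
Proof.
move=> Xa; apply/fpsP => n; have XaS : (fpsX * a) n.+1 = 0 by rewrite Xa.
by rewrite fpsXM in XaS.
Qed.

Lemma fpsM_low a b k n : (forall i, (i < k)%N -> b i = 0) -> (n < k)%N -> (a * b) n = 0.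
Proof.
by move=> b0 nk; rewrite fpsM big1 // => i _; rewrite b0 ?mulr0 //; lia.
Qed.

Lemma fps_exp_low b k n : b 0%N = 0 -> (n < k)%N -> (b ^+ k) n = 0.
Proof.
move=> b0; elim: k n => // k IH n nk; rewrite exprS fpsM big1 // => -[[|i] ik] _ /=.
  by rewrite b0 mul0r.
by rewrite IH ?mulr0 //; lia.
Qed.

End FpsBasics.

Section Substitution.
Variables (A' A : pzRingType) (phi : {rmorphism A' -> fps A}) (z : fps A).
Hypothesis z0 : z 0%N = 0.
Hypothesis z_central : forall a, z * a = a * z.
Implicit Types (a b : fps A').

(** Substitution of [z] for u^-1, with coefficients carried along by [phi]. It serves twice: u^-1
    goes to (u - c)^-1 with constant coefficients, and v goes to u - d with coefficients that are
    themselves series. *)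
Definition fps_subst a : fps A := Fps (fun n => (\sum_(k < n.+1) phi (a k) * z ^+ k) n).

(** Since [z] has no constant term, [z ^+ k] starts in degree k: the terms beyond n do not reach
    coefficient n. *)
Lemma fps_substE m n a : (n <= m)%N ->
  fps_subst a n = (\sum_(k < m.+1) phi (a k) * z ^+ k) n.
Proof.
move=> nm; rewrite /= !fps_sum (big_ord_widen _ (fun k => (phi (a k) * z ^+ k) n)
  (_ : n.+1 <= m.+1)%N) //.
rewrite big_mkcond; apply: eq_bigr => k _; case: ltnP => // nk.
by rewrite (@fpsM_low _ _ _ k) // => i ik; apply: fps_exp_low.
Qed.

Lemma fps_subst_zmod : zmod_morphism fps_subst.
Proof.
move=> a b; apply/fpsP => n; rewrite fpsD fpsN /= !fps_sum -sumrB.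
by apply: eq_bigr => k _; rewrite -[phi _ in LHS]/(phi (a k - b k)) rmorphB mulrBl fpsD fpsN.
Qed.

Lemma fps_subst_monoid : monoid_morphism fps_subst.
Proof.
split.
  apply/fpsP => n; rewrite [LHS]/= big_ord_recl [phi _]rmorph1 mul1r expr0.
  by rewrite fpsD fps_sum big1 ?addr0 // => i _; rewrite [phi _]rmorph0 mul0r.
move=> a b; apply/fpsP => n.
(* The triangle k + l <= n is completed to a square; the added terms contain a power of [z] above n
   and contribute nothing to coefficient n. *)
have -> : fps_subst (a * b) n = (\sum_(k < n.+1) \sum_(l < n.+1) phi (a k * b l) * z ^+ (k + l)) n.
  rewrite /= !fps_sum.
  transitivity (\sum_(m < n.+1) \sum_(k < n.+1 | (k <= m)%N) (phi (a k * b (m - k)%N) * z ^+ m) n).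
    apply: eq_bigr => m _; rewrite rmorph_sum mulr_suml fps_sum.
    by rewrite (big_ord_widen_cond n.+1 xpredT (fun k => (phi (a k * b (m - k)%N) * z ^+ m) n)) //=;
       apply: eq_bigl => k; rewrite ltnS.
  rewrite (exchange_big_dep xpredT) //=; apply: eq_bigr => k _; rewrite fps_sum.
  rewrite -(big_geq_mkord _ _ xpredT (fun m => (phi (a k * b (m - k)%N) * z ^+ m) n)).
  have /= -> := big_addn 0 n.+1 k xpredT (fun m => (phi (a k * b (m - k)%N) * z ^+ m) n).
  rewrite big_mkord (big_ord_widen n.+1 (fun l => (phi (a k * b (l + k - k)%N) * z ^+ (l + k)) n)).
    rewrite big_mkcond; apply: eq_bigr => l _; rewrite addnK addnC; case: ltnP => // kl.
    by apply/esym/(@fpsM_low _ _ _ (k + l)) => [i ik|]; [exact: fps_exp_low | lia].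
  exact: leq_subr.
have sE c i : (i <= n)%N -> fps_subst c i = (\sum_(k < n.+1) phi (c k) * z ^+ k) i.
  exact: fps_substE.
have -> : (fps_subst a * fps_subst b) n =
  ((\sum_(k < n.+1) phi (a k) * z ^+ k) * (\sum_(k < n.+1) phi (b k) * z ^+ k)) n.
  by rewrite !fpsM; apply: eq_bigr => i _; rewrite !sE ?leq_subr // -ltnS.
congr fps_coef; rewrite mulr_suml; apply: eq_bigr => k _.
rewrite mulr_sumr; apply: eq_bigr => l _.
have zk c : z ^+ k * c = c * z ^+ k.
  elim: (k : nat) => [|m IH]; first by rewrite mul1r mulr1.
  by rewrite exprS -mulrA IH mulrA z_central mulrA.
by rewrite rmorphM exprD -!mulrA (mulrA (z ^+ k) (phi _)) (zk (phi _)) -mulrA.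
Qed.

End Substitution.

(** * Re-expansion of a(u - c) in powers of u^-1 *)

Section Shift.
Variable A : pzRingType.
Implicit Types a b : fps A.

(** The geometric series of (u - c)^-1 = u^-1 / (1 - c u^-1). *)
Definition fpsY c : fps A := Fps (fun n => if n is n'.+1 then (c ^ n')%:R else 0).

Lemma fpsYE c : fpsY c = fpsX + c%:R * fpsX * fpsY c.
Proof.
apply/fpsP => n; rewrite fpsD -mulrA mulr_natl fpsMn fpsXM; case: n => [|[|n]] /=.
- by rewrite mul0rn addr0.
- by rewrite mul0rn addr0.
- by rewrite add0r expnSr mulrnA.
Qed.

(** Pascal's rule applied to [fpsYE]. It identifies the explicit binomial formula of [fps_shift]
    with a substitution, from which multiplicativity of the shift follows. At n = 0 the truncated
    [n.-1] only meets 'C(0, 0). *)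
Lemma fpsY_exp c k n : (fpsY c ^+ k) n =
  if (k <= n)%N then ('C(n.-1, n - k) * c ^ (n - k))%:R else 0.
Proof.
elim: k n => [|k IHk] n; first by rewrite expr0 fps1 leq0n subn0; case: n => [|n] /=;
  rewrite ?bin0 // bin_small.
elim: n => [|n IHn]; first by rewrite fps_exp_low.
rewrite exprS {1}fpsYE mulrDl fpsD fpsXM -!mulrA -exprS mulr_natl fpsMn fpsXM IHk IHn /=.
rewrite ltnS subSS; case: ltngtP => kn.
- case: n kn {IHn} => // n kn; rewrite subSS /= subSn // binS -mulrnA -natrD.
  by congr (_%:R); rewrite mulnDl expnSr !mulnA.
- by rewrite mul0rn addr0.
- by rewrite kn subnn !bin0 mul0rn addr0.
Qed.

Lemma fps_shiftE c a : fps_shift c a = fps_subst (@fpsC A) (fpsY c) a.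
Proof.
apply/fpsP => n; rewrite /= fps_sum; apply: eq_bigr => k _.
by rewrite fpsCM fpsY_exp -ltnS ltn_ord mulr_natr.
Qed.

Lemma fpsY_central c a : fpsY c * a = a * fpsY c.
Proof.
apply/fpsP => n; rewrite !fpsM (reindex_inj rev_ord_inj) /=; apply: eq_bigr => i _.
rewrite subSS subKn; last by rewrite -ltnS.
by case: (n - i)%N => [|m]; rewrite ?mul0r ?mulr0 // mulr_natl mulr_natr.
Qed.

Lemma fpsY0 c : fpsY c 0%N = 0. Proof. by []. Qed.

Lemma fps_shift_fun c : @fps_shift A c = fps_subst (@fpsC A) (fpsY c).
Proof. by apply/funext => a; exact: fps_shiftE. Qed.

Fact fps_shift_zmod c : zmod_morphism (@fps_shift A c).
Proof. by rewrite fps_shift_fun; exact: fps_subst_zmod. Qed.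
Fact fps_shift_monoid c : monoid_morphism (@fps_shift A c).
Proof.
rewrite fps_shift_fun; apply: fps_subst_monoid; first exact: fpsY0.
exact: fpsY_central.
Qed.
HB.instance Definition _ c :=
  GRing.isZmodMorphism.Build (fps A) (fps A) (@fps_shift A c) (fps_shift_zmod c).
HB.instance Definition _ c :=
  GRing.isMonoidMorphism.Build (fps A) (fps A) (@fps_shift A c) (fps_shift_monoid c).

Lemma fps_shiftC c (a : A) : fps_shift c (fpsC a) = fpsC a.
Proof.
apply/fpsP => n; rewrite /= big_ord_recl big1 => [|k _]; last by rewrite mul0rn.
by case: n => [|n]; rewrite addr0 subn0 /= ?bin0 ?mulr1n // bin_small // mul0n mulr0n.
Qed.

Lemma fps_shiftX c : fps_shift c fpsX = fpsY c.
Proof.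
apply/fpsP => n; rewrite fps_shiftE /= fps_sum; case: n => [|n].
  by rewrite big_ord_recl big_ord0 fpsCM mul0r addr0.
rewrite !big_ord_recl big1 => [|k _]; last by rewrite fpsCM /= mul0r.
by rewrite !fpsCM [_ ^+ lift _ _]expr1 /= mul0r add0r addr0 mul1r.
Qed.

Lemma fps_shiftY c d : fps_shift c (fpsY d) = fpsY (c + d).
Proof.
apply/fpsP => -[|n] /=; first by rewrite big_ord_recl big_ord0 mul0rn addr0.
rewrite big_ord_recl mul0rn add0r expnDn natr_sum.
apply: eq_bigr => k _; have kn : (k <= n)%N by rewrite -ltnS.
rewrite lift0 subSS bin_sub // -mulrnA; congr (_%:R).
by rewrite mulnC -mulnA.
Qed.

Lemma fps_shift_shift c d a : fps_shift c (fps_shift d a) = fps_shift (c + d) a.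
Proof.
apply/fpsP => n; rewrite [in RHS]fps_shiftE.
(* Coefficient n depends on the coefficients up to n only, so the inner shift may be replaced by a
   polynomial in (u - d)^-1, to which the ring morphism property applies. *)
have loc b b' : (forall k, (k <= n)%N -> b k = b' k) ->
    fps_shift c b n = fps_shift c b' n.
  by move=> bb; rewrite /fps_shift /=; apply: eq_bigr => k _; rewrite bb // -ltnS.
rewrite (loc _ (\sum_(k < n.+1) fpsC (a k) * fpsY d ^+ k)); last first.
  by move=> k kn; rewrite fps_shiftE; exact: fps_substE.
rewrite rmorph_sum [RHS]/=; congr fps_coef; apply: eq_bigr => k _.
by rewrite rmorphM rmorphXn /= fps_shiftC fps_shiftY.
Qed.

End Shift.

Section ScalarExtension.
Variables (K : pzRingType) (A : algType K).

Lemma fps_shiftZ c (k : K) (a : fps A) : fps_shift c (k *: a) = k *: fps_shift c a.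
Proof.
apply/fpsP => n; rewrite fpsZ /= scaler_sumr; apply: eq_bigr => i _.
by rewrite scalerMnr.
Qed.

End ScalarExtension.

(** * Series in two variables and the substitution v = u - d *)

Section TwoVariables.
Variable A : pzRingType.

HB.instance Definition _ := GRing.RMorphism.copy (@in_u A) (fps_map (@fpsC A)).
HB.instance Definition _ := GRing.RMorphism.copy (@in_v A) (@fpsC (fps A)).

(** The substitution v = u - d. *)
Definition fps_diag (d : nat) : fps (fps A) -> fps A :=
  fps_subst (@fps_shift A d) fpsX.

Fact fps_diag_zmod d : zmod_morphism (fps_diag d).
Proof. exact: fps_subst_zmod. Qed.
Fact fps_diag_monoid d : monoid_morphism (fps_diag d).
Proof. by apply: fps_subst_monoid => // a; exact: fpsX_central. Qed.
HB.instance Definition _ d :=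
  GRing.isZmodMorphism.Build (fps (fps A)) (fps A) (fps_diag d) (fps_diag_zmod d).
HB.instance Definition _ d :=
  GRing.isMonoidMorphism.Build (fps (fps A)) (fps A) (fps_diag d) (fps_diag_monoid d).

Lemma fps_diag_u d a : fps_diag d (in_u a) = a.
Proof.
apply/fpsP => n.
have -> : fps_diag d (in_u a) n = (\sum_(k < n.+1) fps_shift d (fpsC (a k)) * fpsX ^+ k) n.
  by [].
rewrite fps_sum big_ord_recr fps_shiftC fpsCM fpsXn eqxx mulr1.
rewrite big1 => [|k _]; first exact: add0r.
by rewrite fps_shiftC fpsCM fpsXn gtn_eqF ?mulr0 //=.
Qed.

Lemma fps_diag_v d a : fps_diag d (in_v a) = fps_shift d a.
Proof.
apply/fpsP => n.
have -> : fps_diag d (in_v a) n =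
  (\sum_(k < n.+1) fps_shift d (fpsC a k) * fpsX ^+ k) n by [].
rewrite big_ord_recl expr0 mulr1 fpsD fps_sum big1 => [|k _]; first exact: addr0.
by rewrite [fps_shift d _](rmorph0 (fps_shift d)) mul0r.
Qed.

Lemma fps_shift_u c (a : fps A) : fps_shift c (in_u a) = in_u (fps_shift c a).
Proof.
apply/fpsP => r; apply/fpsP => n /=; rewrite fps_sum.
case: n => [|n]; first by apply: eq_bigr => k _; rewrite fpsMn.
by rewrite big1 // => k _; rewrite fpsMn mul0rn.
Qed.

Lemma fps_shift_v c (a : fps A) : fps_shift c (in_v a) = in_v a.
Proof. exact: fps_shiftC. Qed.

(** The factor is (u - v - j) / (u v). Multiplication by u^-1 lowers the outer index of the
    coefficient concerned, so induction on that index leaves only the v^-1 term, which merely shifts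
    coefficients. *)
Lemma vu_regular j (a : fps (fps A)) :
  (in_v fpsX - in_u fpsX - j%:R * (in_u fpsX * in_v fpsX)) * a = 0 -> a = 0.
Proof.
have uE b r s : (in_u fpsX * b : fps (fps A)) r s = if r is r'.+1 then b r' s else 0.
  have -> : (in_u fpsX : fps (fps A)) = fpsX.
    apply/fpsP => -[|[|n]]; apply/fpsP => -[|m] //=.
  by rewrite fpsXM; case: r.
have vE b r s : (in_v fpsX * b : fps (fps A)) r s = if s is s'.+1 then b r s' else 0.
  by rewrite fpsCM fpsXM; case: s.
move=> H; apply/fpsP => r; apply/fpsP; elim: r => [|r IH] s.
  have := congr1 (fun f : fps (fps A) => f 0%N s.+1) H.
  by rewrite !mulrBl -!mulrA !mulr_natl !fpsD !fpsN !fpsMn !uE vE subr0 mul0rn subr0.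
have := congr1 (fun f : fps (fps A) => f r.+1 s.+1) H.
by rewrite !mulrBl -!mulrA !mulr_natl !fpsD !fpsN !fpsMn !uE !vE !IH mul0rn !subr0.
Qed.

End TwoVariables.

(** * Skew-symmetrizers and R-traces *)

(** The operators on all tensor powers of V at once, with the R-trace over one
    factor: the factors are numbered from 0, [tower_r i] is R on the factors
    i and i+1, [tower_cent i x] says that x acts trivially on the factor i, and
    [tower_tr i x] is the R-trace over the factor i, tensored with the identity
    on that factor. *)
Record rtower (K : numFieldType) (E : algType K) := RTower {
  tower_tr : nat -> {linear E -> E};
  tower_r : nat -> E;
  tower_cent : nat -> E -> Prop;
  cent1 : forall i, tower_cent i 1;
  centD : forall i x y, tower_cent i x -> tower_cent i y -> tower_cent i (x + y);
  centZ : forall i (c : K) x, tower_cent i x -> tower_cent i (c *: x);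
  centM : forall i x y, tower_cent i x -> tower_cent i y -> tower_cent i (x * y);
  cent_central : forall i c, (forall x, c * x = x * c) -> tower_cent i c;
  cent_r : forall i j, i != j -> i != j.+1 -> tower_cent i (tower_r j);
  cent_comm : forall j x, tower_cent j x -> tower_cent j.+1 x -> tower_r j * x = x * tower_r j;
  r_sqr : forall j, tower_r j * tower_r j = 1;
  r_braid : forall j,
    tower_r j * tower_r j.+1 * tower_r j = tower_r j.+1 * tower_r j * tower_r j.+1;
  trMl : forall i x y, tower_cent i x -> tower_tr i (x * y) = x * tower_tr i y;
  trMr : forall i x y, tower_cent i x -> tower_tr i (y * x) = tower_tr i y * x;
  cent_tr : forall i x, tower_cent i (tower_tr i x);
  cent_tr_stable : forall i j x, tower_cent j x -> tower_cent j (tower_tr i x);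
  tr_r : forall i, tower_tr i.+1 (tower_r i) = 1;
  tr_conj : forall i x, tower_cent i.+1 x ->
    tower_tr i.+1 (tower_r i * x * tower_r i) = tower_tr i x;
  tr_cyc : forall i x,
    tower_tr i (tower_tr i.+1 (tower_r i * x)) = tower_tr i (tower_tr i.+1 (x * tower_r i))
}.

(** * Skew-symmetrizers: absorption and recursions *)

Section RingLemmas.
Variables (K : numFieldType) (E : algType K).

(** Here [a] and [p] are consecutive skew-symmetrizers, [t] is the generator joining them and [s]
    the next one. The recursion for [p] turns (k+1) p s p into s p - k a t s p; multiplication by
    [s] exchanges p and s p, and the braid relation with t p = - p changes the sign of a t s p. *)
Lemma skew_step_l (k : nat) (a p s t : E) :
  a * s = s * a -> a * p = p -> p * a = p ->
  k.+1%:R *: p = a - k%:R *: (a * t * a) ->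
  s * t * s = t * s * t -> t * p = - p -> s * s = 1 ->
  s * (p - k.+1%:R *: (p * s * p)) = - (p - k.+1%:R *: (p * s * p)).
Proof.
move=> as_ ap pa kp sts tp ss.
have kpsp : k.+1%:R *: (p * s * p) = s * p - k%:R *: (a * t * s * p).
  rewrite -mulrA scalerAl kp mulrBl; congr (_ - _).
    by rewrite mulrA as_ -mulrA ap.
  by rewrite -scalerAl -!mulrA (mulrA a s) as_ -mulrA ap.
have E1 : s * (s * p) = p by rewrite mulrA ss mul1r.
have E2 : s * (a * t * s * p) = - (a * t * s * p).
  have -> : s * (a * t * s * p) = a * (s * t * s) * p.
    by rewrite !mulrA as_.
  by rewrite sts -!mulrA tp !mulrN.
rewrite kpsp !mulrBr E1 -scalerAr E2 scalerN opprK !opprB.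
by rewrite opprD addrA addrAC.
Qed.

Lemma skew_step_r (k : nat) (a p s t : E) :
  a * s = s * a -> a * p = p -> p * a = p ->
  k.+1%:R *: p = a - k%:R *: (a * t * a) ->
  s * t * s = t * s * t -> p * t = - p -> s * s = 1 ->
  (p - k.+1%:R *: (p * s * p)) * s = - (p - k.+1%:R *: (p * s * p)).
Proof.
move=> as_ ap pa kp sts pt ss.
have kpsp : k.+1%:R *: (p * s * p) = p * s - k%:R *: (p * s * t * a).
  rewrite scalerAr kp mulrBr; congr (_ - _).
    by rewrite -mulrA -as_ mulrA pa.
  by rewrite -scalerAr !mulrA -(mulrA p s a) -as_ mulrA pa.
have E1 : p * s * s = p by rewrite -mulrA ss mulr1.
have E2 : p * s * t * a * s = - (p * s * t * a).
  have -> : p * s * t * a * s = p * (s * t * s) * a.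
    by rewrite -!mulrA as_.
  by rewrite sts !mulrA pt !mulNr.
rewrite kpsp !mulrBl E1 -scalerAl E2 scalerN opprK !opprB.
by rewrite opprD addrA addrAC.
Qed.

End RingLemmas.

Section Words.
Variables (K : numFieldType) (E : algType K) (T : rtower E).
Implicit Types (x y z : E) (i j k : nat).
Local Notation tr := (tower_tr T).
Local Notation r := (tower_r T).
Local Notation cent := (tower_cent T).

(** The skew-symmetrizer on the factors i, ..., i+k-1. *)
Fixpoint askew i k : E :=
  match k with
  | 0 | 1 => 1
  | k'.+1 => (k'%:R / k'.+1%:R) *:
      (askew i k' * (k'%:R^-1 *: 1 - r (i + k').-1) * askew i k')
  end.

(** Skew-symmetrizers are the same expression in the [r_j] at every position. A relation compatible
    with the algebra operations therefore has to be checked on the [r_j] only; commutation,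
    translation and cyclicity are all obtained this way. *)
Lemma askew_rel (Q : E -> E -> Prop) i i' k :
  Q 1 1 ->
  (forall x y x' y', Q x x' -> Q y y' -> Q (x + y) (x' + y')) ->
  (forall x y x' y', Q x x' -> Q y y' -> Q (x * y) (x' * y')) ->
  (forall (c : K) x x', Q x x' -> Q (c *: x) (c *: x')) ->
  (forall j, (j.+1 < k)%N -> Q (r (i + j)) (r (i' + j))) ->
  Q (askew i k) (askew i' k).
Proof.
move=> Q1 QD QM QZ; elim: k => [|[|k] IH] Qr //.
have Qk : Q (askew i k.+1) (askew i' k.+1) by apply: IH => j jk; apply: Qr; lia.
apply: (QZ); apply: (QM) => //; apply: (QM) => //; apply: (QD); first exact: QZ.
by rewrite -scaleN1r -[X in Q _ X]scaleN1r !addnS /=; apply: QZ; exact: Qr.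
Qed.

Lemma askew_comm x i k : (forall j, (j.+1 < k)%N -> r (i + j) * x = x * r (i + j)) ->
  askew i k * x = x * askew i k.
Proof.
move=> rx; apply: (@askew_rel (fun y y' => y * x = x * y')) => //.
- by rewrite mul1r mulr1.
- by move=> *; rewrite mulrDl mulrDr; congr (_ + _).
- by move=> y z y' z' Hy Hz; rewrite -mulrA Hz !mulrA Hy.
- by move=> c y y' H; rewrite -scalerAl H scalerAr.
Qed.

Lemma askew_cent i k j : (j < i)%N || (i + k <= j)%N -> (0 < k)%N -> cent j (askew i k).
Proof.
move=> ij k0; apply: (@askew_rel (fun y _ => cent j y) _ i) => //.
- exact: cent1.
- by move=> *; apply: centD.
- by move=> *; apply: centM.
- by move=> *; apply: centZ.
- by move=> l lk; apply: cent_r; lia.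
Qed.

Lemma r_comm i j : (i.+1 < j)%N -> r i * r j = r j * r i.
Proof. by move=> ij; apply: cent_comm; apply: cent_r; lia. Qed.

Lemma r_comm' i j : (i.+1 < j)%N -> r j * r i = r i * r j.
Proof. by move/r_comm. Qed.

Lemma nat_neq0 k : (k.+1%:R : K) != 0. Proof. by rewrite pnatr_eq0. Qed.

Lemma askewSS i k : askew i k.+2 = (k.+1%:R / k.+2%:R) *:
  (askew i k.+1 * (k.+1%:R^-1 *: 1 - r (i + k)) * askew i k.+1).
Proof. by rewrite [LHS]/= addnS. Qed.

(** The normalisation of the recursion: where every r acts as -1, each step multiplies by this
    number. *)
Lemma skew_coef k : k.+1%:R / k.+2%:R * (k.+1%:R^-1 + 1) = 1 :> K.
Proof.
rewrite mulrDr mulr1 mulrAC divff ?nat_neq0 // mul1r.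
by rewrite -[X in X + _]mul1r -mulrDl nat1r divff ?nat_neq0.
Qed.

Lemma askew_id i k x :
  (forall j, (j.+1 < k)%N -> r (i + j) * x = - x) -> askew i k * x = x.
Proof.
elim: k => [|[|k] IH] rx; rewrite ?mul1r //.
have px : askew i k.+1 * x = x by apply: IH => j jk; apply: rx; lia.
rewrite askewSS -!scalerAl -!mulrA px mulrBl -scalerAl mul1r rx //.
rewrite opprK mulrDr -scalerAr px -[X in _ + X]scale1r -scalerDl scalerA.
by rewrite skew_coef scale1r.
Qed.

Lemma askew_id_r i k x :
  (forall j, (j.+1 < k)%N -> x * r (i + j) = - x) -> x * askew i k = x.
Proof.
elim: k => [|[|k] IH] rx; rewrite ?mulr1 //.
have px : x * askew i k.+1 = x by apply: IH => j jk; apply: rx; lia.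
rewrite askewSS -!scalerAr !mulrA px mulrBr -scalerAr mulr1 rx //.
rewrite opprK mulrDl -scalerAl px -[X in _ + X]scale1r -scalerDl scalerA.
by rewrite skew_coef scale1r.
Qed.

Lemma askew_absorb i k :
  (forall j, (j.+1 < k)%N -> r (i + j) * askew i k = - askew i k) /\
  (forall j, (j.+1 < k)%N -> askew i k * r (i + j) = - askew i k).
Proof.
(* The recursion has to be carried along in the induction: absorbing the newest generator rewrites
   the previous skew-symmetrizer by the recursion one order lower. *)
suff: [/\ forall j, (j.+1 < k)%N -> r (i + j) * askew i k = - askew i k,
  forall j, (j.+1 < k)%N -> askew i k * r (i + j) = - askew i k &
  (0 < k)%N -> k%:R *: askew i k =
    askew i k.-1 - k.-1%:R *: (askew i k.-1 * r (i + k.-2) * askew i k.-1)].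
  by case.
elim: k => [|[|k] [IH1 IH2 IH3]]; first by split.
  by split=> // _; rewrite scale0r subr0 /= scale1r.
set p := askew i k.+1 in IH1 IH2 IH3.
have pp : p * p = p by apply: askew_id.
have pE : k.+2%:R *: askew i k.+2 = p - k.+1%:R *: (p * r (i + k) * p).
  rewrite askewSS -/p scalerA [X in X *: _]mulrC divfK ?nat_neq0 //.
  rewrite mulrBr mulrBl scalerBr -scalerAr mulr1 -scalerAl pp scalerA.
  by rewrite divff ?nat_neq0 // scale1r.
have inj x y : k.+2%:R *: x = k.+2%:R *: y -> x = y.
  by apply: scalerI; exact: nat_neq0.
split=> // j jk; apply: inj; rewrite scalerN.
  rewrite scalerAr pE.
  have [jk'|jk'] := ltnP j k.
    by rewrite mulrBr -scalerAr !mulrA IH1 // !mulNr scalerN opprB opprK addrC.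
  have -> : j = k by lia.
  case: k @p IH1 IH2 IH3 pp {pE jk jk'} => [|k] p IH1 IH2 IH3 pp.
    by rewrite /p mul1r mulr1 scale1r mulrBr mulr1 r_sqr opprB.
  apply: (@skew_step_l _ _ k.+1 (askew i k.+1) _ _ (r (i + k))).
  - apply: askew_comm => l lk; rewrite r_comm //; lia.
  - by apply: askew_id => l lk; apply: IH1; lia.
  - by apply: askew_id_r => l lk; apply: IH2; lia.
  - exact: IH3.
  - by rewrite addnS r_braid.
  - exact: IH1.
  - exact: r_sqr.
rewrite scalerAl pE.
have [jk'|jk'] := ltnP j k.
  by rewrite mulrBl -scalerAl -!mulrA IH2 // !mulrN scalerN opprB opprK addrC.
have -> : j = k by lia.
case: k @p IH1 IH2 IH3 pp {pE jk jk'} => [|k] p IH1 IH2 IH3 pp.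
  by rewrite /p mul1r mulr1 scale1r mulrBl mul1r r_sqr opprB.
apply: (@skew_step_r _ _ k.+1 (askew i k.+1) _ _ (r (i + k))).
- apply: askew_comm => l lk; rewrite r_comm //; lia.
- by apply: askew_id => l lk; apply: IH1; lia.
- by apply: askew_id_r => l lk; apply: IH2; lia.
- exact: IH3.
- by rewrite addnS r_braid.
- exact: IH2.
- exact: r_sqr.
Qed.

Lemma r_askew i k j : (i <= j)%N -> (j.+1 < i + k)%N ->
  r j * askew i k = - askew i k.
Proof.
move=> ij jk; have [H _] := askew_absorb i k.
by rewrite -(subnKC ij) H //; lia.
Qed.

Lemma askew_r i k j : (i <= j)%N -> (j.+1 < i + k)%N ->
  askew i k * r j = - askew i k.
Proof.
move=> ij jk; have [_ H] := askew_absorb i k.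
by rewrite -(subnKC ij) H //; lia.
Qed.

Lemma askewMl i k j n : (i <= j)%N -> (j + n <= i + k)%N ->
  askew j n * askew i k = askew i k.
Proof. by move=> ij jn; apply: askew_id => l ln; apply: r_askew; lia. Qed.

Lemma askewMr i k j n : (i <= j)%N -> (j + n <= i + k)%N ->
  askew i k * askew j n = askew i k.
Proof. by move=> ij jn; apply: askew_id_r => l ln; apply: askew_r; lia. Qed.

(** The defining recursion splits off the last factor, this one the first. The right-hand side is
    fixed by the full skew-symmetrizer, since every r_j acts on it as -1; on the other hand the
    skew-symmetrizer absorbs all its factors and leaves a multiple of itself. *)
Lemma askew_mirror i k : k.+1%:R *: askew i k.+1 =
  askew i.+1 k - k%:R *: (askew i.+1 k * r i * askew i.+1 k).
Proof.
elim: k i => [|k IH] i; first by rewrite scale1r scale0r subr0.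
set q := askew i.+1 k.+1; set x := RHS.
have <- : askew i k.+2 * x = x.
  apply: askew_id => -[|j] jk; last first.
    rewrite /x mulrBr -scalerAr !mulrA r_askew ?mulNr; try lia.
    by rewrite scalerN opprB opprK addrC.
  rewrite /x addn0; case: k @q @x IH jk => [|k] q x IH jk.
    by rewrite /q mul1r mulr1 scale1r mulrBr mulr1 r_sqr opprB.
  apply: (@skew_step_l _ _ k.+1 (askew i.+2 k.+1) _ _ (r i.+1)).
  - apply: askew_comm => l lk; rewrite r_comm' //; lia.
  - by apply: askewMl; lia.
  - by apply: askewMr; lia.
  - exact: IH.
  - exact: r_braid.
  - by apply: r_askew; lia.
  - exact: r_sqr.
have pq : askew i k.+2 * q = askew i k.+2 by apply: askewMr; lia.
rewrite /x mulrBr -scalerAr !mulrA pq askew_r ?mulNr ?pq; try lia.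
by rewrite scalerN opprK -[X in _ = X + _]scale1r -scalerDl nat1r.
Qed.

Fixpoint rprod i k : E := if k is k'.+1 then rprod i k' * r (i + k') else 1.

Lemma rprodS i k : rprod i k.+1 = r i * rprod i.+1 k.
Proof.
elim: k => [|k IH]; first by rewrite /= addn0 mul1r mulr1.
by rewrite -[LHS]/(rprod i k.+1 * _) IH -mulrA addnS.
Qed.

(** The mirror recursion unrolled: the inner skew-symmetrizer commutes with [r i] and is absorbed by
    the outer one. *)
Lemma askew_sum i k : k.+1%:R *: askew i k.+1 =
  askew i.+1 k * \sum_(0 <= j < k.+1) (-1) ^+ j *: rprod i j.
Proof.
elim: k i => [|k IH] i; first by rewrite big_nat1 !scale1r mulr1.
rewrite askew_mirror scalerAr IH mulrA -(mulrA (askew _ _) (r i)).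
rewrite -askew_comm; last by move=> j jk; rewrite r_comm' //; lia.
rewrite mulrA askewMr; try lia.
rewrite [in RHS]big_nat_recl // scale1r mulrDr mulr1; congr (_ + _).
rewrite -mulrA -mulrN; congr (_ * _).
rewrite mulr_sumr -sumrN; apply: eq_bigr => j _.
by rewrite rprodS -scalerAr exprS mulN1r scaleNr.
Qed.

End Words.

(** * Iterated R-traces and the overlined operators *)

Section Traces.
Variables (K : numFieldType) (E : algType K) (T : rtower E).
Implicit Types (x y z : E) (i j k : nat).
Local Notation tr := (tower_tr T).
Local Notation r := (tower_r T).
Local Notation cent := (tower_cent T).
Local Notation askew := (askew T).
Local Notation rprod := (rprod T).

Fixpoint trs i n x : E := if n is n'.+1 then trs i n' (tr (i + n') x) else x.

Fact trs_is_linear i n : linear (trs i n).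
Proof. by elim: n => [|n IH] c x y //=; rewrite linearP IH. Qed.
HB.instance Definition _ i n :=
  GRing.isLinear.Build K E E _ (trs i n) (trs_is_linear i n).

Lemma trsD i n x y : trs i n (x + y) = trs i n x + trs i n y.
Proof. exact: linearD. Qed.

Lemma trsB i n x y : trs i n (x - y) = trs i n x - trs i n y.
Proof. exact: linearB. Qed.

Lemma trsZ i n c x : trs i n (c *: x) = c *: trs i n x.
Proof. exact: linearZ. Qed.

Lemma trs_cat i n k x : trs i (n + k) x = trs i n (trs (i + n) k x).
Proof. by elim: k x => [|k IH] x; rewrite ?addn0 // addnS /= IH addnA. Qed.

Lemma trsS i n x : trs i n.+1 x = tr i (trs i.+1 n x).
Proof. by rewrite -add1n trs_cat /= addn0 addn1. Qed.

Lemma trsMl i n x y : (forall l, (i <= l < i + n)%N -> cent l x) ->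
  trs i n (x * y) = x * trs i n y.
Proof.
elim: n y => [|n IH] y cx //=; rewrite trMl; last by apply: cx; lia.
by rewrite IH // => l ?; apply: cx; lia.
Qed.

Lemma trsMr i n x y : (forall l, (i <= l < i + n)%N -> cent l x) ->
  trs i n (y * x) = trs i n y * x.
Proof.
elim: n y => [|n IH] y cx //=; rewrite trMr; last by apply: cx; lia.
by rewrite IH // => l ?; apply: cx; lia.
Qed.

Lemma cent_trs_stable i n j x : cent j x -> cent j (trs i n x).
Proof. by elim: n x => [|n IH] x // cx; apply/IH/cent_tr_stable. Qed.

Lemma cent_trs i n j x : (i <= j < i + n)%N -> cent j (trs i n x).
Proof.
elim: n x => [|n IH] x ij; first by lia.
have [->|jn] := eqVneq j (i + n)%N.
  by rewrite /=; apply: cent_trs_stable; apply: cent_tr.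
by apply: IH; lia.
Qed.

(** The traces over factors above j + 1 let [r j] pass, and those over j and j + 1 are cyclic for it
    by [tr_cyc]. The remaining outer traces then see equal arguments. *)
Lemma trs_cyc i n j x : (i <= j)%N -> (j.+1 < i + n)%N ->
  trs i n (r j * x) = trs i n (x * r j).
Proof.
move=> ij jn; have -> : n = (j - i + (2 + (i + n - j.+2)))%N by lia.
have cr l : (j.+2 <= l < j.+2 + (i + n - j.+2))%N -> cent l (r j).
  by move=> ?; apply: cent_r; lia.
rewrite !trs_cat /= !subnKC // addn0 addn1 addn2.
by rewrite [trs _ _ (r j * x)]trsMl // [trs _ _ (x * r j)]trsMr // tr_cyc.
Qed.

Lemma trs_cyc_askew i n j k x : (i <= j)%N -> (j + k <= i + n)%N ->
  trs i n (askew j k * x) = trs i n (x * askew j k).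
Proof.
move=> ij jn; move: x.
apply: (@askew_rel _ _ T (fun y y' => forall x, trs i n (y * x) = trs i n (x * y')) j).
- by move=> x; rewrite mul1r mulr1.
- by move=> y z y' z' Hy Hz x; rewrite mulrDl mulrDr !trsD Hy Hz.
- by move=> y z y' z' Hy Hz x; rewrite -(mulrA y) Hy -(mulrA z) Hz mulrA.
- by move=> c y y' Hy x; rewrite -scalerAl -scalerAr !trsZ Hy.
- by move=> l lk x; apply: trs_cyc; lia.
Qed.

(** L with the overlined index j+1.  It is locked because unification would
    otherwise match [lbar x j.+1] with a product. *)
Fixpoint lbar_rec x j : E :=
  if j is j'.+1 then r j' * lbar_rec x j' * r j' else x.
Fact lbar_key : unit. Proof. exact: tt. Qed.
Definition lbar := locked_with lbar_key lbar_rec.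

Lemma lbar0 x : lbar x 0 = x.
Proof. by rewrite [lbar]unlock. Qed.

Lemma lbarS x j : lbar x j.+1 = r j * lbar x j * r j.
Proof. by rewrite [lbar]unlock. Qed.

Definition based x := forall j, (0 < j)%N -> cent j x.

Lemma cent_lbar x i j : based x -> (j < i)%N -> cent i (lbar x j).
Proof.
move=> bx; elim: j => [|j IH] ji; first by rewrite lbar0; exact: bx.
rewrite lbarS.
by do 2?apply: centM; try (by apply: cent_r; lia); apply: IH; lia.
Qed.

(** For j < i the two operators act on different factors. For i + 1 < j the essential case is j = i
    + 2: the braid relation turns [r i] into [r i.+1], which passes [lbar x i], and back again on
    the other side. Further conjugations commute with [r i]. *)
Lemma r_lbar x i j : based x -> (j < i)%N || (i.+1 < j)%N ->
  r i * lbar x j = lbar x j * r i.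
Proof.
move=> bx; have lt_case j' : (j' < i)%N -> r i * lbar x j' = lbar x j' * r i.
  by move=> ji; apply: cent_comm; apply: cent_lbar => //; lia.
case/orP => [|ij]; first exact: lt_case.
have -> : j = ((j - i.+2) + i).+2 by lia.
elim: (j - i.+2)%N => [|d IH].
  rewrite add0n !lbarS; set z := lbar x i.
  have zr : r i.+1 * z = z * r i.+1.
    by apply: cent_comm; apply: cent_lbar => //; lia.
  rewrite !mulrA r_braid -!mulrA; congr (_ * (_ * _)).
  by rewrite !mulrA zr -!mulrA; congr (_ * _); rewrite !mulrA r_braid.
have : (i.+1 < (d + i).+2)%N by lia.
rewrite addSn; move: (d + i).+2 IH => j' IH ij'.
rewrite lbarS !mulrA r_comm // -(mulrA (r j') (r i)) IH -!mulrA.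
by rewrite r_comm.
Qed.

(** Conjugation by r_j r_(j+1) shifts r_j and [lbar x j] by one factor. *)
Lemma lbar_exchange al be x x' j :
  (forall z, al * z = z * al) -> (forall z, be * z = z * be) ->
  based x -> based x' ->
  (al * r 0 - be) * x * (r 0 * x' * r 0) = x' * (r 0 * x * r 0) * (al * r 0 - be) ->
  (al * r j - be) * lbar x j * lbar x' j.+1 = lbar x' j * lbar x j.+1 * (al * r j - be).
Proof.
move=> Cal Cbe bx bx' ex; elim: j => [|j IH]; first by rewrite !lbarS !lbar0.
pose f y := r j * r j.+1 * y * (r j.+1 * r j).
have fM y z : f y * f z = f (y * z).
  rewrite /f !mulrA -(mulrA _ (r j) (r j)) r_sqr mulr1.
  by rewrite -(mulrA _ (r j.+1) (r j.+1)) r_sqr mulr1.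
have f_r : f (al * r j - be) = al * r j.+1 - be.
  rewrite /f mulrBr mulrBl; congr (_ - _).
    rewrite [_ * (al * _)]mulrA -Cal -!mulrA; congr (al * _).
    have -> : r j * (r j.+1 * (r j * (r j.+1 * r j))) =
       r j * (r j.+1 * r j * r j.+1) * r j by rewrite !mulrA.
    by rewrite -r_braid !mulrA r_sqr mul1r -!mulrA r_sqr mulr1.
  rewrite -Cbe -[LHS]mulrA -[RHS]mulr1; congr (_ * _).
  by rewrite mulrA -(mulrA (r j)) r_sqr mulr1 r_sqr.
have f_l y : based y -> f (lbar y j) = lbar y j.+1.
  move=> by_; rewrite /f -(mulrA (r j) (r j.+1)) r_lbar ?ltnSn // !mulrA.
  by rewrite -(mulrA _ (r j.+1) (r j.+1)) r_sqr mulr1 lbarS.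
have f_l' y : based y -> f (lbar y j.+1) = lbar y j.+2.
  move=> by_; have E1 : f (lbar y j.+1) = r j * lbar y j.+2 * r j.
    by rewrite /f !lbarS !mulrA.
  by rewrite E1 r_lbar ?ltnSn ?orbT // -mulrA r_sqr mulr1.
move/(congr1 f): IH; rewrite -(fM _ (lbar x' _)) -(fM _ (lbar x _)).
rewrite -[in RHS](fM _ (_ - be)) -(fM _ (lbar x _)).
by rewrite f_r !f_l // !f_l'.
Qed.

End Traces.
Arguments askew : simpl never.

(** * Permuting the spectral parameters of a word *)

Section SpectralWords.
Variables (K : numFieldType) (E : algType K) (T : rtower E) (y : nat -> E).
Implicit Types (x z : E) (i j k : nat) (s t : seq nat).
Local Notation tr := (tower_tr T).
Local Notation trs := (trs T).
Local Notation r := (tower_r T).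
Local Notation cent := (tower_cent T).
Local Notation askew := (askew T).
Local Notation rprod := (rprod T).
Local Notation lbar := (lbar T).
Local Notation based := (based T).
Hypothesis y_based : forall c, based (y c).
(** With [y c] for L_1(u - c) this is the Yangian relation at the parameters u - c and u - d, whose
    difference is d - c. It is multiplied by d - c to clear the denominator, and by r_0 on the
    right. *)
Hypothesis y_exchange : forall c d, (c < d)%N ->
  ((d - c)%:R *: r 0 - 1) * y c * (r 0 * y d * r 0) =
  y d * (r 0 * y c * r 0) * ((d - c)%:R *: r 0 - 1).

Fixpoint word i s : E :=
  if s is c :: s' then lbar (y c) i * word i.+1 s' else 1.

Lemma word_cat i s t : word i (s ++ t) = word i s * word (i + size s) t.
Proof.
elim: s i => [|c s IH] i /=; first by rewrite addn0 mul1r.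
by rewrite IH mulrA addSnnS.
Qed.

Lemma cent_word i s j : (i + size s <= j)%N -> cent j (word i s).
Proof.
elim: s i => [|c s IH] i /= ij; first exact: cent1.
apply: centM; [apply: cent_lbar => //; lia | apply: IH; lia].
Qed.

Lemma r_word i s j : (j.+1 < i)%N || (i + size s <= j)%N ->
  r j * word i s = word i s * r j.
Proof.
elim: s i => [|c s IH] i /= ij; first by rewrite mulr1 mul1r.
rewrite mulrA r_lbar //; last by lia.
by rewrite -mulrA IH ?mulrA //; lia.
Qed.

Lemma askew_word i s j k : (j + k <= i)%N || (i + size s <= j)%N ->
  askew j k * word i s = word i s * askew j k.
Proof. by move=> ij; apply: askew_comm => l lk; apply: r_word; lia. Qed.

Lemma lbar_rel c d j : (c < d)%N ->
  ((d - c)%:R *: r j - 1) * (lbar (y c) j * lbar (y d) j.+1) =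
  lbar (y d) j * lbar (y c) j.+1 * ((d - c)%:R *: r j - 1).
Proof.
move=> cd; rewrite mulrA.
have := @lbar_exchange _ _ T ((d - c)%:R *: 1) 1 (y c) (y d) j.
rewrite -!scalerAl !mul1r; apply => //.
- by move=> z; rewrite -scalerAl -scalerAr mul1r mulr1.
- by move=> z; rewrite mul1r mulr1.
exact: y_exchange.
Qed.

Lemma word_rel i s t c d (j := (i + size s)%N) (D := ((d - c)%:R *: r j - 1)) :
  (c < d)%N ->
  D * word i (s ++ [:: c, d & t]) = word i (s ++ [:: d, c & t]) * D.
Proof.
move=> cd; have cD z : r j * z = z * r j -> D * z = z * D.
  by move=> H; rewrite mulrBl mulrBr -scalerAl -scalerAr H mul1r mulr1.
rewrite !word_cat -/j /= !mulrA cD; last by apply: r_word; lia.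
rewrite -[in LHS](mulrA _ _ (lbar _ j.+1)) -(mulrA _ D) lbar_rel //.
rewrite -!mulrA; do 3!congr (_ * _); apply: cD.
by apply: r_word; lia.
Qed.

Lemma askew_r_lin i k j (a : K) : (i <= j)%N -> (j.+1 < i + k)%N ->
  askew i k * (a *: r j - 1) = - (a + 1) *: askew i k.
Proof.
move=> ij jk; rewrite mulrBr -scalerAr askew_r // mulr1 scalerN.
by rewrite scaleNr scalerDl scale1r opprD.
Qed.

Lemma r_lin_askew i k j (a : K) : (i <= j)%N -> (j.+1 < i + k)%N ->
  (a *: r j - 1) * askew i k = - (a + 1) *: askew i k.
Proof.
move=> ij jk; rewrite mulrBl -scalerAl r_askew // mul1r scalerN.
by rewrite scaleNr scalerDl scale1r opprD.
Qed.

(** Between two skew-symmetrizers a (d - c) r_j - 1 acts as the nonzero scalar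
    -(d - c + 1) on either side. *)
Lemma word_swap i s t c d n (p := askew i n) :
  n = (size s + (size t).+2)%N -> (c < d)%N ->
  p * word i (s ++ [:: c, d & t]) * p = p * word i (s ++ [:: d, c & t]) * p.
Proof.
move=> En cd; have n0 : - ((d - c)%:R + 1) != 0 :> K.
  by rewrite oppr_eq0 natr1 pnatr_eq0.
apply: (scalerI n0); rewrite [LHS]scalerAl [in LHS]scalerAl.
rewrite -(askew_r_lin (j := i + size s)) ?leq_addr //; last by lia.
rewrite -(mulrA p (_ - 1)) word_rel // -!mulrA r_lin_askew ?leq_addr //; last by lia.
by rewrite -!scalerAr.
Qed.

Lemma word_bubble i s t c s' n (p := askew i n) :
  n = (size s + (size s' + size t).+1)%N -> all (ltn c) s' ->
  p * word i (s ++ c :: s' ++ t) * p = p * word i (s ++ s' ++ c :: t) * p.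
Proof.
rewrite /p {p}; elim: s' s => [//|d s' IH] s /= En /andP[cd cs].
rewrite word_swap //; last by rewrite En size_cat; lia.
by rewrite -cat_rcons IH ?cat_rcons // size_rcons; lia.
Qed.

(** The smallest letter of the segment stands first; it is moved to the end by swaps of the form
    allowed by [word_swap], and the rest is reversed recursively. *)
Lemma word_rev i s t u n (p := askew i n) :
  n = (size s + (size t + size u))%N -> sorted ltn t ->
  p * word i (s ++ t ++ u) * p = p * word i (s ++ rev t ++ u) * p.
Proof.
rewrite /p {p}; elim: t u => [//|c t IH] u /= En ct.
rewrite (@word_bubble i s u c t) ?(order_path_min ltn_trans ct) //.
by rewrite rev_cons cat_rcons IH ?(path_sorted ct) //=; lia.
Qed.

(** For consecutive parameters the exchange factor is r_j - 1. The skew-symmetrizer times it is -2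
    times the skew-symmetrizer, hence the constant -1/2. Passing through the word, the factor
    reaches the right end, where (r_j - 1) r_j = -(r_j - 1). *)
Lemma askew_word_r i c k j : (i <= j)%N -> (j.+1 < i + k)%N ->
  askew i k * word i (iota c k) * r j = - (askew i k * word i (iota c k)).
Proof.
move=> ij jk; pose s := iota c (j - i); pose t := iota (c + (j - i)).+2 (i + k - j.+2).
have sj : (i + size s = j)%N by rewrite size_iota; lia.
have -> : iota c k = s ++ [:: (c + (j - i))%N, (c + (j - i)).+1 & t].
  rewrite {1}(_ : k = (j - i) + (2 + (i + k - j.+2)))%N; last by lia.
  by rewrite !iotaD addn2.
have := @word_rel i s t _ _ (ltnSn (c + (j - i))); rewrite sj subSnn scale1r => rel.
set W := word _ _ in rel *; set W' := word _ _ in rel.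
have pW : askew i k * W = (- 2%:R^-1) *: (askew i k * W' * (r j - 1)).
  rewrite -mulrA -rel mulrA -[r j]scale1r askew_r_lin // -scalerAl scalerA.
  by rewrite mulrNN mulVf ?pnatr_eq0 ?scale1r.
rewrite pW -scalerAl -scalerN; congr (_ *: _).
by rewrite -(mulrA _ (r j - 1)) mulrBl mul1r r_sqr -[1 - _]opprB mulrN.
Qed.

Lemma r_word_askew i c k j : (i <= j)%N -> (j.+1 < i + k)%N ->
  r j * (word i (rev (iota c k)) * askew i k) = - (word i (rev (iota c k)) * askew i k).
Proof.
move=> ij jk; pose c' := (c + (i + k - j.+2))%N.
pose s := rev (iota c'.+2 (j - i)); pose t := rev (iota c (i + k - j.+2)).
have sj : (i + size s = j)%N by rewrite size_rev size_iota; lia.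
have -> : rev (iota c k) = s ++ [:: c'.+1, c' & t].
  rewrite {1}(_ : k = (i + k - j.+2) + (2 + (j - i)))%N; last by lia.
  rewrite !iotaD !rev_cat addn2 -catA; congr (_ ++ _).
have := @word_rel i s t _ _ (ltnSn c'); rewrite sj subSnn scale1r => rel.
set W' := word _ (_ ++ [:: c', _ & _]) in rel *; set W := word _ _ in rel *.
have pW : W * askew i k = (- 2%:R^-1) *: ((r j - 1) * W' * askew i k).
  rewrite rel -mulrA -[r j]scale1r r_lin_askew // -scalerAr scalerA.
  by rewrite mulrNN mulVf ?pnatr_eq0 ?scale1r.
rewrite pW -scalerAr -scalerN; congr (_ *: _).
by rewrite !mulrA mulrBr mulr1 r_sqr -[1 - _]opprB !mulNr.
Qed.

Lemma askew_iota i c k :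
  askew i k * word i (iota c k) * askew i k = askew i k * word i (iota c k).
Proof. by apply: askew_id_r => j jk; apply: askew_word_r; lia. Qed.

Lemma askew_iota_rev i c k :
  askew i k * word i (rev (iota c k)) * askew i k = word i (rev (iota c k)) * askew i k.
Proof. by rewrite -mulrA askew_id // => j jk; apply: r_word_askew; lia. Qed.

(** Each side equals its own word placed between two skew-symmetrizers, and there the order of the
    parameters is immaterial. This converts the increasing words of the skew powers into the
    decreasing ones of the matrix powers. *)
Lemma askew_word_iota i c k :
  askew i k * word i (iota c k) = word i (rev (iota c k)) * askew i k.
Proof.
rewrite -askew_iota -askew_iota_rev.
have := @word_rev i [::] (iota c k) [::] k; rewrite /= !cats0 size_iota.
by apply; rewrite ?addn0 ?iota_ltn_sorted.
Qed.

End SpectralWords.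

(** * Translation by one factor *)

Section Shift.
Variables (K : numFieldType) (E : algType K) (T : rtower E).
Implicit Types (x z : E) (i j k : nat) (s t : seq nat).
Local Notation tr := (tower_tr T).
Local Notation trs := (trs T).
Local Notation r := (tower_r T).
Local Notation cent := (tower_cent T).
Local Notation askew := (askew T).
Local Notation rprod := (rprod T).
Local Notation lbar := (lbar T).
Local Notation based := (based T).

(** The inverse of [rprod i k]. For i = 0 it is also the product R_k ... R_1 that closes the matrix
    powers. *)
Fixpoint rprodV i k : E := if k is k'.+1 then r (i + k') * rprodV i k' else 1.

Lemma rprodK i k : rprod i k * rprodV i k = 1.
Proof.
elim: k => [|k IH] /=; first by rewrite mulr1.
by rewrite mulrA -(mulrA _ (r _) (r _)) r_sqr mulr1.
Qed.

Lemma rprodVS i k : rprodV i k.+1 = rprodV i.+1 k * r i.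
Proof.
elim: k => [|k IH]; first by rewrite /= addn0 mul1r mulr1.
by rewrite -[LHS]/(_ * rprodV i k.+1) IH mulrA addnS.
Qed.

Lemma cent_rprod i k j : (j < i)%N || (i + k < j)%N -> cent j (rprod i k).
Proof.
elim: k => [|k IH] ij /=; first exact: cent1.
by apply: centM; [apply: IH; lia | apply: cent_r; lia].
Qed.

Lemma rprodV_comm i k x : (forall l, (l < k)%N -> r (i + l) * x = x * r (i + l)) ->
  rprodV i k * x = x * rprodV i k.
Proof.
elim: k => [|k IH] rx /=; first by rewrite mul1r mulr1.
by rewrite -mulrA IH ?mulrA ?rx // => l lk; apply: rx; lia.
Qed.

Lemma cent_rprodV i k j : (j < i)%N || (i + k < j)%N -> cent j (rprodV i k).
Proof.
elim: k => [|k IH] ij /=; first exact: cent1.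
by apply: centM; [apply: cent_r; lia | apply: IH; lia].
Qed.

Lemma r_rprod i k j : (j.+1 < i)%N || (i + k < j)%N ->
  r j * rprod i k = rprod i k * r j.
Proof. by move=> ij; apply: cent_comm; apply: cent_rprod; lia. Qed.

Lemma rprod_r j k i : (j <= i)%N -> (i.+1 < j + k)%N ->
  rprod j k * r i = r i.+1 * rprod j k.
Proof.
elim: k => [|k IH] ji ik; first by lia.
rewrite /=; have [ik'|ik'] := ltnP i.+1 (j + k).
  by rewrite -mulrA -r_comm // !mulrA IH.
case: k IH ik ik' => [|k] _ ik ik'; first by lia.
have -> : i = (j + k)%N by lia.
rewrite /= addnS -(mulrA _ (r _) (r _.+1)) -mulrA r_braid !mulrA.
by rewrite -r_rprod //; lia.
Qed.

Lemma rprod_lbar x j k i : based x -> (j <= i < j + k)%N ->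
  rprod j k * lbar x i = lbar x i.+1 * rprod j k.
Proof.
move=> bx; elim: k => [|k IH] ijk; first by lia.
rewrite /=; have [ik'|ik'] := ltnP i (j + k).
  by rewrite -mulrA r_lbar ?ik' // !mulrA IH //; lia.
have -> : i = (j + k)%N by lia.
have rl l : (l <= k)%N -> rprod j l * lbar x (j + k).+1 = lbar x (j + k).+1 * rprod j l.
  elim: l => [|l IHl] lk /=; first by rewrite mul1r mulr1.
  by rewrite -mulrA r_lbar ?mulrA ?IHl //; lia.
rewrite -mulrA; have -> : r (j + k) * lbar x (j + k) = lbar x (j + k).+1 * r (j + k).
  by rewrite lbarS -(mulrA _ (r _) (r _)) r_sqr mulr1.
by rewrite mulrA rl // mulrA.
Qed.

(** The word w = r_j ... r_(j+k-1) carries the factors j, ..., j+k-1 to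
    j+1, ..., j+k. *)
Lemma trs_rprod j k x : cent (j + k) x ->
  trs j.+1 k (rprod j k * x * rprodV j k) = trs j k x.
Proof.
elim: k x => [|k IH] x cx /=; first by rewrite mul1r mulr1.
have -> : rprod j k * r (j + k) * x * (r (j + k) * rprodV j k) =
  rprod j k * (r (j + k) * x * r (j + k)) * rprodV j k by rewrite !mulrA.
rewrite addnS in cx; rewrite addSn trMr; last by apply: cent_rprodV; lia.
rewrite (trMl (x := rprod j k)) ?tr_conj //; last by apply: cent_rprod; lia.
by rewrite IH //; apply: cent_tr.
Qed.

Lemma rprod_askew j k i n : (j <= i)%N -> (i + n <= j + k)%N ->
  rprod j k * askew i n = askew i.+1 n * rprod j k.
Proof.
move=> ji ink.
apply: (@askew_rel _ _ T (fun y y' => rprod j k * y = y' * rprod j k)).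
- by rewrite mul1r mulr1.
- by move=> *; rewrite mulrDl mulrDr; congr (_ + _).
- by move=> y z y' z' Hy Hz; rewrite mulrA Hy -mulrA Hz mulrA.
- by move=> c y y' H; rewrite -scalerAl -H scalerAr.
- by move=> l ln; rewrite rprod_r //; lia.
Qed.

End Shift.

(** * The identities in an abstract tower *)

Section Main.
Variables (K : numFieldType) (E : algType K) (T : rtower E) (y : nat -> E).
Implicit Types (x z : E) (i j k : nat) (s t : seq nat).
Local Notation tr := (tower_tr T).
Local Notation trs := (trs T).
Local Notation r := (tower_r T).
Local Notation cent := (tower_cent T).
Local Notation askew := (askew T).
Local Notation rprod := (rprod T).
Local Notation rprodV := (rprodV T).
Local Notation lbar := (lbar T).
Local Notation based := (based T).
Local Notation word := (word T y).
Hypothesis y_based : forall c, based (y c).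
Hypothesis y_exchange : forall c d, (c < d)%N ->
  ((d - c)%:R *: r 0 - 1) * y c * (r 0 * y d * r 0) =
  y d * (r 0 * y c * r 0) * ((d - c)%:R *: r 0 - 1).

Lemma rprod_word j k i s : (j <= i)%N -> (i + size s <= j + k)%N ->
  rprod j k * word i s = word i.+1 s * rprod j k.
Proof.
elim: s i => [|c s IH] i ji /= ik; first by rewrite mul1r mulr1.
by rewrite mulrA rprod_lbar ?ji -?mulrA ?IH //; lia.
Qed.

(** Here [j] is the first factor occupied and [c] a global shift of the parameter: with [y c] for
    L(u - c), the next three definitions model e_k(u - c), the k-th skew power at u - c, and L^[k](u
    - c). *)
Definition skew_word j c k := askew j k * word j (iota c k).

Definition elemt c k := trs 0 k (skew_word 0 c k).

Definition wedge c k := trs 1 k.-1 (skew_word 0 c k).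

Definition mpow c k := trs 1 k.-1 (word 0 (rev (iota c k)) * rprodV 0 k.-1).

Lemma cent_skew_word j c k i : (j + k <= i)%N -> cent i (skew_word j c k).
Proof.
case: k => [|k] jk; first by rewrite /skew_word /= mulr1; exact: cent1.
apply: centM; first by apply: askew_cent => //; rewrite jk orbT.
by apply: cent_word => //; rewrite size_iota.
Qed.

(** Conjugation by [rprod j k] moves the whole skew word one factor to the right, and [trs_rprod]
    says that the traces follow. Thus e_k can be placed on factors that are still free. *)
Lemma elemt_shift j c k : trs j k (skew_word j c k) = elemt c k.
Proof.
elim: j => // j <-; rewrite -[RHS]trs_rprod; last exact: cent_skew_word.
congr (trs _ _ _); rewrite /skew_word mulrA rprod_askew // -(mulrA (askew _ _)).
by rewrite rprod_word ?size_iota // mulrA -mulrA rprodK mulr1.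
Qed.

(** This expresses that e_k is a scalar with coefficients in the algebra, acting trivially on every
    factor; commutation with L is a different matter. *)
Lemma cent_elemt c k i : cent i (elemt c k).
Proof.
have [ik|ki] := ltnP i k; first by apply: cent_trs; rewrite add0n.
by apply: cent_trs_stable; apply: cent_skew_word.
Qed.

Section CayleyHamiltonNewton.
Variable k : nat.
Hypothesis k_gt0 : (0 < k)%N.
Let W := word 0 (rev (iota 0 k)).
Let F z := trs 1 k.-1 (W * z).

(** The part of [W] on the factors of the skew-symmetrizer is again a consecutive decreasing word,
    so [askew_iota_rev] applies to it; the parts on either side commute with the
    skew-symmetrizer. *)
Lemma askew_W_askew j n : (j + n <= k)%N -> askew j n * W * askew j n = W * askew j n.
Proof.
move=> jn; pose a := (k - (j + n))%N.
have -> : W = word 0 (rev (iota (a + n) j)) * word j (rev (iota a n)) *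
              word (j + n) (rev (iota 0 a)).
  rewrite /W {1}(_ : k = a + n + j)%N; last by rewrite /a; lia.
  rewrite -addnA iotaD iotaD !rev_cat !word_cat size_cat !size_rev !size_iota.
  by rewrite !add0n.
have c2 : askew j n * word (j + n) (rev (iota 0 a)) =
          word (j + n) (rev (iota 0 a)) * askew j n.
  by apply: askew_word => //; rewrite leqnn.
rewrite !mulrA (askew_word (y := y)) // ?size_rev ?size_iota ?leqnn ?orbT //.
rewrite -!mulrA -!c2 !mulrA; congr (_ * _).
by rewrite -!mulrA; congr (_ * _); rewrite mulrA askew_iota_rev.
Qed.

(** By cyclicity the last skew-symmetrizer moves in front of [W], where [askew_W_askew] removes it.
    Factor 0 is not traced, which is why 0 < j. *)
Lemma F_askew j n z : (0 < j)%N -> (j + n <= k)%N ->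
  F (askew j n * z * askew j n) = F (askew j n * z).
Proof.
move=> j0 jn; rewrite /F !mulrA -trs_cyc_askew //; last by lia.
by rewrite !mulrA askew_W_askew.
Qed.

Lemma FB z z' : F (z - z') = F z - F z'.
Proof. by rewrite /F mulrBr trsB. Qed.

Lemma FZ c z : F (c *: z) = c *: F z.
Proof. by rewrite /F -scalerAr trsZ. Qed.

(** [a j] will be the summand L^[j](u - k + j) e_(k-j)(u). [b j] is the telescoping remainder: [b 0]
    is k times the skew power, and [b k] vanishes through its coefficient. *)
Let a j := F (askew j (k - j) * rprodV 0 j.-1).
Let b j := (k - j)%:R *: F (askew j (k - j) * rprodV 0 j).

(** The mirror recursion for the skew-symmetrizer on factors j, ..., k-1. In the quadratic term the
    second copy commutes with [rprodV 0 j] and is removed by [F_askew], and the freed [r j]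
    lengthens [rprodV 0 j]. *)
Lemma ab_rec j : (j < k)%N -> b j = a j.+1 - b j.+1.
Proof.
move=> jk; rewrite /b /a /=; have -> : (k - j = (k - j.+1).+1)%N by lia.
set n := (k - j.+1)%N; rewrite -FZ scalerAl askew_mirror mulrBl FB -scalerAl FZ.
congr (_ - _ *: _); rewrite -(mulrA (_ * r j)).
have -> : askew j.+1 n * rprodV 0 j = rprodV 0 j * askew j.+1 n.
  apply: askew_comm => l ln; apply: cent_comm; apply: cent_rprodV; lia.
rewrite mulrA -(mulrA _ (r j)) F_askew //; last by rewrite /n; lia.
Qed.

Lemma a_sum n : (n <= k)%N ->
  \sum_(0 <= q < n) (-1) ^+ q *: a (k - q) = (-1) ^+ n.+1 *: b (k - n).
Proof.
elim: n => [|n IH] nk; first by rewrite big_geq // subn0 /b subnn scale0r scaler0.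
rewrite big_nat_recr //= IH; last by lia.
have -> : b (k - n.+1) = a (k - n) - b (k - n).
  by rewrite ab_rec ?subnSK //; lia.
rewrite [in RHS]exprS [in RHS]exprS mulrA mulrNN mul1r scalerBr addrC exprS mulN1r.
by rewrite mul1r scaleNr.
Qed.

Lemma wedgeE : k%:R *: wedge 0 k = b 0.
Proof.
rewrite /b subn0 /wedge /skew_word askew_word_iota //.
by rewrite /= mulr1.
Qed.

(** With e_q moved to the factors n, ..., k-1, the letters k-1, ..., q of the matrix power are
    followed by q-1, ..., 0, and the concatenation is exactly [W]. *)
Lemma mpow_elemt q : (q < k)%N -> mpow q (k - q) * elemt 0 q = a (k - q).
Proof.
move=> qk; set n := (k - q)%N; have n0 : (0 < n)%N by rewrite /n; lia.
rewrite -trsMr; last by move=> *; exact: cent_elemt.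
rewrite -(elemt_shift n) -trsMl; last first.
  move=> l nl; apply: centM; last by apply: cent_rprodV; lia.
  by apply: cent_word; rewrite // size_rev size_iota; lia.
have -> : trs n q = trs (1 + n.-1) q by rewrite add1n prednK.
rewrite -trs_cat /a /F; have -> : (n.-1 + q = k.-1)%N by rewrite /n; lia.
congr (trs _ _ _); rewrite /skew_word askew_word_iota //.
have -> : (k - n = q)%N by rewrite /n; lia.
have -> : W = word 0 (rev (iota q n)) * word n (rev (iota 0 q)).
  rewrite /W {1}(_ : k = q + n)%N; last by rewrite /n; lia.
  by rewrite iotaD rev_cat word_cat size_rev size_iota add0n.
rewrite -!mulrA; congr (_ * _); rewrite !mulrA.
rewrite rprodV_comm; last by move=> l ln; rewrite r_word //; lia.
rewrite -!mulrA; congr (_ * _); rewrite rprodV_comm // => l ln.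
by rewrite askew_comm // => i iq; rewrite r_comm' //; lia.
Qed.

Theorem cayley_hamilton_newton_tower :
  (-1) ^+ k.+1 *: (k%:R *: wedge 0 k) =
  \sum_(0 <= q < k) (-1) ^+ q *: (mpow q (k - q) * elemt 0 q).
Proof.
rewrite wedgeE -[in b _](subnn k) -a_sum //.
by apply: eq_big_nat => q qk; rewrite mpow_elemt.
Qed.

End CayleyHamiltonNewton.

(** * Bi-rank (m|0): Cayley-Hamilton and the determinant *)

Section CayleyHamilton.
Variable m : nat.
Hypothesis m_gt1 : (1 < m)%N.
Hypothesis askew0 : askew 0 m.+1 = 0.

Lemma askew_r_askew : m%:R *: (askew 1 m * r 0 * askew 1 m) = askew 1 m.
Proof.
by apply/esym/eqP; rewrite -subr_eq0 -askew_mirror askew0 scaler0.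
Qed.

Lemma skew_word_shift : rprod 0 m * skew_word 0 0 m * rprodV 0 m = skew_word 1 0 m.
Proof.
rewrite /skew_word mulrA rprod_askew // -(mulrA (askew _ _)).
by rewrite rprod_word ?size_iota // mulrA -mulrA rprodK mulr1.
Qed.

(** Both sides are obtained from the R-trace over the factors 1, ..., m of
    r_0 times the skew word on these factors: the bi-rank condition gives the
    right-hand side, and undoing the shift of the word the left-hand side. *)
Lemma cayley_hamilton_tower : m%:R *: wedge 0 m = elemt 0 m.
Proof.
have idem : askew 1 m * askew 1 m = askew 1 m by apply: askewMl.
transitivity (m%:R *: trs 1 m (r 0 * skew_word 1 0 m)).
  congr (_ *: _); rewrite -skew_word_shift /wedge.
  have: cent m (skew_word 0 0 m) by apply: cent_skew_word.
  move: (skew_word 0 0 m) => X cX; rewrite -(prednK (ltnW m_gt1)).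
  rewrite rprodS rprodVS !mulrA r_sqr mul1r trsS.
  rewrite trsMr; last by move=> *; apply: cent_r; lia.
  rewrite trs_rprod; last by rewrite add1n prednK //; lia.
  rewrite trMl ?tr_r ?mulr1 //; apply: cent_trs; lia.
have pX : askew 1 m * skew_word 1 0 m = skew_word 1 0 m.
  by rewrite /skew_word mulrA idem.
have Xp : skew_word 1 0 m * askew 1 m = skew_word 1 0 m by apply: askew_iota.
rewrite -(elemt_shift 1); move: (skew_word 1 0 m) pX Xp => X pX Xp.
rewrite -{1}Xp mulrA -trs_cyc_askew // -{1}pX -trsZ; congr (trs _ _ _).
have -> : askew 1 m * (r 0 * (askew 1 m * X)) = askew 1 m * r 0 * askew 1 m * X.
  by rewrite !mulrA.
by rewrite scalerAl askew_r_askew pX.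
Qed.

(** [z] stands for L_1(v), [q] for u^-1 v^-1 and [d c] for v^-1 - u^-1 - c u^-1 v^-1 = (u - c - v) /
    (u v). Hence [d c * r j - q] is R_j(u - c, v) cleared of its denominator. *)
Variables (z q : E) (d : nat -> E).
Hypothesis z_based : based z.
Hypothesis q_central : forall x, q * x = x * q.
Hypothesis d_central : forall c x, d c * x = x * d c.
Hypothesis dS : forall c, d c.+1 = d c - q.
Hypothesis z_exchange : forall c,
  (d c * r 0 - q) * y c * (r 0 * z * r 0) = z * (r 0 * y c * r 0) * (d c * r 0 - q).

Fixpoint fprod k := if k is k'.+1 then fprod k' * (d k' * r k' - q) else 1.

Fixpoint dprod k := if k is k'.+1 then dprod k' * d k' else 1.

Lemma dprod_central k x : dprod k * x = x * dprod k.
Proof.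
elim: k x => [|k IH] x /=; first by rewrite mul1r mulr1.
by rewrite -mulrA d_central mulrA IH mulrA.
Qed.

Lemma F_comm c j x : r j * x = x * r j -> (d c * r j - q) * x = x * (d c * r j - q).
Proof.
move=> rx; rewrite mulrBl [RHS]mulrBr q_central; congr (_ - _).
by rewrite -(mulrA _ (r j)) rx mulrA (d_central c x) mulrA.
Qed.

Lemma fprod_comm k x : (forall j, (j < k)%N -> r j * x = x * r j) ->
  fprod k * x = x * fprod k.
Proof.
elim: k => [|k IH] rx /=; first by rewrite mul1r mulr1.
by rewrite -mulrA F_comm ?rx // mulrA IH ?mulrA // => j jk; apply: rx; lia.
Qed.

(** L(v) passes the letters one at a time from right to left. Each passage uses one factor of
    [fprod] and moves that letter one factor to the right. *)
Lemma fprod_word k :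
  fprod k * word 0 (iota 0 k) * lbar z k = z * word 1 (iota 0 k) * fprod k.
Proof.
elim: k => [|k IH]; first by rewrite lbar0 !mulr1 mul1r.
have -> : iota 0 k.+1 = iota 0 k ++ [:: k] by rewrite -addn1 iotaD.
rewrite !word_cat.
rewrite !size_iota /= !mulr1 !add0n add1n.
have Fw : (d k * r k - q) * word 0 (iota 0 k) = word 0 (iota 0 k) * (d k * r k - q).
  by apply: F_comm; apply: r_word => //; rewrite size_iota add0n leqnn orbT.
have ex := @lbar_exchange _ _ T (d k) q (y k) z k (d_central k) q_central
  (y_based k) z_based (z_exchange k).
have Fl : fprod k * lbar (y k) k.+1 = lbar (y k) k.+1 * fprod k.
  by apply: fprod_comm => j jk; apply: r_lbar => //; lia.
move: (d k * r k - q) (word 0 _) (word 1 _) (lbar (y k) k) (lbar (y k) k.+1)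
  (lbar z k) (lbar z k.+1) (fprod k) IH Fw ex Fl.
move=> F w w' a a' b b' f IH Fw ex Fl.
have -> : f * F * (w * a) * b' = f * w * (F * a * b').
  by rewrite !mulrA -(mulrA f F) Fw !mulrA.
by rewrite ex !mulrA IH -(mulrA _ f a') Fl !mulrA.
Qed.

(** Partial sums of the expansion [askew_sum]; the full sum, k = m + 1, is (m + 1) times the
    vanishing skew-symmetrizer. *)
Definition altsum k := askew 1 m * \sum_(0 <= j < k) (-1) ^+ j *: rprod 0 j.

Lemma altsumS k : altsum k.+1 = altsum k + (-1) ^+ k *: (askew 1 m * rprod 0 k).
Proof. by rewrite /altsum big_nat_recr //= mulrDr scalerAr. Qed.

Lemma altsum_r k : (0 < k < m)%N -> altsum k * r k = - altsum k.
Proof.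
move=> /andP[k0 km]; rewrite /altsum -mulrA.
have -> : (\sum_(0 <= j < k) (-1) ^+ j *: rprod 0 j) * r k =
          r k * (\sum_(0 <= j < k) (-1) ^+ j *: rprod 0 j).
  rewrite mulr_suml mulr_sumr; apply: eq_big_nat => j jk.
  by rewrite -scalerAl -scalerAr r_rprod //; lia.
by rewrite mulrA askew_r ?mulNr //; lia.
Qed.

(** Expanding the product of the d_k r_k - q, each term stops at its first
    factor -q: the remaining r_k move to the left and are absorbed with sign -1
    by the skew-symmetrizer. *)
Lemma askew_fprod k : (k < m)%N -> askew 1 m * fprod k.+1 =
  dprod k.+1 * (askew 1 m * rprod 0 k.+1) +
  (-1) ^+ k.+1 *: (q * dprod k * altsum k.+1).
Proof.
have Fr x k' : x * (d k' * r k' - q) = d k' * (x * r k') - q * x.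
  by rewrite mulrBr !mulrA (d_central k' x) (q_central x).
elim: k => [|k IH] km.
  rewrite /altsum big_nat1 /= !mul1r !mulr1 !scale1r mulr1 scaleN1r.
  by rewrite add0n Fr.
have ar : altsum k.+1 * r k.+1 = - altsum k.+1 by apply: altsum_r; lia.
have -> : askew 1 m * rprod 0 k.+2 = askew 1 m * rprod 0 k.+1 * r k.+1.
  by rewrite -mulrA.
rewrite altsumS -[fprod k.+2]/(fprod k.+1 * (d k.+1 * r k.+1 - q)) mulrA IH; last by lia.
rewrite -[dprod k.+2]/(dprod k.+1 * d k.+1).
have qP : dprod k.+1 * q = q * dprod k.+1 by apply: dprod_central.
have dP : dprod k.+1 = dprod k * d k by [].
have d1 : - d k.+1 - q = - d k by rewrite dS opprB addrAC subrr sub0r.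
move: (askew 1 m * rprod 0 k.+1) (altsum k.+1) ar (dprod k.+1) (dprod k) qP dP d1 => A S ar P1 P qP dP d1.
rewrite mulrDl -!mulrA -scalerAl -!mulrA !Fr ar mulrN -mulNr -mulrBl d1.
rewrite mulrBr -addrA; congr (_ + _).
rewrite !mulrA qP mulrDr scalerDr -scalerAr scalerA.
rewrite (exprS _ k.+1) mulN1r mulNr -expr2 sqrr_sign scaleN1r.
rewrite [RHS]addrC; congr (_ + _).
by rewrite mulrN mulNr -mulrA dP !scaleNr scalerN !mulrA.
Qed.

Lemma askew_fprod_m :
  askew 1 m * fprod m = dprod m.-1 * d m * (askew 1 m * rprod 0 m).
Proof.
have m0 : m.-1.+1 = m by lia.
have S0 : altsum m = - (-1) ^+ m *: (askew 1 m * rprod 0 m).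
  apply/eqP; rewrite scaleNr -addr_eq0 -altsumS.
  by rewrite /altsum -askew_sum askew0 scaler0.
have := @askew_fprod m.-1; rewrite m0 => -> //.
(* The scalars combine to dprod (m-1) (d_(m-1) - q), and d_(m-1) - q = d_m: the index m - 1 is
   skipped in the resulting product. *)
rewrite S0 -scalerAr scalerA mulrN -expr2 sqrr_sign scaleN1r.
have -> : dprod m = dprod m.-1 * d m.-1 by rewrite -{1}m0.
by rewrite q_central -mulrBl -mulrBr -dS m0.
Qed.

Lemma rprod_lbar0 k : rprod 0 k * lbar z k = z * rprod 0 k.
Proof.
elim: k => [|k IH] /=; first by rewrite lbar0 mul1r mulr1.
by rewrite lbarS !mulrA -(mulrA _ (r _) (r _)) r_sqr mulr1 IH.
Qed.

(** [fprod_word] is multiplied by the skew-symmetrizer on the left and by the inverse of [rprod 0 m]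
    on the right. On both sides [askew_fprod_m] collapses [fprod m] to the same central scalar, so
    the skew word on factors 1, ..., m commutes with [z] up to that scalar. [z] acts on factor 0
    alone and passes the traces. *)
Lemma elemt_exchange : dprod m.-1 * d m * (elemt 0 m * z - z * elemt 0 m) = 0.
Proof.
have c0 x : dprod m.-1 * d m * x = x * (dprod m.-1 * d m).
  by rewrite -mulrA d_central mulrA dprod_central mulrA.
have zp : askew 1 m * z = z * askew 1 m.
  by apply: askew_comm => j jm; apply: cent_comm; apply: z_based.
have Xp : skew_word 1 0 m * askew 1 m = skew_word 1 0 m by apply: askew_iota.
have wX : rprod 0 m * word 0 (iota 0 m) = word 1 (iota 0 m) * rprod 0 m.
  by rewrite rprod_word ?size_iota.
have ex : dprod m.-1 * d m * (skew_word 1 0 m * z - z * skew_word 1 0 m) = 0.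
  rewrite mulrBr; apply/eqP; rewrite subr_eq0; apply/eqP.
  have := fprod_word m; have := askew_fprod_m; have := rprod_lbar0 m.
  have := rprodK T 0 m; rewrite [skew_word 1 0 m]/skew_word in Xp *.
  move: c0 zp Xp wX; set dl := dprod _ * _; move: dl (askew 1 m) (fprod m).
  move=> dl p f c0 zp Xp wX wK wb pf fw.
  have -> : dl * (p * word 1 (iota 0 m) * z) =
    p * f * word 0 (iota 0 m) * lbar z m * rprodV 0 m.
    rewrite pf -[z in LHS]mulr1 -wK (mulrA z) -wb !mulrA.
    by rewrite -(mulrA _ (rprod 0 m) (word 0 _)) wX !mulrA.
  rewrite -!mulrA (mulrA f) (mulrA _ (lbar z m)) fw !mulrA zp.
  rewrite -(mulrA z) -Xp -!mulrA (mulrA p f) pf -!mulrA wK mulr1.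
  by rewrite !mulrA -[in LHS]c0 -!mulrA (mulrA p) Xp.
have cz l : (1 <= l < 1 + m)%N -> cent l z by move=> ?; apply: z_based; lia.
rewrite -(elemt_shift 1) -trsMr // -trsMl // -trsB -trsMl ?ex ?linear0 //.
by move=> l _; apply: cent_central.
Qed.

End CayleyHamilton.

End Main.

(** * R-traces of skew-invertible involutive symmetries *)

Section RTraceIdentities.
Variables (K : fieldType) (N : nat) (R4 P4 : 'I_N -> 'I_N -> 'I_N -> 'I_N -> K).
Let C (i j : 'I_N) : K := \sum_k P4 i k j k.

Hypothesis R4_inv : forall a b c d,
  \sum_p \sum_q R4 a b p q * R4 p q c d = (a == c)%:R * (b == d)%:R.
Hypothesis R4_braid : forall f i j g b c,
  \sum_k \sum_a \sum_l R4 i j k l * R4 f k g a * R4 a l b c =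
  \sum_p \sum_q \sum_s R4 f i p q * R4 q j s c * R4 p s g b.
Hypothesis R4_skew : forall i k p q,
  \sum_j \sum_l R4 i j k l * P4 l p j q = (i == q)%:R * (p == k)%:R.

Lemma sum_delta (F : 'I_N -> K) i : \sum_j (i == j)%:R * F j = F i.
Proof.
rewrite (bigD1 i) //= eqxx mul1r big1 ?addr0 // => j /negPf ji.
by rewrite eq_sym ji mul0r.
Qed.

(** When the indices are regrouped as (i, k) and (j, l), the skew inverse is an ordinary matrix
    inverse, and a one-sided inverse of a square matrix is two-sided. *)
Lemma R4_skewl j l j' l' :
  \sum_i \sum_k P4 l k j i * R4 i j' k l' = (j == j')%:R * (l == l')%:R.
Proof.
pose ev (x : 'I_#|{: 'I_N * 'I_N}|) : 'I_N * 'I_N := enum_val x.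
pose M : 'M[K]_#|{: 'I_N * 'I_N}| :=
  \matrix_(x, y) R4 (ev x).1 (ev y).1 (ev x).2 (ev y).2.
pose Q : 'M[K]_#|{: 'I_N * 'I_N}| :=
  \matrix_(x, y) P4 (ev x).2 (ev y).2 (ev x).1 (ev y).1.
have sumE (F : 'I_N * 'I_N -> K) : \sum_x F (ev x) = \sum_i \sum_k F (i, k).
  rewrite pair_big /= [RHS](eq_bigr F); last by case.
  by rewrite (reindex ev) //; apply: onW_bij; exact: enum_val_bij.
have MQ : M *m Q = 1%:M.
  apply/matrixP => x y; rewrite !mxE.
  under eq_bigr => z _ do rewrite !mxE.
  rewrite (sumE (fun z => R4 (ev x).1 z.1 (ev x).2 z.2 * P4 z.2 (ev y).2 z.1 (ev y).1)).
  rewrite R4_skew -natrM mulnb; congr (nat_of_bool _)%:R.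
  by rewrite -(inj_eq enum_val_inj) -/(ev x) -/(ev y) [RHS]xpair_eqE eq_sym [X in _ && X]eq_sym.
have /matrixP/(_ (enum_rank (j, l)) (enum_rank (j', l'))) := mulmx1C MQ.
rewrite !mxE; under eq_bigr => z _ do rewrite !mxE /ev !enum_rankK.
rewrite (sumE (fun z => P4 l z.2 j z.1 * R4 z.1 j' z.2 l')) => ->.
by rewrite (inj_eq enum_rank_inj) xpair_eqE -mulnb natrM.
Qed.

Lemma R4_inj (z z' : 'I_N -> 'I_N -> K) :
  (forall f g, \sum_k \sum_a R4 f k g a * z k a = \sum_k \sum_a R4 f k g a * z' k a) ->
  forall k a, z k a = z' k a.
Proof.
move=> H k a.
have E (w : 'I_N -> 'I_N -> K) : w k a =
    \sum_f \sum_g P4 a g k f * (\sum_k' \sum_a' R4 f k' g a' * w k' a').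
  transitivity (\sum_k' \sum_a' (\sum_f \sum_g P4 a g k f * R4 f k' g a') * w k' a').
    under eq_bigr => k' _ do under eq_bigr => a' _ do rewrite R4_skewl -mulrA.
    by under eq_bigr => k' _ do rewrite -mulr_sumr sum_delta; rewrite sum_delta.
  under eq_bigr => k' _ do under eq_bigr => a' _ do rewrite mulr_suml.
  under [RHS]eq_bigr => f _ do under eq_bigr => g _ do rewrite mulr_sumr.
  under eq_bigr => k' _ do rewrite exchange_big /=.
  rewrite exchange_big /=; apply: eq_bigr => f _.
  under eq_bigr => k' _ do under eq_bigr => a' _ do rewrite mulr_suml.
  under eq_bigr => k' _ do rewrite exchange_big /=.
  rewrite exchange_big /=; apply: eq_bigr => g _; apply: eq_bigr => k' _.
  by rewrite mulr_sumr; apply: eq_bigr => a' _; rewrite mulrA.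
by rewrite [LHS]E [RHS]E; apply: eq_bigr => f _; apply: eq_bigr => g _; rewrite H.
Qed.

Lemma Rtrace_R i k : \sum_j \sum_l R4 i j k l * C l j = (i == k)%:R.
Proof.
transitivity (\sum_p \sum_j \sum_l R4 i j k l * P4 l p j p).
  rewrite [RHS]exchange_big; apply: eq_bigr => j _ /=.
  by rewrite [RHS]exchange_big; apply: eq_bigr => l _ /=; rewrite mulr_sumr.
by under eq_bigr => p _ do rewrite R4_skew; rewrite sum_delta eq_sym.
Qed.

(** Both sides are contracted with one more R, which [R4_inj] cancels. The braid relation then
    isolates a single R under the trace; by [Rtrace_R] it disappears, and the remaining two R give
    R^2 = I. *)
Lemma Rtrace_conj i k a b :
  \sum_j \sum_l \sum_c R4 i j k l * R4 a l b c * C c j = (i == b)%:R * C a k.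
Proof.
move: k a; apply: R4_inj => f g.
transitivity (\sum_k \sum_a R4 f k g a * ((i == b)%:R * C a k)); last by [].
transitivity ((f == g)%:R * (i == b)%:R : K); last first.
  rewrite -(Rtrace_R f g) mulr_suml; apply: eq_bigr => k _.
  by rewrite mulr_suml; apply: eq_bigr => a _; ring.
rewrite -(R4_inv f i g b).
transitivity (\sum_j \sum_c C c j *
   \sum_k \sum_a \sum_l R4 i j k l * R4 f k g a * R4 a l b c).
  rewrite [RHS]pair_bigA /=; under [RHS]eq_bigr => p _ do rewrite mulr_sumr.
  rewrite [RHS]exchange_big; apply: eq_bigr => k _ /=.
  under [RHS]eq_bigr => p _ do rewrite mulr_sumr.
  rewrite [RHS]exchange_big; apply: eq_bigr => a _ /=.
  under [RHS]eq_bigr => p _ do rewrite mulr_sumr.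
  rewrite [RHS]exchange_big [in LHS]exchange_big mulr_sumr.
  apply: eq_bigr => l _ /=; rewrite pair_bigA /= mulr_sumr.
  by apply: eq_bigr => p _; ring.
under eq_bigr => j _ do under eq_bigr => c _ do rewrite R4_braid.
rewrite pair_bigA /=; under eq_bigr => x _ do rewrite mulr_sumr.
rewrite exchange_big; apply: eq_bigr => p _ /=.
under eq_bigr => x _ do rewrite mulr_sumr.
rewrite exchange_big; apply: eq_bigr => q _ /=.
under eq_bigr => x _ do rewrite mulr_sumr.
rewrite exchange_big /=.
transitivity (\sum_s (q == s)%:R * (R4 f i p q * R4 p s g b)); last exact: sum_delta.
apply: eq_bigr => s _; rewrite -Rtrace_R pair_bigA /= mulr_suml.
by apply: eq_bigr => x _; ring.
Qed.

(** One copy of C moves past R, which becomes Psi; [P_C] moves the second copy and turns Psi back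
    into R. Both come from [Rtrace_conj] by cancelling an R with [R4_inj]. *)
Lemma R_C a l b j : \sum_c R4 a l b c * C c j = \sum_p C a p * P4 l p j b.
Proof.
move: j l; apply: R4_inj => i k.
transitivity ((i == b)%:R * C a k).
  rewrite -Rtrace_conj; apply: eq_bigr => j _; apply: eq_bigr => l _.
  by rewrite mulr_sumr; apply: eq_bigr => c _; rewrite mulrA.
transitivity (\sum_p C a p * \sum_j \sum_l R4 i j k l * P4 l p j b).
  under eq_bigr => p _ do rewrite R4_skew mulrCA [_ * (p == k)%:R]mulrC [p == k]eq_sym.
  by rewrite -mulr_sumr sum_delta.
under eq_bigr => p _ do rewrite mulr_sumr.
rewrite exchange_big; apply: eq_bigr => j _ /=.
under eq_bigr => p _ do rewrite mulr_sumr.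
rewrite exchange_big; apply: eq_bigr => l _ /=.
by rewrite mulr_sumr; apply: eq_bigr => p _; ring.
Qed.

Lemma P_C l p j d : \sum_b P4 l p j b * C b d = \sum_y C l y * R4 p y d j.
Proof.
move: j l; apply: R4_inj => i k.
transitivity ((p == k)%:R * C i d).
  transitivity (\sum_b (i == b)%:R * ((p == k)%:R * C b d)); last exact: sum_delta.
  transitivity (\sum_b (\sum_j \sum_l R4 i j k l * P4 l p j b) * C b d).
    under [RHS]eq_bigr => b _ do rewrite mulr_suml.
    rewrite [RHS]exchange_big; apply: eq_bigr => j _ /=.
    under [RHS]eq_bigr => b _ do rewrite mulr_suml.
    rewrite [RHS]exchange_big; apply: eq_bigr => l _ /=.
    by rewrite mulr_sumr; apply: eq_bigr => b _; ring.
  by apply: eq_bigr => b _; rewrite R4_skew mulrA.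
rewrite -Rtrace_conj [LHS]exchange_big; apply: eq_bigr => j _ /=.
under [RHS]eq_bigr => l _ do rewrite mulr_sumr.
by rewrite [RHS]exchange_big; do 2!(apply: eq_bigr => ? _); ring.
Qed.

Lemma R_CC a l d j : \sum_b \sum_c R4 a l b c * (C b d * C c j) =
  \sum_x \sum_y C a x * C l y * R4 x y d j.
Proof.
transitivity (\sum_b C b d * \sum_p C a p * P4 l p j b).
  apply: eq_bigr => b _; rewrite -R_C mulr_sumr; apply: eq_bigr => c _; ring.
under eq_bigr => b _ do rewrite mulr_sumr.
rewrite exchange_big; apply: eq_bigr => x _ /=.
transitivity (C a x * \sum_b P4 l x j b * C b d).
  by rewrite mulr_sumr; apply: eq_bigr => b _; ring.
by rewrite P_C mulr_sumr; apply: eq_bigr => y _; rewrite mulrA.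
Qed.

End RTraceIdentities.

(** * Operators on the infinite tensor power *)

(** The operators act on all functions from configurations of an infinite chain
    of sites to B, so that the tensor powers of all orders live in one ring and
    no index needs a bound.  Linearity with respect to the right action of B
    makes the central elements of B central. *)
Section ChainRing.
Variables (K : numFieldType) (N : nat) (B : algType K).
Local Notation conf := (nat -> 'I_N.+1).
Local Notation state := (conf -> B).
Implicit Types (f g : state) (s : conf).

Definition right_linear (F : state -> state) :=
  forall f g (b : B) s, F (fun s => f s * b + g s) s = F f s * b + F g s.

Record chain := Chain { chain_fun :> state -> state; _ : right_linear chain_fun }.

Lemma chainP (X Y : chain) : (forall f s, X f s = Y f s) -> X = Y.
Proof.
case: X Y => [X HX] [Y HY] /= XY; have E : X = Y by do 2!apply/funext=> ?.
by case: _ / E HY => HY; congr Chain; exact: Prop_irrelevance.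
Qed.

Lemma chain_lin (X : chain) : right_linear X. Proof. by case: X. Qed.

HB.instance Definition _ := gen_eqMixin chain.
HB.instance Definition _ := gen_choiceMixin chain.

Fact chain0_lin : right_linear (fun _ _ => 0).
Proof. by move=> f g b s; rewrite mul0r addr0. Qed.
Definition chain0 := Chain chain0_lin.

Fact chainN_lin (X : chain) : right_linear (fun f s => - X f s).
Proof. by move=> f g b s; rewrite chain_lin opprD mulNr. Qed.
Definition chainN X := Chain (chainN_lin X).

Fact chainD_lin (X Y : chain) : right_linear (fun f s => X f s + Y f s).
Proof. by move=> f g b s; rewrite !chain_lin mulrDl addrACA. Qed.
Definition chainD X Y := Chain (chainD_lin X Y).

Fact chain1_lin : right_linear (fun f s => f s). Proof. by []. Qed.
Definition chain1 := Chain chain1_lin.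

Lemma chain_linE (X : chain) f g b :
  X (fun s => f s * b + g s) = fun s => X f s * b + X g s.
Proof. by apply/funext => s; exact: chain_lin. Qed.

Fact chainM_lin (X Y : chain) : right_linear (fun f s => X (Y f) s).
Proof. by move=> f g b s; rewrite chain_linE chain_lin. Qed.
Definition chainM X Y := Chain (chainM_lin X Y).

Fact chainZ_lin (c : K) (X : chain) : right_linear (fun f s => c *: X f s).
Proof. by move=> f g b s; rewrite chain_lin scalerDr scalerAl. Qed.
Definition chainZ c X := Chain (chainZ_lin c X).

Lemma chain_fun0 (X : chain) s : X (fun=> 0) s = 0.
Proof.
rewrite -[RHS](addNr (X (fun=> 0) s)) -mulrN1 -chain_lin; congr (X _ s).
by apply/funext => t; rewrite mul0r addr0.
Qed.

Lemma chain_funD (X : chain) f g s : X (fun t => f t + g t) s = X f s + X g s.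
Proof.
have := chain_lin X f g 1 s; rewrite mulr1 => <-; congr (X _ s).
by apply/funext => t; rewrite mulr1.
Qed.

Lemma chain_funM (X : chain) f b s : X (fun t => f t * b) s = X f s * b.
Proof.
have := chain_lin X f (fun=> 0) b s; rewrite chain_fun0 addr0 => <-; congr (X _ s).
by apply/funext => t; rewrite addr0.
Qed.

Lemma chain_funZ (X : chain) c f s : X (fun t => c *: f t) s = c *: X f s.
Proof.
rewrite -mulr_algr -chain_funM; congr (X _ s).
by apply/funext => t; rewrite mulr_algr.
Qed.

Fact chain_addA : associative chainD.
Proof. by move=> X Y Z; apply: chainP => f s; exact: addrA. Qed.
Fact chain_addC : commutative chainD.
Proof. by move=> X Y; apply: chainP => f s; exact: addrC. Qed.
Fact chain_add0 : left_id chain0 chainD.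
Proof. by move=> X; apply: chainP => f s; exact: add0r. Qed.
Fact chain_addN : left_inverse chain0 chainN chainD.
Proof. by move=> X; apply: chainP => f s; exact: addNr. Qed.
HB.instance Definition _ := GRing.isZmodule.Build chain
  chain_addA chain_addC chain_add0 chain_addN.

Fact chain_mulA : associative chainM.
Proof. by move=> X Y Z; apply: chainP. Qed.
Fact chain_mul1l : left_id chain1 chainM.
Proof. by move=> X; apply: chainP. Qed.
Fact chain_mul1r : right_id chain1 chainM.
Proof. by move=> X; apply: chainP. Qed.
Fact chain_mulDl : left_distributive chainM +%R.
Proof. by move=> X Y Z; apply: chainP. Qed.
Fact chain_mulDr : right_distributive chainM +%R.
Proof. by move=> X Y Z; apply: chainP => f s; exact: chain_funD. Qed.
Fact chain1_neq0 : chain1 != 0.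
Proof.
apply/eqP => /(congr1 (fun X : chain => X (fun=> 1) (fun=> ord0)))/eqP.
by rewrite /= oner_eq0.
Qed.
HB.instance Definition _ := GRing.Zmodule_isNzRing.Build chain
  chain_mulA chain_mul1l chain_mul1r chain_mulDl chain_mulDr chain1_neq0.

Fact chain_scaleA c d X : chainZ c (chainZ d X) = chainZ (c * d) X.
Proof. by apply: chainP => f s; exact: scalerA. Qed.
Fact chain_scale1 : left_id 1 chainZ.
Proof. by move=> X; apply: chainP => f s; exact: scale1r. Qed.
Fact chain_scaleDr : right_distributive chainZ +%R.
Proof. by move=> c X Y; apply: chainP => f s; exact: scalerDr. Qed.
Fact chain_scaleDl X : {morph chainZ^~ X : c d / c + d}.
Proof. by move=> c d; apply: chainP => f s; exact: scalerDl. Qed.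
HB.instance Definition _ := GRing.Zmodule_isLmodule.Build K chain
  chain_scaleA chain_scale1 chain_scaleDr chain_scaleDl.
Fact chain_scaleAl (c : K) (X Y : chain) : c *: (X * Y) = c *: X * Y.
Proof. by apply: chainP. Qed.
HB.instance Definition _ := GRing.Lmodule_isLalgebra.Build K chain chain_scaleAl.
Fact chain_scaleAr (c : K) (X Y : chain) : c *: (X * Y) = X * (c *: Y).
Proof. by apply: chainP => f s; apply/esym; exact: chain_funZ. Qed.
HB.instance Definition _ := GRing.Lalgebra_isAlgebra.Build K chain chain_scaleAr.

Lemma chainDE (X Y : chain) f s : (X + Y) f s = X f s + Y f s. Proof. by []. Qed.
Lemma chainNE (X : chain) f s : (- X) f s = - X f s. Proof. by []. Qed.
Lemma chainME (X Y : chain) f s : (X * Y) f s = X (Y f) s. Proof. by []. Qed.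
Lemma chainZE c (X : chain) f s : (c *: X) f s = c *: X f s. Proof. by []. Qed.
Lemma chain_sumE I r (P : pred I) (F : I -> chain) f s :
  (\sum_(i <- r | P i) F i) f s = \sum_(i <- r | P i) F i f s.
Proof. by elim/big_rec2: _ => // i x y _ <-. Qed.

End ChainRing.

(** * Tensor entries, configurations and local operators *)

Section TensorEntries.
Variables (A : pzRingType) (N : nat).

Lemma tentryE n (F : n.-tuple 'I_N -> n.-tuple 'I_N -> A) s t :
  tentry (mk_tensor_mx F) s t = F s t.
Proof. by rewrite /tentry mxE !enum_rankK. Qed.

Lemma tentryP n (X Y : tensor_mx A N n) :
  (forall s t, tentry X s t = tentry Y s t) -> X = Y.
Proof.
by move=> XY; apply/matrixP => i j; have := XY (enum_val i) (enum_val j);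
  rewrite /tentry !enum_valK.
Qed.

Lemma tentryM n (X Y : tensor_mx A N n) s t :
  tentry (X *m Y) s t = \sum_r tentry X s r * tentry Y r t.
Proof.
rewrite /tentry mxE (reindex enum_rank) //.
exact/onW_bij/enum_rank_bij.
Qed.

Lemma tentry1 n (s t : n.-tuple 'I_N) : tentry (1%:M : tensor_mx A N n) s t = (s == t)%:R.
Proof. by rewrite /tentry mxE (inj_eq enum_rank_inj). Qed.

Lemma tentryZ n (c : A) (X : tensor_mx A N n) s t : tentry (c *: X) s t = c * tentry X s t.
Proof. by rewrite /tentry mxE. Qed.

Lemma tentryD n (X Y : tensor_mx A N n) s t : tentry (X + Y) s t = tentry X s t + tentry Y s t.
Proof. by rewrite /tentry mxE. Qed.

Lemma tentryN n (X : tensor_mx A N n) s t : tentry (- X) s t = - tentry X s t.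
Proof. by rewrite /tentry mxE. Qed.

Lemma tentry_map (A' : pzRingType) (h : A -> A') n (X : tensor_mx A N n) s t :
  tentry (map_mx h X) s t = h (tentry X s t).
Proof. by rewrite /tentry mxE. Qed.

Definition put1 n (p : 'I_n) (w : n.-tuple 'I_N) (b : 'I_N) : n.-tuple 'I_N :=
  [tuple if j == p then b else tnth w j | j < n].

Lemma sum_agree1 n (p : 'I_n) w (F : n.-tuple 'I_N -> A) :
  \sum_(t | agree_off (pred1 p) w t) F t = \sum_b F (put1 p w b).
Proof.
rewrite (reindex_onto (put1 p w) (fun t => tnth t p)) /=; last first.
  move=> t /forallP wt; apply: eq_from_tnth => j; rewrite tnth_mktuple.
  case: eqVneq => [-> //|jp]; apply/eqP.
  by have := wt j; rewrite inE jp.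
apply: eq_bigl => b; rewrite tnth_mktuple !eqxx andbT; apply/forallP => j.
by rewrite inE tnth_mktuple; case: eqVneq => //= _; rewrite eqxx.
Qed.

Lemma sum_agree2 n (p q : 'I_n) w (F : n.-tuple 'I_N -> A) : p != q ->
  \sum_(t | agree_off (pred2 p q) w t) F t =
  \sum_b \sum_c F (put1 q (put1 p w b) c).
Proof.
move=> pq; rewrite pair_bigA /=.
rewrite (reindex_onto (fun x : 'I_N * 'I_N => put1 q (put1 p w x.1) x.2)
                      (fun t => (tnth t p, tnth t q))) /=; last first.
  move=> t /forallP wt; apply: eq_from_tnth => j; rewrite !tnth_mktuple.
  case: eqVneq => [-> //|jq]; case: eqVneq => [-> //|jp]; apply/eqP.
  by have := wt j; rewrite !inE (negPf jp) (negPf jq).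
apply: eq_bigl => -[b c]; rewrite !tnth_mktuple (negPf pq) !eqxx andbT.
apply/forallP => j; rewrite !inE !tnth_mktuple.
by case: eqVneq => //= jp; case: eqVneq => //= jq; rewrite eqxx.
Qed.

Lemma sum_tuple1 (F : 1.-tuple 'I_N -> A) : \sum_t F t = \sum_b F [tuple b].
Proof.
rewrite (reindex (fun b => [tuple b])) //=.
exists (fun t => tnth t ord0) => [b|t] _ //.
by apply: eq_from_tnth => j; rewrite (ord1 j) (tnth_nth (tnth t ord0)).
Qed.

Lemma sum_tuple2 (F : 2.-tuple 'I_N -> A) : \sum_t F t = \sum_b \sum_c F [tuple b; c].
Proof.
rewrite pair_bigA (reindex (fun x : 'I_N * 'I_N => [tuple x.1; x.2])) //=.
exists (fun t => (tnth t ord0, tnth t ord_max)) => [[b c]|t] _ //.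
apply: eq_from_tnth => -[[|[|j]] jlt] //; rewrite (tnth_nth (tnth t ord0)) /=;
  by congr (tnth _ _); apply: val_inj.
Qed.

Lemma sum_tupleS n (F : n.+1.-tuple 'I_N -> A) :
  \sum_t F t = \sum_(t : n.-tuple 'I_N) \sum_b F [tuple of rcons t b].
Proof.
rewrite pair_bigA (reindex (fun x : n.-tuple 'I_N * 'I_N => [tuple of rcons x.1 x.2])) //=.
exists (fun t => ([tuple tnth t (widen_ord (leqnSn n) j) | j < n], tnth t ord_max)).
  move=> [t b] _; congr (_, _) => /=.
    apply: eq_from_tnth => j; rewrite tnth_mktuple !(tnth_nth b) /= nth_rcons.
    by rewrite size_tuple ltn_ord.
  by rewrite (tnth_nth b) /= nth_rcons size_tuple ltnn eqxx.
move=> t _; apply: eq_from_tnth => j; rewrite (tnth_nth (tnth t ord_max)) /=.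
rewrite nth_rcons size_map size_enum_ord; case: ltnP => jn.
  rewrite (nth_map (Ordinal jn)) ?size_enum_ord //.
  by congr tnth; apply: val_inj; rewrite /= nth_enum_ord.
have jE : j = ord_max by apply: val_inj => /=; have := ltn_ord j; lia.
by rewrite jE eqxx.
Qed.

End TensorEntries.

Section Configurations.
Variable N : nat.
Local Notation conf := (nat -> 'I_N).
Implicit Types (s : conf) (i j k : nat).

Definition upd s i b : conf := fun j => if j == i then b else s j.
Definition window i k s : k.-tuple 'I_N := [tuple s (i + j)%N | j < k].
(** The default value [s j] of [nth] keeps the sites beyond the end of [t] unchanged. *)
Definition repl i s (t : seq 'I_N) : conf :=
  fun j => if (i <= j)%N then nth (s j) t (j - i) else s j.

Lemma upd_eq s i b : upd s i b i = b. Proof. by rewrite /upd eqxx. Qed.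

Lemma upd_neq s i j b : i != j -> upd s i b j = s j.
Proof. by rewrite /upd eq_sym => /negPf ->. Qed.

Lemma upd_upd s i b c : upd (upd s i b) i c = upd s i c.
Proof. by apply/funext => j; rewrite /upd; case: eqP. Qed.

Lemma upd_id s i : upd s i (s i) = s.
Proof. by apply/funext => j; rewrite /upd; case: eqP => // ->. Qed.

Lemma updC s i j b c : i != j -> upd (upd s i b) j c = upd (upd s j c) i b.
Proof.
move=> ij; apply/funext => l; rewrite /upd; case: (eqVneq l j) => // ->.
by rewrite eq_sym (negPf ij).
Qed.

Lemma repl_out i s t j : (j < i)%N || (i + size t <= j)%N -> repl i s t j = s j.
Proof. by rewrite /repl; case: leqP => // ij jt; rewrite nth_default //; lia. Qed.

Lemma repl_in i k s (t : k.-tuple 'I_N) (j : 'I_k) : repl i s t (i + j)%N = tnth t j.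
Proof.
rewrite /repl leq_addr addKn (tnth_nth (tnth t j)).
by apply: set_nth_default; rewrite size_tuple.
Qed.

Lemma window_repl i k s (t : k.-tuple 'I_N) : window i k (repl i s t) = t.
Proof. by apply: eq_from_tnth => j; rewrite tnth_mktuple repl_in. Qed.

Lemma window_upd i k s j b : (j < i)%N || (i + k <= j)%N ->
  window i k (upd s j b) = window i k s.
Proof.
move=> ij; apply: eq_from_tnth => l; rewrite !tnth_mktuple upd_neq //.
by have := ltn_ord l; lia.
Qed.

Lemma repl_cases (P : 'I_N -> 'I_N -> Prop) i k (t : k.-tuple 'I_N) j s s' :
  (forall l : 'I_k, j = (i + l)%N -> P (tnth t l) (tnth t l)) ->
  ((j < i)%N || (i + k <= j)%N -> P (s j) (s' j)) ->
  P (repl i s t j) (repl i s' t j).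
Proof.
move=> H1 H2; have [ij|ij] := boolP ((j < i)%N || (i + k <= j)%N).
  by rewrite !repl_out ?size_tuple //; apply: H2.
have jk : (j - i < k)%N by lia.
have -> : j = (i + Ordinal jk)%N by rewrite /=; lia.
by rewrite !repl_in; apply: H1 => /=; lia.
Qed.

Lemma repl_repl i k s (t t' : k.-tuple 'I_N) : repl i (repl i s t) t' = repl i s t'.
Proof.
apply/funext => j; apply: repl_cases => // ij.
by rewrite repl_out ?size_tuple.
Qed.

Lemma repl_window i k s : repl i s (window i k s) = s.
Proof.
apply/funext => j; have [ij|ij] := boolP ((j < i)%N || (i + k <= j)%N).
  by rewrite repl_out ?size_tuple.
have jk : (j - i < k)%N by lia.
have -> : j = (i + Ordinal jk)%N by rewrite /=; lia.
by rewrite repl_in tnth_mktuple.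
Qed.

Lemma repl_upd i k s (t : k.-tuple 'I_N) j b : (j < i)%N || (i + k <= j)%N ->
  repl i (upd s j b) t = upd (repl i s t) j b.
Proof.
move=> ij; apply/funext => l; rewrite /upd; case: eqVneq => [->|lj].
  by rewrite repl_out ?size_tuple ?eqxx.
by apply: repl_cases => // _; rewrite (negPf lj).
Qed.

Lemma repl_put1 i k s (t : k.-tuple 'I_N) p b :
  repl i s (put1 p t b) = upd (repl i s t) (i + p) b.
Proof.
apply/funext => j; have [ij|ij] := boolP ((j < i)%N || (i + k <= j)%N).
  rewrite upd_neq ?repl_out ?size_tuple //.
  by have := ltn_ord p; lia.
have jk : (j - i < k)%N by lia.
have -> : j = (i + Ordinal jk)%N by rewrite /=; lia.
by rewrite repl_in tnth_mktuple /upd eqn_add2l repl_in.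
Qed.

Lemma repl1 i s b : repl i s [tuple b] = upd s i b.
Proof.
apply/funext => j; rewrite /repl /upd; case: (ltngtP i j) => [ij||->] //=.
  by rewrite nth_default //=; lia.
by rewrite subnn.
Qed.

Lemma repl_rcons i k s (t : k.-tuple 'I_N) c :
  repl i s (rcons t c) = upd (repl i s t) (i + k) c.
Proof.
apply/funext => j; rewrite /repl /upd; case: leqP => ij; last first.
  by case: eqP => // E; move: ij; rewrite E; lia.
rewrite nth_rcons size_tuple; case: ltngtP => jk.
- by rewrite ifN //; lia.
- by rewrite ifN ?nth_default ?size_tuple //; lia.
- by rewrite ifT //; lia.
Qed.

Lemma repl2 i s b c : repl i s [tuple b; c] = upd (upd s i b) i.+1 c.
Proof. by have := repl_rcons i s [tuple b] c; rewrite repl1 addn1. Qed.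

Lemma window_rcons i k s : window i k.+1 s = [tuple of rcons (window i k s) (s (i + k)%N)].
Proof.
apply: eq_from_tnth => j; rewrite tnth_mktuple (tnth_nth (s (i + k)%N)) /= nth_rcons.
rewrite size_map size_enum_ord; case: ltngtP => jk.
- by rewrite (nth_map (Ordinal jk)) ?size_enum_ord //= nth_enum_ord.
- by have := ltn_ord j; lia.
- by rewrite jk.
Qed.

Lemma window1 i s : window i 1 s = [tuple s i].
Proof. by apply: eq_from_tnth => j; rewrite tnth_mktuple ord1 addn0. Qed.

Lemma window2 i s : window i 2 s = [tuple s i; s i.+1].
Proof.
apply: eq_from_tnth => j; rewrite tnth_mktuple (tnth_nth (s i)).
by case: j => [[|[|j]] jlt] //=; rewrite ?addn0 ?addn1.
Qed.

End Configurations.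

Section LocalOperators.
Variables (K : numFieldType) (N : nat) (B : algType K).
Local Notation conf := (nat -> 'I_N.+1).
Local Notation state := (conf -> B).
Local Notation E := (chain N B).
Implicit Types (f g : state) (s : conf).

Fact loc_lin i k (X : tensor_mx B N.+1 k) : right_linear
  (fun f s => \sum_(t : k.-tuple 'I_N.+1) tentry X (window i k s) t * f (repl i s t)).
Proof.
move=> f g b s; rewrite mulr_suml -big_split; apply: eq_bigr => t _ /=.
by rewrite mulrDr mulrA.
Qed.
Fact loc_key : unit. Proof. exact: tt. Qed.
(** Rows are lower multi-indices, so on functions of configurations composition follows the order of
    the matrix product. *)
Definition loc i k X : E := locked_with loc_key (Chain (@loc_lin i k X)).

Lemma locE i k (X : tensor_mx B N.+1 k) f s :
  loc i X f s = \sum_t tentry X (window i k s) t * f (repl i s t).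
Proof. by rewrite /loc unlock. Qed.

Lemma loc_1 i k : loc i (1%:M : tensor_mx B N.+1 k) = 1.
Proof.
apply: chainP => f s; rewrite locE (bigD1 (window i k s)) //= big1 => [|t].
  by rewrite tentry1 eqxx mul1r addr0 repl_window.
by rewrite tentry1 eq_sym => /negPf ->; rewrite mul0r.
Qed.

Lemma locM i k (X Y : tensor_mx B N.+1 k) : loc i (X *m Y) = loc i X * loc i Y.
Proof.
apply: chainP => f s; rewrite chainME !locE.
under [RHS]eq_bigr => t _ do rewrite locE mulr_sumr window_repl.
rewrite exchange_big; apply: eq_bigr => r _ /=; rewrite tentryM mulr_suml.
by apply: eq_bigr => t _; rewrite repl_repl mulrA.
Qed.

Lemma locD i k (X Y : tensor_mx B N.+1 k) : loc i (X + Y) = loc i X + loc i Y.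
Proof.
apply: chainP => f s; rewrite chainDE !locE -big_split; apply: eq_bigr => t _ /=.
by rewrite tentryD mulrDl.
Qed.

Lemma locN i k (X : tensor_mx B N.+1 k) : loc i (- X) = - loc i X.
Proof.
apply: chainP => f s; rewrite chainNE !locE -sumrN; apply: eq_bigr => t _ /=.
by rewrite tentryN mulNr.
Qed.

Lemma locZ i k (c : K) (X : tensor_mx B N.+1 k) : loc i (c%:A *: X) = c *: loc i X.
Proof.
apply: chainP => f s; rewrite chainZE !locE scaler_sumr; apply: eq_bigr => t _ /=.
by rewrite tentryZ mulr_algl scalerAl.
Qed.

Definition site i (X : 'M[B]_N.+1) : E := loc i (act1 (n := 1) ord0 X).

Lemma loc_act1 i k (p : 'I_k) X : loc i (act1 p X) = site (i + p) X.
Proof.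
apply: chainP => f s; rewrite /site !locE.
have key j n (q : 'I_n) (Y : 'M[B]_N.+1) : \sum_t tentry (act1 q Y) (window j n s) t * f (repl j s t) =
    \sum_b Y (s (j + q)%N) b * f (upd s (j + q) b).
  under eq_bigr => t _ do rewrite tentryE (fun_if ( *%R^~ _)) mul0r.
  rewrite -big_mkcond sum_agree1; apply: eq_bigr => b _.
  by rewrite repl_put1 repl_window !tnth_mktuple eqxx.
by rewrite !key addn0.
Qed.

Lemma siteE i X f s : site i X f s = \sum_b X (s i) b * f (upd s i b).
Proof.
rewrite /site locE sum_tuple1; apply: eq_bigr => b _.
by rewrite tentryE repl1 window1 ifT //; apply/forallP => l; rewrite ord1.
Qed.

Lemma loc2E i (X : tensor_mx B N.+1 2) f s : loc i X f s =
  \sum_b \sum_c tentry X [tuple s i; s i.+1] [tuple b; c] * f (upd (upd s i b) i.+1 c).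
Proof.
rewrite locE sum_tuple2; apply: eq_bigr => b _; apply: eq_bigr => c _.
by rewrite window2 repl2.
Qed.

Lemma loc_act2 i k (p q : 'I_k) X : q = p.+1 :> nat -> loc i (act2 p q X) = loc (i + p) X.
Proof.
move=> qp; have pq : p != q by rewrite -(inj_eq val_inj) /= qp; lia.
apply: chainP => f s; rewrite loc2E locE.
under eq_bigr => t _ do rewrite tentryE (fun_if ( *%R^~ _)) mul0r.
rewrite -big_mkcond sum_agree2 //; apply: eq_bigr => b _; apply: eq_bigr => c _.
by rewrite !repl_put1 repl_window !tnth_mktuple !eqxx (negPf pq) qp addnS.
Qed.

Lemma loc_act_adj i k j (X : tensor_mx B N.+1 2) : (j.+1 < k)%N ->
  loc i (act_adj k j.+1 X) = loc (i + j) X.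
Proof.
move=> jk; rewrite /act_adj /= (insubT (fun x => (x < k)%N) (ltnW jk)).
by rewrite (insubT (fun x => (x < k)%N) jk) loc_act2.
Qed.

(** The case k = 0 is included: this is how a complete trace becomes a scalar operator. *)
Lemma loc_scalar i k (b : B) : loc i (b%:M : tensor_mx B N.+1 k) = site i b%:M.
Proof.
apply: chainP => f s; rewrite locE siteE (bigD1 (window i k s)) //= [RHS](bigD1 (s i)) //=.
rewrite !big1 => [|t|t]; first by rewrite /tentry !mxE !eqxx !addr0 repl_window upd_id.
  by rewrite !mxE eq_sym => /negPf ->; rewrite mulr0n mul0r.
rewrite /tentry !mxE eq_sym => /negPf H; rewrite (inj_eq enum_rank_inj) H.
by rewrite mulr0n mul0r.
Qed.

Lemma siteM i X Y : site i (X *m Y) = site i X * site i Y.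
Proof.
apply: chainP => f s; rewrite chainME !siteE.
under [RHS]eq_bigr => t _ do rewrite siteE mulr_sumr.
rewrite exchange_big; apply: eq_bigr => r _ /=; rewrite mxE mulr_suml.
by apply: eq_bigr => t _; rewrite upd_upd upd_eq mulrA.
Qed.

(** A central [b] acts as right multiplication by [b], which every right-linear operator
    respects. *)
Lemma site_scalar_central i (b : B) : (forall x, b * x = x * b) ->
  forall X : E, site i b%:M * X = X * site i b%:M.
Proof.
move=> bC X; have bE f s : site i b%:M f s = f s * b.
  rewrite siteE (bigD1 (s i)) //= big1 => [|t].
    by rewrite !mxE eqxx addr0 upd_id mulr1n bC.
  by rewrite !mxE eq_sym => /negPf ->; rewrite mulr0n mul0r.
apply: chainP => f s; rewrite !chainME bE -chain_funM; congr (X _ s).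
by apply/funext => t; rewrite bE.
Qed.

Lemma site_inj i X Y : site i X = site i Y -> X = Y.
Proof.
move=> XY; apply/matrixP => a b.
pose F (s : conf) : B := (s i == b)%:R.
have : site i X F (fun=> a) = site i Y F (fun=> a) by rewrite XY.
rewrite !siteE /F.
have key (Z : 'M[B]_N.+1) : \sum_c Z a c * (upd (fun=> a) i c i == b)%:R = Z a b.
  rewrite (bigD1 b) //= upd_eq eqxx mulr1 big1 ?addr0 // => c /negPf cb.
  by rewrite upd_eq cb mulr0.
by rewrite !key.
Qed.

Lemma siteD i X Y : site i (X + Y) = site i X + site i Y.
Proof.
apply: chainP => f s; rewrite chainDE !siteE -big_split; apply: eq_bigr => t _ /=.
by rewrite mxE mulrDl.
Qed.

Lemma siteZ i (c : K) X : site i (c%:A *: X) = c *: site i X.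
Proof.
apply: chainP => f s; rewrite chainZE !siteE scaler_sumr; apply: eq_bigr => t _ /=.
by rewrite mxE mulr_algl scalerAl.
Qed.

End LocalOperators.

(** * Matrix units at a site and the R-trace over a site *)

Section MatrixUnits.
Variables (K : numFieldType) (N : nat) (B : algType K).
Local Notation conf := (nat -> 'I_N.+1).
Local Notation E := (chain N B).
Implicit Types (f : conf -> B) (s : conf) (x y : E) (i j : nat) (a b c d : 'I_N.+1).

Definition munit i a b : E := site i (delta_mx a b).

Lemma munitE i a b f s : munit i a b f s = if s i == a then f (upd s i b) else 0.
Proof.
rewrite /munit siteE (bigD1 b) //= big1 => [|c /negPf cb]; last first.
  by rewrite mxE cb andbF mul0r.
by rewrite mxE eqxx andbT addr0; case: eqP => _; rewrite ?mul1r ?mul0r.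
Qed.

Lemma munitM i a b c d : munit i a b * munit i c d = (b == c)%:R *: munit i a d.
Proof.
rewrite /munit -siteM mul_delta_mx_cond; case: eqP => _; first by rewrite scale1r.
rewrite mulr0n scale0r; apply: chainP => f s; rewrite siteE big1 // => e _.
by rewrite mxE mul0r.
Qed.

Lemma munitC i j a b c d : i != j ->
  munit i a b * munit j c d = munit j c d * munit i a b.
Proof.
move=> ij; have ji : j != i by rewrite eq_sym.
apply: chainP => f s; rewrite !chainME !munitE !(upd_neq _ _ ij) !(upd_neq _ _ ji).
by rewrite (updC _ _ _ ij); case: eqP; case: eqP.
Qed.

Lemma munit_sum i : \sum_a munit i a a = 1.
Proof.
apply: chainP => f s; rewrite chain_sumE (bigD1 (s i)) //= big1 => [|a].
  by rewrite munitE eqxx upd_id addr0.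
by rewrite munitE eq_sym => /negPf ->.
Qed.

(** Trivial action on site i, expressed without a tensor decomposition: commutation with all matrix
    units there. *)
Definition ccent i x := forall a b, x * munit i a b = munit i a b * x.

Lemma ccent_loc i k (X : tensor_mx B N.+1 k) j : (j < i)%N || (i + k <= j)%N ->
  ccent j (loc i X).
Proof.
move=> ij a b; apply: chainP => f s; rewrite !chainME munitE locE.
under eq_bigr => t _ do rewrite munitE repl_out ?size_tuple //.
case: eqP => _; last by rewrite big1 // => t _; rewrite mulr0.
by rewrite locE; apply: eq_bigr => t _; rewrite window_upd // repl_upd.
Qed.

Lemma ccent1 i : ccent i 1. Proof. by move=> a b; rewrite mul1r mulr1. Qed.

Lemma ccentD i x y : ccent i x -> ccent i y -> ccent i (x + y).
Proof. by move=> cx cy a b; rewrite mulrDl mulrDr cx cy. Qed.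

Lemma ccentZ i (c : K) x : ccent i x -> ccent i (c *: x).
Proof. by move=> cx a b; rewrite -scalerAl cx scalerAr. Qed.

Lemma ccentM i x y : ccent i x -> ccent i y -> ccent i (x * y).
Proof. by move=> cx cy a b; rewrite -mulrA cy mulrA cx mulrA. Qed.

Lemma ccent_munit i j a b : i != j -> ccent i (munit j a b).
Proof. by move=> ij c d; rewrite munitC // eq_sym. Qed.

Lemma ccent_sum i I (r : seq I) (F : I -> E) :
  (forall l, ccent i (F l)) -> ccent i (\sum_(l <- r) F l).
Proof.
move=> cF a b; rewrite mulr_suml mulr_sumr.
by apply: eq_bigr => l _; exact: cF.
Qed.

Lemma loc2_munit i (X : tensor_mx K N.+1 2) :
  loc i (map_mx (in_alg B) X) = \sum_a \sum_b \sum_c \sum_d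
    tentry X [tuple a; b] [tuple c; d] *: (munit i a c * munit i.+1 b d).
Proof.
apply: chainP => f s; rewrite loc2E chain_sumE [RHS](bigD1 (s i)) //= [X in _ = _ + X]big1 => [|a ai].
  rewrite addr0 chain_sumE [RHS](bigD1 (s i.+1)) //= [X in _ = _ + X]big1 => [|b bi].
    rewrite addr0 chain_sumE; apply: eq_bigr => c _.
    rewrite chain_sumE; apply: eq_bigr => d _.
    rewrite tentry_map in_algE mulr_algl chainZE chainME !munitE (eqxx (s i)) upd_neq.
      by rewrite (eqxx (s i.+1)).
    by lia.
  rewrite chain_sumE big1 // => c _; rewrite chain_sumE big1 // => d _.
  rewrite chainZE chainME !munitE (eqxx (s i)) upd_neq; last by lia.
  by rewrite [s _ == b]eq_sym (negPf bi) scaler0.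
rewrite chain_sumE big1 // => b _; rewrite chain_sumE big1 // => c _.
rewrite chain_sumE big1 // => d _.
by rewrite chainZE chainME munitE [s i == a]eq_sym (negPf ai) scaler0.
Qed.

Lemma ccent_comm i (X : tensor_mx K N.+1 2) x : ccent i x -> ccent i.+1 x ->
  loc i (map_mx (in_alg B) X) * x = x * loc i (map_mx (in_alg B) X).
Proof.
move=> cx cx'; rewrite loc2_munit !(mulr_suml, mulr_sumr).
do 2!(apply: eq_bigr => ? _; rewrite !(mulr_suml, mulr_sumr)).
apply: eq_bigr => c _; rewrite mulr_suml mulr_sumr; apply: eq_bigr => d _.
by rewrite -scalerAl -scalerAr -mulrA -cx' !mulrA -cx.
Qed.

Variable C : 'M[K]_N.+1.

(** The inner sum over [a] extracts the entry of [x] from b to c at site i and tensors it with the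
    identity of that site; the weights C_c^b then form Tr(x C). *)
Definition ctr i x : E := \sum_b \sum_c C c b *: \sum_a munit i a b * x * munit i c a.

Fact ctr_is_linear i : linear (ctr i).
Proof.
move=> k x y; rewrite /ctr scaler_sumr -big_split; apply: eq_bigr => b _ /=.
rewrite scaler_sumr -big_split; apply: eq_bigr => c _ /=.
rewrite scalerA [k * _]mulrC -scalerA -scalerDr; congr (_ *: _).
rewrite scaler_sumr -big_split; apply: eq_bigr => a _ /=.
by rewrite mulrDr mulrDl -scalerAr -scalerAl.
Qed.
HB.instance Definition _ i := GRing.isLinear.Build K E E _ (ctr i) (ctr_is_linear i).

Lemma ctrMl i x y : ccent i x -> ctr i (x * y) = x * ctr i y.
Proof.
move=> cx; rewrite mulr_sumr; apply: eq_bigr => b _.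
rewrite mulr_sumr; apply: eq_bigr => c _; rewrite -scalerAr; congr (_ *: _).
by rewrite mulr_sumr; apply: eq_bigr => a _; rewrite !mulrA cx.
Qed.

Lemma ctrMr i x y : ccent i x -> ctr i (y * x) = ctr i y * x.
Proof.
move=> cx; rewrite mulr_suml; apply: eq_bigr => b _.
rewrite mulr_suml; apply: eq_bigr => c _; rewrite -scalerAl; congr (_ *: _).
by rewrite mulr_suml; apply: eq_bigr => a _; rewrite -!mulrA cx.
Qed.

Lemma ccent_ptr i b c x : ccent i (\sum_a munit i a b * x * munit i c a).
Proof.
move=> d d'; rewrite mulr_suml mulr_sumr (bigD1 d) //= [RHS](bigD1 d') //=.
rewrite !big1 => [|a /negPf ad|a /negPf ad].
- by rewrite !addr0 -!mulrA munitM eqxx scale1r !mulrA munitM eqxx scale1r.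
- by rewrite !mulrA munitM eq_sym ad scale0r !mul0r.
- by rewrite -!mulrA munitM ad scale0r !mulr0.
Qed.

Lemma ccent_ctr i x : ccent i (ctr i x).
Proof.
apply: ccent_sum => b; apply: ccent_sum => c; apply: ccentZ.
exact: ccent_ptr.
Qed.

Lemma ccent_ctr_stable i j x : ccent j x -> ccent j (ctr i x).
Proof.
move=> cx; have [-> |ij] := eqVneq j i; first exact: ccent_ctr.
apply: ccent_sum => b; apply: ccent_sum => c; apply: ccentZ.
apply: ccent_sum => a; apply: ccentM; last exact: ccent_munit.
by apply: ccentM => //; exact: ccent_munit.
Qed.

Definition ptr k (X : tensor_mx B N.+1 k.+1) : tensor_mx B N.+1 k :=
  mk_tensor_mx (fun u v => \sum_b \sum_c
    C c b *: tentry X [tuple of rcons u b] [tuple of rcons v c]).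

Lemma ctr_loc i k (X : tensor_mx B N.+1 k.+1) : ctr (i + k) (loc i X) = loc i (ptr X).
Proof.
apply: chainP => f s; rewrite chain_sumE locE.
under [RHS]eq_bigr => t _ do rewrite tentryE mulr_suml.
rewrite exchange_big; apply: eq_bigr => b _.
rewrite chain_sumE.
under [RHS]eq_bigr => t _ do rewrite mulr_suml.
rewrite exchange_big; apply: eq_bigr => c _.
rewrite chainZE chain_sumE (bigD1 (s (i + k)%N)) //.
rewrite [X in _ *: (_ + X)]big1 => [|a /andP[_ /negPf ai]]; last first.
  by rewrite -mulrA chainME munitE eq_sym ai.
rewrite addr0 -mulrA chainME munitE eqxx chainME locE sum_tupleS scaler_sumr.
apply: eq_bigr => t _; rewrite (bigD1 c) //.
rewrite [X in _ *: (_ + X)]big1 => [|d /andP[_ /negPf dc]]; last first.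
  by rewrite munitE repl_rcons upd_eq dc mulr0.
rewrite addr0 munitE repl_rcons upd_eq eqxx upd_upd window_rcons upd_eq.
rewrite window_upd ?leqnn ?orbT // repl_upd ?leqnn ?orbT // upd_upd.
rewrite -scalerAl; do 3!congr (_ _).
have <- : repl i s t (i + k)%N = s (i + k)%N by rewrite repl_out // size_tuple leqnn orbT.
by rewrite upd_id.
Qed.

End MatrixUnits.

Section Entries.
Variables (K : numFieldType) (N : nat) (R Psi : tensor_mx K N 2).
Hypothesis R_sym : involutive_symmetry R.
Let R4 i j k l := tentry R [tuple i; j] [tuple k; l].

Lemma tuple2_eq (a b c d : 'I_N) :
  ([tuple a; b] == [tuple c; d]) = (a == c) && (b == d).
Proof. by rewrite -(inj_eq val_inj) /= !eqseq_cons andbT. Qed.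

Lemma R4_invE a b c d :
  \sum_p \sum_q R4 a b p q * R4 p q c d = (a == c)%:R * (b == d)%:R.
Proof.
have [_ /(congr1 (fun X : tensor_mx K N 2 => tentry X [tuple a; b] [tuple c; d]))] := R_sym.
by rewrite tentryM sum_tuple2 tentry1 tuple2_eq -mulnb natrM.
Qed.

Lemma tentry_act2_mul n (p q : 'I_n) (X : tensor_mx K N 2) Y s t : p != q ->
  tentry (act2 p q X *m Y) s t = \sum_b \sum_c
    tentry X [tuple tnth s p; tnth s q] [tuple b; c] * tentry Y (put1 q (put1 p s b) c) t.
Proof.
move=> pq; rewrite tentryM.
under eq_bigr => r _ do rewrite tentryE (fun_if ( *%R^~ _)) mul0r.
rewrite -big_mkcond sum_agree2 //; apply: eq_bigr => b _; apply: eq_bigr => c _.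
by rewrite !tnth_mktuple !eqxx (negPf pq).
Qed.

Lemma tentry_act1_mul (X : 'M[K]_N) (Y : tensor_mx K N 2) a b t :
  tentry (act1 ord0 X *m Y) [tuple a; b] t = \sum_c X a c * tentry Y [tuple c; b] t.
Proof.
rewrite tentryM.
under eq_bigr => r _ do rewrite tentryE (fun_if ( *%R^~ _)) mul0r.
rewrite -big_mkcond sum_agree1; apply: eq_bigr => c _.
rewrite tnth_mktuple eqxx; congr (_ * tentry Y _ _).
by apply: eq_from_tnth => -[[|[|l]] ll] //; rewrite tnth_mktuple !(tnth_nth a).
Qed.

Lemma R4_braidE f i j g b c :
  \sum_k \sum_a \sum_l R4 i j k l * R4 f k g a * R4 a l b c =
  \sum_p \sum_q \sum_s R4 f i p q * R4 q j s c * R4 p s g b.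
Proof.
pose o0 : 'I_3 := ord0; pose o1 : 'I_3 := Ordinal (isT : 1 < 3)%N.
pose o2 : 'I_3 := Ordinal (isT : 2 < 3)%N.
have a1 : act_adj 3 1 R = act2 o0 o1 R.
  rewrite /act_adj !(insubT (fun x => (x < 3)%N)) //=.
  by congr (act2 _ _ _); apply: val_inj.
have a2 : act_adj 3 2 R = act2 o1 o2 R.
  by rewrite /act_adj !(insubT (fun x => (x < 3)%N)) //=.
have [+ _] := R_sym; rewrite a1 a2 => br.
have put3_0 x y z w : put1 o0 [tuple x; y; z] w = [tuple w; y; z].
  by apply: eq_from_tnth => -[[|[|[|l]]] ll]; rewrite tnth_mktuple !(tnth_nth x).
have put3_1 x y z w : put1 o1 [tuple x; y; z] w = [tuple x; w; z].
  by apply: eq_from_tnth => -[[|[|[|l]]] ll]; rewrite tnth_mktuple !(tnth_nth x).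
have put3_2 x y z w : put1 o2 [tuple x; y; z] w = [tuple x; y; w].
  by apply: eq_from_tnth => -[[|[|[|l]]] ll]; rewrite tnth_mktuple !(tnth_nth x).
have A1 Y x y z t : tentry (act2 o0 o1 R *m Y) [tuple x; y; z] t =
    \sum_v \sum_w R4 x y v w * tentry Y [tuple v; w; z] t.
  rewrite tentry_act2_mul //; apply: eq_bigr => v _; apply: eq_bigr => w _.
  by rewrite put3_0 put3_1 !(tnth_nth x).
have A2 Y x y z t : tentry (act2 o1 o2 R *m Y) [tuple x; y; z] t =
    \sum_v \sum_w R4 y z v w * tentry Y [tuple x; v; w] t.
  rewrite tentry_act2_mul //; apply: eq_bigr => v _; apply: eq_bigr => w _.
  by rewrite put3_1 put3_2 !(tnth_nth x).
have tuple3_eq (x y z x' y' z' : 'I_N) : ([tuple x; y; z] == [tuple x'; y'; z'])%:R =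
    (x' == x)%:R * (y' == y)%:R * (z' == z)%:R :> K.
  rewrite -(inj_eq val_inj) /= !eqseq_cons andbT -!natrM !mulnb -andbA.
  by rewrite ![x' == _]eq_sym ![y' == _]eq_sym ![z' == _]eq_sym.
(* The extra factor [1%:M] lets [A1] and [A2] expand the innermost operator as well. *)
have := congr1 (fun X : tensor_mx K N 3 => tentry (X *m 1%:M) [tuple f; i; j] [tuple g; b; c]) br.
rewrite /= -!mulmxA A1 A2 => H; symmetry.
transitivity (\sum_p \sum_q R4 f i p q *
   tentry (act2 o1 o2 R *m (act2 o0 o1 R *m 1%:M)) [tuple p; q; j] [tuple g; b; c]).
  apply: eq_bigr => p _; apply: eq_bigr => q _; rewrite A2 mulr_sumr.
  apply: eq_bigr => s _.
  transitivity (R4 f i p q * \sum_w (c == w)%:R * (R4 q j s w * R4 p s g b)).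
    by rewrite sum_delta mulrA.
  congr (_ * _); apply: eq_bigr => w _; rewrite A1 mulrCA; congr (_ * _).
  rewrite -(sum_delta (R4 p s ^~ b)) mulr_sumr; apply: eq_bigr => x _.
  rewrite -(sum_delta (R4 p s x)) !mulr_sumr; apply: eq_bigr => y _.
  by rewrite tentry1 tuple3_eq; ring.
rewrite {}H; apply: eq_bigr => k _; rewrite [RHS]exchange_big; apply: eq_bigr => l _ /=.
rewrite A1 -(sum_delta (fun g => \sum_a R4 i j k l * R4 f k g a * R4 a l b c)) mulr_sumr.
apply: eq_bigr => x _; rewrite !mulr_sumr; apply: eq_bigr => a _.
rewrite A2 -(sum_delta (R4 a l ^~ c)) !mulr_sumr; apply: eq_bigr => v _.
rewrite -(sum_delta (R4 a l v)) !mulr_sumr; apply: eq_bigr => w _.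
by rewrite tentry1 tuple3_eq; ring.
Qed.

End Entries.

(** * The chain satisfies the tower axioms *)

Section Tower.
Variables (K : numFieldType) (N : nat) (B : algType K).
Variables (R Psi : tensor_mx K N.+1 2).
Hypothesis R_sym : involutive_symmetry R.
Hypothesis R_skew : skew_inverse R Psi.
Local Notation E := (chain N B).
Local Notation C := (Cmx Psi).
Let R4 i j k l := tentry R [tuple i; j] [tuple k; l].
Let P4 i j k l := tentry Psi [tuple i; j] [tuple k; l].

Definition cr j : E := loc j (map_mx (in_alg B) R).

Lemma CE i j : C i j = \sum_k P4 i k j k. Proof. by rewrite mxE. Qed.

Lemma cr_cr j : cr j * cr j = 1.
Proof.
have [_ RR] := R_sym.
by rewrite -locM -map_mxM RR map_mx1 loc_1.
Qed.

Lemma map_act2 n p q (X : tensor_mx K N.+1 2) :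
  map_mx (in_alg B) (act2 (n := n) p q X) = act2 p q (map_mx (in_alg B) X).
Proof.
apply: tentryP => s t; rewrite tentry_map !tentryE (fun_if (in_alg B)) rmorph0.
by rewrite tentry_map.
Qed.

Lemma map_act_adj n k (X : tensor_mx K N.+1 2) :
  map_mx (in_alg B) (act_adj n k X) = act_adj n k (map_mx (in_alg B) X).
Proof.
rewrite /act_adj; case: insub => [i|]; last exact: map_mx1.
by case: insub => [j|]; [exact: map_act2 | exact: map_mx1].
Qed.

Lemma loc_Rk n i j : (j.+1 < n)%N ->
  loc i (map_mx (in_alg B) (act_adj n j.+1 R)) = cr (i + j).
Proof. by move=> jn; rewrite map_act_adj loc_act_adj. Qed.

Lemma cr_braid j : cr j * cr j.+1 * cr j = cr j.+1 * cr j * cr j.+1.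
Proof.
have [br _] := R_sym.
have := congr1 (fun X => loc j (map_mx (in_alg B) X)) br.
by rewrite /= !map_mxM !locM !loc_Rk // addn0 addn1.
Qed.

Lemma ptr_scalar (X : tensor_mx K N.+1 2) (c : K) :
  (forall a b, \sum_p \sum_q tentry X [tuple a; p] [tuple b; q] * C q p = (a == b)%:R * c) ->
  ptr C (map_mx (in_alg B) X) = c%:A%:M.
Proof.
move=> H; apply: tentryP => s t; rewrite tentryE.
have [a ->] : exists a, s = [tuple a].
  by exists (tnth s ord0); apply: eq_from_tnth => j; rewrite ord1 (tnth_nth (tnth s ord0)).
have [b ->] : exists b, t = [tuple b].
  by exists (tnth t ord0); apply: eq_from_tnth => j; rewrite ord1 (tnth_nth (tnth t ord0)).
transitivity ((\sum_p \sum_q tentry X [tuple a; p] [tuple b; q] * C q p)%:A : B).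
  rewrite scaler_suml; apply: eq_bigr => p _; rewrite scaler_suml; apply: eq_bigr => q _.
  rewrite tentry_map in_algE scalerA mulrC; congr (_ * _ *: _).
  by congr tentry; apply: val_inj.
have ab : ([tuple a] == [tuple b]) = (a == b).
  by rewrite -(inj_eq val_inj) /= eqseq_cons andbT.
rewrite H /tentry mxE (inj_eq enum_rank_inj) ab.
by case: eqP; rewrite ?mul1r ?mul0r ?scale0r.
Qed.

Lemma ctr_loc2 i (X : tensor_mx B N.+1 2) : ctr C i.+1 (loc i X) = loc i (ptr C X).
Proof. by rewrite -ctr_loc addn1. Qed.

Lemma ctr_cr i : ctr C i.+1 (cr i) = 1.
Proof.
rewrite ctr_loc2 (@ptr_scalar R 1) ?scale1r ?loc_1 // => a b; rewrite mulr1.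
rewrite -(@Rtrace_R _ _ R4 P4 R_skew a b).
by apply: eq_bigr => p _; apply: eq_bigr => q _; rewrite CE.
Qed.

Lemma loc_scalarZ i k (c : K) : loc i (c%:A%:M : tensor_mx B N.+1 k) = c *: 1.
Proof. by rewrite -scalemx1 locZ loc_1. Qed.

Lemma ctr_conj_munit i a b : ctr C i.+1 (cr i * munit B i a b * cr i) = C b a *: 1.
Proof.
have -> : munit B i a b = loc i (map_mx (in_alg B) (act1 (n := 2) ord0 (delta_mx a b))).
  rewrite (_ : map_mx _ _ = act1 ord0 (delta_mx a b)) ?loc_act1 ?addn0 //.
  apply: tentryP => s t; rewrite tentry_map !tentryE (fun_if (in_alg B)) rmorph0.
  by rewrite !mxE rmorph_nat.
rewrite -!locM -!map_mxM ctr_loc2 (@ptr_scalar _ (C b a)) ?loc_scalarZ // => c d.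
have := @Rtrace_conj _ _ R4 P4 (R4_invE R_sym) (R4_braidE R_sym) R_skew c a b d.
rewrite -CE => <-; apply: eq_bigr => p _; rewrite exchange_big; apply: eq_bigr => q _ /=.
rewrite -mulmxA tentryM sum_tuple2 exchange_big mulr_suml; apply: eq_bigr => l _ /=.
rewrite CE; congr (_ * _); rewrite (bigD1 a) //= big1 ?addr0 => [|k /negPf ka].
  rewrite tentry_act1_mul (bigD1 b) //= big1 ?addr0 => [|k /negPf kb].
    by rewrite mxE (eqxx a) (eqxx b) mul1r.
  by rewrite mxE kb andbF mul0r.
rewrite tentry_act1_mul big1 ?mulr0 // => x _.
by rewrite mxE ka mul0r.
Qed.

(** x is expanded in matrix units of site i with coefficients [xx a b] acting trivially on sites i
    and i+1. These leave the trace, and the matrix units are covered by [ctr_conj_munit]. *)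
Lemma ctr_conj i (x : E) : ccent i.+1 x -> ctr C i.+1 (cr i * x * cr i) = ctr C i x.
Proof.
move=> cx; pose xx a b := \sum_c munit B i c a * x * munit B i b c.
have cxx a b : ccent i.+1 (xx a b).
  apply: ccent_sum => c; apply: ccentM; last by apply: ccent_munit; lia.
  by apply: ccentM => //; apply: ccent_munit; lia.
have xE : x = \sum_a \sum_b munit B i a b * xx a b.
  transitivity ((\sum_a munit B i a a) * x * \sum_b munit B i b b).
    by rewrite !munit_sum mul1r mulr1.
  rewrite -mulrA mulr_suml; apply: eq_bigr => a _.
  rewrite mulrA mulr_sumr; apply: eq_bigr => b _.
  rewrite mulr_sumr (bigD1 b) //= big1 ?addr0 => [|c /negPf cb].
    by rewrite !mulrA munitM eqxx scale1r.
  by rewrite !mulrA munitM eq_sym cb scale0r !mul0r.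
have rx a b : cr i * xx a b = xx a b * cr i.
  by apply: ccent_comm => //; exact: ccent_ptr.
rewrite {1}xE mulr_sumr mulr_suml linear_sum [RHS]/ctr; apply: eq_bigr => a _ /=.
rewrite mulr_sumr mulr_suml linear_sum; apply: eq_bigr => b _ /=.
rewrite !mulrA -(mulrA _ (xx a b)) -rx !mulrA ctrMr //.
by rewrite ctr_conj_munit -scalerAl mul1r.
Qed.

(** Sites i and i+1 are treated as one site with index set [J]; the double trace becomes a single
    one with weight C tensor C, and its cyclicity for R reduces to [RR_CC]. *)
Local Notation J := ('I_N.+1 * 'I_N.+1)%type.
Let T i (P Q : J) : E := munit B i P.1 Q.1 * munit B i.+1 P.2 Q.2.
Let RR (P Q : J) := R4 P.1 P.2 Q.1 Q.2.
Let CC (P Q : J) := C P.1 Q.1 * C P.2 Q.2.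
Let U i (P Q : J) (x : E) := \sum_A T i A P * x * T i Q A.

Lemma TM i P Q S A : T i P Q * T i S A = (Q == S)%:R *: T i P A.
Proof.
have ii : i.+1 != i by lia.
rewrite /T mulrA -(mulrA (munit _ _ _ _)) (munitC B _ _ _ _ ii) !mulrA munitM -!mulrA.
rewrite munitM -!scalerAl -!scalerAr scalerA -natrM mulnb.
by case: Q S => [q1 q2] [s1 s2].
Qed.

Lemma crE i : cr i = \sum_P \sum_Q RR P Q *: T i P Q.
Proof.
rewrite /cr loc2_munit pair_bigA /=; apply: eq_bigr => P _.
by rewrite pair_bigA; apply: eq_bigr.
Qed.

Lemma T_cr i A P : T i A P * cr i = \sum_Q RR P Q *: T i A Q.
Proof.
rewrite crE mulr_sumr (bigD1 P) //= [X in _ + X]big1 ?addr0 => [|S /negPf SP].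
  by rewrite mulr_sumr; apply: eq_bigr => Q _; rewrite -scalerAr TM eqxx scale1r.
by rewrite mulr_sumr big1 // => Q _; rewrite -scalerAr TM eq_sym SP scale0r scaler0.
Qed.

Lemma cr_T i Q A : cr i * T i Q A = \sum_P RR P Q *: T i P A.
Proof.
rewrite crE mulr_suml; apply: eq_bigr => P _.
rewrite mulr_suml (bigD1 Q) //= big1 ?addr0 => [|S /negPf SP].
  by rewrite -scalerAl TM eqxx scale1r.
by rewrite -scalerAl TM SP scale0r scaler0.
Qed.

Lemma U_crl i P Q x : U i P Q (cr i * x) = \sum_S RR P S *: U i S Q x.
Proof.
under [RHS]eq_bigr => S _ do rewrite scaler_sumr.
rewrite [RHS]exchange_big; apply: eq_bigr => A _ /=.
rewrite mulrA T_cr !mulr_suml; apply: eq_bigr => S _.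
by rewrite -!scalerAl.
Qed.

Lemma U_crr i P Q x : U i P Q (x * cr i) = \sum_S RR S Q *: U i P S x.
Proof.
under [RHS]eq_bigr => S _ do rewrite scaler_sumr.
rewrite [RHS]exchange_big; apply: eq_bigr => A _ /=.
rewrite mulrA -(mulrA _ (cr i)) cr_T mulr_sumr; apply: eq_bigr => S _.
by rewrite -scalerAr.
Qed.

Lemma ctr_ctr i x : ctr C i (ctr C i.+1 x) = \sum_P \sum_Q CC Q P *: U i P Q x.
Proof.
transitivity (\sum_b \sum_b' \sum_c \sum_c' (C c b * C c' b') *:
   U i (b, b') (c, c') x); last first.
  rewrite pair_bigA; apply: eq_bigr => -[b b'] _ /=.
  by rewrite pair_bigA; apply: eq_bigr => -[c c'] _.
rewrite /ctr; apply: eq_bigr => b _; rewrite [RHS]exchange_big; apply: eq_bigr => c _ /=.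
under eq_bigr => a _ do rewrite mulr_sumr mulr_suml.
rewrite exchange_big scaler_sumr; apply: eq_bigr => b' _ /=.
under eq_bigr => a _ do rewrite mulr_sumr mulr_suml.
rewrite exchange_big scaler_sumr; apply: eq_bigr => c' _ /=.
under eq_bigr => a _ do rewrite -scalerAr -scalerAl mulr_sumr mulr_suml.
rewrite -scaler_sumr scalerA pair_bigA; congr (_ *: _); apply: eq_bigr => -[a a'] _ /=.
rewrite /T /= -!mulrA; congr (_ * (_ * (_ * _))).
by apply: munitC; lia.
Qed.

Lemma RR_CC Q S : \sum_P CC Q P * RR P S = \sum_P RR Q P * CC P S.
Proof.
have := @R_CC _ _ R4 P4 (R4_invE R_sym) (R4_braidE R_sym) R_skew Q.1 Q.2 S.1 S.2.
rewrite !pair_bigA /= => H; symmetry.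
transitivity (\sum_p R4 Q.1 Q.2 p.1 p.2 *
   ((\sum_k P4 p.1 k S.1 k) * (\sum_k P4 p.2 k S.2 k))).
  by apply: eq_bigr => p _; rewrite /CC !CE.
by rewrite H; apply: eq_bigr => p _; rewrite /CC !CE.
Qed.

Lemma ctr_cyc i x : ctr C i (ctr C i.+1 (cr i * x)) = ctr C i (ctr C i.+1 (x * cr i)).
Proof.
rewrite !ctr_ctr.
transitivity (\sum_P \sum_Q (\sum_S CC Q S * RR S P) *: U i P Q x).
  rewrite exchange_big [RHS]exchange_big; apply: eq_bigr => Q _ /=.
  under eq_bigr => P _ do rewrite U_crl scaler_sumr.
  rewrite exchange_big; apply: eq_bigr => S _ /=; rewrite scaler_suml.
  by apply: eq_bigr => P _; rewrite scalerA.
apply: eq_bigr => P _; under eq_bigr => Q _ do rewrite RR_CC scaler_suml.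
rewrite exchange_big; apply: eq_bigr => S _ /=; rewrite U_crr scaler_sumr.
by apply: eq_bigr => Q _; rewrite scalerA mulrC.
Qed.

Lemma ccent_cr i j : i != j -> i != j.+1 -> ccent i (cr j).
Proof. by move=> ij ij'; apply: ccent_loc; lia. Qed.

Definition chain_tower : rtower E := @RTower K E (ctr C) cr (@ccent K N B)
  (@ccent1 K N B) (@ccentD K N B) (@ccentZ K N B) (@ccentM K N B)
  (fun i c cC a b => cC _) ccent_cr (fun j x => @ccent_comm K N B j R x) cr_cr cr_braid
  (@ctrMl K N B C) (@ctrMr K N B C) (@ccent_ctr K N B C) (@ccent_ctr_stable K N B C)
  ctr_cr ctr_conj ctr_cyc.

End Tower.

(** * The identities *)

Section PartialTraces.
Variables (K : numFieldType) (N : nat) (Psi : tensor_mx K N.+1 2) (A : algType K).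
Local Notation C := (Cmx Psi).

Lemma Rtr_but1S n (X : tensor_mx (fps A) N.+1 n.+2) :
  Rtr_but1 Psi X = Rtr_but1 Psi (ptr C X).
Proof.
apply/matrixP => i j; rewrite !mxE big_mkcond sum_tupleS [RHS]big_mkcond.
apply: eq_bigr => s _.
have t0 (t : n.+1.-tuple 'I_N.+1) b : tnth [tuple of rcons t b] ord0 = tnth t ord0.
  by rewrite !(tnth_nth b) /= nth_rcons size_tuple.
under eq_bigr => b _ do rewrite t0.
case: eqP => _; last by rewrite big1.
under eq_bigr => b _ do rewrite big_mkcond sum_tupleS.
rewrite exchange_big [RHS]big_mkcond; apply: eq_bigr => t _ /=.
under eq_bigr => b _ do under eq_bigr => c _ do rewrite t0.
case: eqP => _; last by rewrite big1 // => b _; rewrite big1.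
rewrite tentryE scaler_sumr; apply: eq_bigr => b _.
rewrite scaler_sumr; apply: eq_bigr => c _; rewrite scalerA; congr (_ *: _).
rewrite big_mkcond big_ord_recr [in RHS]big_mkcond /=; congr (_ * _).
  by apply: eq_bigr => l _; rewrite !(tnth_nth b) /= !nth_rcons !size_tuple ltn_ord.
by rewrite !(tnth_nth b) /= !nth_rcons !size_tuple ltnn eqxx.
Qed.

End PartialTraces.

(** * Dictionary between tensor matrices and operators on the chain *)

Section Interface.
Variables (K : numFieldType) (N : nat) (R Psi : tensor_mx K N.+1 2).
Hypothesis R_sym : involutive_symmetry R.
Hypothesis R_skew : skew_inverse R Psi.
(** [g] will be the identity, the shift by q, and the inclusion of the series in u into those in u
    and v. *)
Variables (A B : algType K) (g : {rmorphism fps A -> B}).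
Hypothesis gZ : forall (c : K) x, g (c *: x) = c *: g x.
Local Notation T := (chain_tower B R_sym R_skew).
Local Notation C := (Cmx Psi).
Local Notation E := (chain N B).

Definition rep k (X : tensor_mx (fps A) N.+1 k) : E := loc 0 (map_mx g X).

Lemma repM k (X Y : tensor_mx (fps A) N.+1 k) : rep (X *m Y) = rep X * rep Y.
Proof. by rewrite /rep map_mxM locM. Qed.

Lemma rep1 k : rep (1%:M : tensor_mx (fps A) N.+1 k) = 1.
Proof. by rewrite /rep map_mx1 loc_1. Qed.

Lemma rep_alg k (X : tensor_mx K N.+1 k) :
  rep (map_mx (in_alg (fps A)) X) = loc 0 (map_mx (in_alg B) X).
Proof.
by congr loc; apply/matrixP => i j; rewrite !mxE /= gZ rmorph1.
Qed.

Lemma rep_prod k n1 n2 (F : nat -> tensor_mx (fps A) N.+1 k) :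
  rep (\prod_(n1 <= i < n2) F i) = \prod_(n1 <= i < n2) rep (F i).
Proof. by apply: (big_morph (@rep k)) => [X Y|]; [exact: repM | exact: rep1]. Qed.

Lemma rep_Rk n k : (k.+1 < n)%N -> rep (Rk R A n k.+1) = cr B R k.
Proof. by move=> kn; rewrite rep_alg loc_Rk // add0n. Qed.

Lemma invmx_R : invmx R = R.
Proof.
have [_ RR] := R_sym; have [uR _] := mulmx1_unit RR.
by rewrite -[RHS](mulKmx uR) RR mulmx1.
Qed.

Definition gsite (L : 'M[fps A]_N.+1) : E := site 0 (map_mx g L).

Lemma gsite_based L : based T (gsite L).
Proof. by move=> j j0; apply: ccent_loc; lia. Qed.

Lemma rep_Lbar n k L : (k <= n)%N -> rep (Lbar R n k.+1 L) = lbar T (gsite L) k.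
Proof.
elim: k => [|k IH] kn.
  by rewrite lbar0 /rep map_act1 loc_act1.
rewrite -[Lbar R n k.+2 L]/(Rk R A n.+1 k.+1 *m Lbar R n k.+1 L *m Rk_inv R A n.+1 k.+1).
rewrite !repM IH; last exact: ltnW.
by rewrite /Rk_inv invmx_R -/(Rk R A n.+1 k.+1) !rep_Rk // lbarS.
Qed.

Lemma rep_word n m L (s : nat -> nat) : (m <= n.+1)%N ->
  rep (\prod_(1 <= i < m.+1) Lbar R n i (shift_mx (s i) L)) =
  word T (fun c => gsite (shift_mx c L)) 0 [seq s i | i <- iota 1 m].
Proof.
move=> mn; rewrite rep_prod; elim: m mn => [|m IH] mn; first by rewrite big_geq.
rewrite big_nat_recr // IH; last exact: ltnW.
rewrite rep_Lbar // (_ : iota 1 m.+1 = iota 1 m ++ [:: m.+1]); last by have := iotaD 1 m 1; rewrite addn1.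
by rewrite map_cat word_cat size_map size_iota add0n /= mulr1.
Qed.

Lemma loc_skewsym n k : (k <= n)%N ->
  loc 0 (map_mx (in_alg B) (skewsym n R k)) = askew T 0 k.
Proof.
elim: k => [|[|k] IH] kn; rewrite ?map_mx1 ?loc_1 //.
rewrite askewSS -(IH (ltnW kn)) [skewsym n R k.+2]/=.
rewrite -[X in _ *: (X *m _ *m X)]/(skewsym n R k.+1) map_mxZ locZ !map_mxM !locM.
congr (_ *: (_ * _ * _)); rewrite map_mxB locD locN loc_Rk // map_scalar_mx /=.
by rewrite loc_scalarZ.
Qed.

Lemma rep_Rprod n : rep (\prod_(1 <= i < n.+1) Rk R A n.+1 (n.+1 - i)) = rprodV T 0 n.
Proof.
rewrite rep_prod; transitivity (\prod_(1 <= i < n.+1) cr B R (n - i)).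
  apply: eq_big_nat => i /andP[i0 ii]; rewrite subSn // rep_Rk //; lia.
suff H m : (m <= n)%N -> \prod_(n.+1 - m <= i < n.+1) cr B R (n - i) = rprodV T 0 m.
  by rewrite -H // subSnn.
elim: m => [|m IH] mn; first by rewrite subn0 big_geq.
rewrite big_ltn; last by lia.
have mn' := ltnW mn; by rewrite subSS subKn // -subSn // IH.
Qed.

Lemma map_ptr k (X : tensor_mx (fps A) N.+1 k.+1) :
  map_mx g (ptr C X) = ptr C (map_mx g X).
Proof.
apply: tentryP => s t; rewrite tentry_map !tentryE rmorph_sum; apply: eq_bigr => b _.
by rewrite rmorph_sum; apply: eq_bigr => c _; rewrite /= gZ tentry_map.
Qed.

Lemma trs_rep n (X : tensor_mx (fps A) N.+1 n.+1) :
  trs T 1 n (rep X) = gsite (Rtr_but1 Psi X).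
Proof.
elim: n X => [|n IH] X.
  apply: chainP => f s; rewrite siteE locE sum_tuple1; apply: eq_bigr => b _.
  rewrite repl1 window1 tentry_map mxE; congr (_ * _); congr (g _).
  rewrite mxE big_mkcond sum_tuple1 (bigD1 (s 0%N)) //= [X in _ + X]big1 => [|c /negPf cs].
    rewrite addr0 (tnth_nth b) /= (eqxx (s 0%N)) big_mkcond sum_tuple1 (bigD1 b) //=.
    rewrite [X in _ + X]big1 => [|c /negPf cb]; last by rewrite (tnth_nth b) /= cb.
    by rewrite addr0 (tnth_nth b) /= (eqxx b) big_pred0 ?scale1r // => l; rewrite ord1 eqxx.
  by rewrite (tnth_nth b) /= cs.
have H := ctr_loc C 0 (map_mx g X); rewrite add0n -map_ptr in H.
by rewrite /= add1n [ctr _ _ _]H IH -Rtr_but1S.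
Qed.

(** Factor 0 is the last one: its trace is a tensor of order 0. *)
Lemma tr_gsite (Z : 'M[fps A]_N.+1) : tower_tr T 0 (gsite Z) = site 0 (g (Rtr Psi Z))%:M.
Proof.
transitivity (loc 0 ((g (Rtr Psi Z))%:M : tensor_mx B N.+1 0)); last exact: loc_scalar.
rewrite [LHS](ctr_loc C 0); congr loc; apply: tentryP => s t; rewrite tentryE.
have -> : tentry (g (Rtr Psi Z))%:M s t = g (Rtr Psi Z).
  by rewrite /tentry mxE (inj_eq enum_rank_inj) [s]tuple0 [t]tuple0 eqxx.
rewrite /Rtr exchange_big /= rmorph_sum; apply: eq_bigr => b _.
rewrite rmorph_sum; apply: eq_bigr => c _; rewrite /= gZ tentryE; congr (_ *: _).
rewrite ifT; last by apply/forallP => l; rewrite ord1.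
by rewrite !mxE !(tnth_nth b) /= [s]tuple0 [t]tuple0.
Qed.

Variable L : 'M[fps A]_N.+1.
Let y c := gsite (shift_mx c L).

Lemma rep_skew n : rep (map_mx (in_alg (fps A)) (skewsym n.+1 R n.+1) *m
              \prod_(1 <= i < n.+2) Lbar R n i (shift_mx i.-1 L)) = skew_word T y 0 0 n.+1.
Proof.
rewrite repM rep_alg loc_skewsym // (rep_word _ predn) //.
by rewrite -[1%N]/(1 + 0)%N iotaDl -map_comp map_id.
Qed.

Lemma wedge_skew_power n : wedge T y 0 n.+1 = gsite (skew_power R Psi L n.+1).
Proof. by rewrite /wedge -rep_skew trs_rep. Qed.

Lemma elemt_elem_sym n : elemt T y 0 n = site 0 (g (elem_sym R Psi L n))%:M.
Proof.
case: n => [|n].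
  rewrite rmorph1 -(loc_scalar N 0 1) loc_1.
  by rewrite /elemt /= /skew_word /= mulr1.
by rewrite /elemt -rep_skew trsS trs_rep tr_gsite.
Qed.

(** The shifts n + 1 - i for i = 1, ..., n + 1 run through n, ..., 0, which is the decreasing
    word. *)
Lemma mpow_matrix_power n : mpow T y 0 n.+1 = gsite (matrix_power R Psi L n.+1).
Proof.
rewrite /mpow -trs_rep repM rep_Rprod (rep_word _ (fun i => n.+1 - i)%N) //.
congr (trs _ _ _ (word _ _ _ _ * _)); apply: (@eq_from_nth _ 0%N).
  by rewrite size_rev size_map !size_iota.
move=> i; rewrite size_rev size_iota => ni; rewrite nth_rev ?size_iota //.
by rewrite (nth_map 0%N) ?size_iota // !nth_iota //; lia.
Qed.

End Interface.

Section Central.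
Variable A : pzRingType.
Implicit Types a b x : A.

Lemma centralM a b : (forall x, a * x = x * a) -> (forall x, b * x = x * b) ->
  forall x, a * b * x = x * (a * b).
Proof. by move=> aC bC x; rewrite -mulrA bC mulrA aC -mulrA. Qed.

Lemma centralB a b : (forall x, a * x = x * a) -> (forall x, b * x = x * b) ->
  forall x, (a - b) * x = x * (a - b).
Proof. by move=> aC bC x; rewrite mulrBl mulrBr aC bC. Qed.

Lemma central_nat n x : n%:R * x = x * n%:R.
Proof. by rewrite mulr_natl mulr_natr. Qed.

End Central.

Section FpsMore.
Variable A : pzRingType.

Lemma fpsYK c (a : fps A) : (1 - c%:R * fpsX) * (fpsY A c * a) = fpsX * a.
Proof.
by rewrite mulrA mulrBl mul1r {1}fpsYE addrK.
Qed.

Lemma in_u_central (a : fps A) : (forall n x, a n * x = x * a n) ->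
  forall b : fps (fps A), in_u a * b = b * in_u a.
Proof.
move=> aC b; apply/fpsP => r; apply/fpsP => s; rewrite !fpsM !fps_sum.
rewrite (reindex_inj rev_ord_inj) /=; apply: eq_bigr => i _.
rewrite subSS subKn; last by rewrite -ltnS.
exact: etrans (fpsCM _ _ _) (etrans (aC _ _) (esym (fpsMC _ _ _))).
Qed.

Lemma fpsY_coef_central c n (x : A) : fpsY A c n * x = x * fpsY A c n.
Proof. by case: n => [|n] /=; rewrite ?mul0r ?mulr0 // mulr_natl mulr_natr. Qed.

Lemma fpsX_coef_central n (x : A) : (fpsX : fps A) n * x = x * (fpsX : fps A) n.
Proof. by rewrite /= mulr_natl mulr_natr. Qed.

Lemma in_v_central (a : fps A) : (forall x, a * x = x * a) ->
  forall b : fps (fps A), in_v a * b = b * in_v a.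
Proof. by move=> aC b; apply/fpsP => r; rewrite fpsCM fpsMC aC. Qed.

End FpsMore.

Lemma fps_diagZ (K : pzRingType) (A : algType K) e (k : K) (x : fps (fps A)) :
  fps_diag e (k *: x) = k *: fps_diag e x.
Proof.
apply/fpsP => n; rewrite fpsZ.
have -> : fps_diag e (k *: x) n =
  (\sum_(i < n.+1) fps_shift e (k *: x i) * fpsX ^+ i) n by [].
have -> : fps_diag e x n = (\sum_(i < n.+1) fps_shift e (x i) * fpsX ^+ i) n by [].
rewrite -fpsZ scaler_sumr; congr fps_coef; apply: eq_bigr => i _.
by rewrite fps_shiftZ scalerAl.
Qed.

(** * The Yangian relation as an exchange relation *)

Section Exchange.
Variables (K : numFieldType) (N : nat) (R : tensor_mx K N.+1 2).
Hypothesis R_sym : involutive_symmetry R.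
Variables (A B : algType K) (L : 'M[fps A]_N.+1).
Hypothesis L_rel : yangian_defect R L = 0.
Local Notation crB := (cr B R).
Local Notation scal b := (site 0 b%:M : chain N B).

Lemma locZs k (b : B) (X : tensor_mx B N.+1 k) : loc 0 (b *: X) = scal b * loc 0 X.
Proof. by rewrite -mul_scalar_mx locM loc_scalar. Qed.

Lemma scalM (b c : B) : scal (b * c) = scal b * scal c.
Proof. by rewrite scalar_mxM siteM. Qed.

Lemma scalB (b c : B) : scal (b - c) = scal b - scal c.
Proof.
apply: chainP => f s; rewrite chainDE chainNE !siteE -sumrB; apply: eq_bigr => t _ /=.
by rewrite raddfB !mxE mulrBl.
Qed.

Lemma exchange_scale (c a b : B) (X Q X' Y : chain N B) :
  (forall x, c * x = x * c) ->
  (scal a * Y - scal b) * X * Q = X' * (scal a * Y - scal b) ->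
  (scal (c * a) * Y - scal (c * b)) * X * Q = X' * (scal (c * a) * Y - scal (c * b)).
Proof.
move=> cC ex.
have -> : scal (c * a) * Y - scal (c * b) = scal c * (scal a * Y - scal b).
  by rewrite mulrBr mulrA !scalM.
rewrite [RHS]mulrA -(site_scalar_central 0 cC X') -[RHS]mulrA -ex.
by rewrite !mulrA.
Qed.

Lemma scal_reg (b : B) (X : chain N B) : (forall x, b * x = 0 -> x = 0) ->
  scal b * X = 0 -> X = 0.
Proof.
move=> breg bX; apply: chainP => f s; apply: breg.
have : (scal b * X) f s = 0 by rewrite bX.
rewrite chainME siteE (bigD1 (s 0%N)) //= big1 => [|t].
  by rewrite mxE eqxx upd_id addr0.
by rewrite mxE eq_sym => /negPf ->; rewrite mulr0n mul0r.
Qed.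

Variable h : {rmorphism fps (fps A) -> B}.
Hypothesis hZ : forall (c : K) x, h (c *: x) = c *: h x.
Let al := h (in_v fpsX - in_u fpsX).
Let be := h (in_u fpsX * in_v fpsX).
Hypothesis al_central : forall b, al * b = b * al.
Hypothesis be_central : forall b, be * b = b * be.
Let x := site 0 (map_mx h (map_mx (@in_u A) L)).
Let x' := site 0 (map_mx h (map_mx (@in_v A) L)).

(** [al] and [be] are the images of the two coefficients of the cleared R(u,v). A further r_0 on the
    right, which commutes with al r_0 - be, produces L with overlined indices 1 and 2. *)
Lemma defect_exchange :
  (scal al * crB 0 - scal be) * x * (crB 0 * x' * crB 0) =
  x' * (crB 0 * x * crB 0) * (scal al * crB 0 - scal be).
Proof.
have D0 : loc 0 (map_mx h (yangian_defect R L)) = 0 :> chain N B.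
  rewrite L_rel (_ : map_mx h 0 = 0); last by apply/matrixP => i j; rewrite !mxE rmorph0.
  apply: chainP => f s; rewrite locE big1 // => t _.
  by rewrite /tentry mxE mul0r.
rewrite /yangian_defect map_defect locD locN !locM locD locN locZs loc_scalar in D0.
rewrite !map_act1 !loc_act1 in D0.
have RE : map_mx h (map_mx (in_alg (fps (fps A))) R) = map_mx (in_alg B) R.
  by apply/matrixP => i j; rewrite !mxE /= hZ rmorph1.
rewrite RE -/(crB 0) -/al -/be -/x -/x' in D0.
move/eqP: D0; rewrite subr_eq0 => /eqP D0.
have fC : (scal al * crB 0 - scal be) * crB 0 = crB 0 * (scal al * crB 0 - scal be).
  have ar := site_scalar_central 0 al_central (crB 0).
  have br := site_scalar_central 0 be_central (crB 0).
  by rewrite mulrBl [RHS]mulrBr br [in RHS]mulrA -ar.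
transitivity ((scal al * crB 0 - scal be) * x * crB 0 * x' * crB 0).
  by rewrite !mulrA.
by rewrite D0 -!mulrA fC !mulrA.
Qed.

End Exchange.

Section SpectralExchange.
Variables (K : numFieldType) (N : nat) (R Psi : tensor_mx K N.+1 2).
Hypothesis R_sym : involutive_symmetry R.
Variables (A B : algType K) (L : 'M[fps A]_N.+1).
Hypothesis L_rel : yangian_defect R L = 0.
Local Notation crB := (cr B R).
Local Notation scal b := (site 0 b%:M : chain N B).

Section Shifted.
Variable g : {rmorphism fps A -> B}.
Hypothesis gZ : forall (c : K) x, g (c *: x) = c *: g x.
Hypothesis gX_reg : forall b, g fpsX * b = 0 -> b = 0.
Hypothesis gY_central : forall c b, g (fpsY A c) * b = b * g (fpsY A c).
Let y c := gsite g (shift_mx c L) : chain N B.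

Lemma gY_reg c b : g (fpsY A c) * b = 0 -> b = 0.
Proof.
move=> Yb; apply: gX_reg; rewrite -[fpsX]mulr1 -(fpsYK c) mulr1 rmorphM.
by rewrite -mulrA Yb mulr0.
Qed.

Lemma gsite_exchange c d : (c < d)%N ->
  ((d - c)%:R *: crB 0 - 1) * y c * (crB 0 * y d * crB 0) =
  y d * (crB 0 * y c * crB 0) * ((d - c)%:R *: crB 0 - 1).
Proof.
move=> cd; set e := (d - c)%N.
(* First v becomes u - e, then u becomes u - c; in total u goes to u - c and v to u - d. Then v^-1 -
   u^-1 becomes e times the image [w] of u^-1 v^-1, and the common regular factor [w] can be
   cancelled. *)
pose h : {rmorphism fps (fps A) -> B} := g \o (@fps_shift A c \o @fps_diag A e).
have hZ (k : K) x : h (k *: x) = k *: h x.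
  rewrite /h /= -gZ -fps_shiftZ; congr (g (fps_shift c _)).
  exact: fps_diagZ.
pose w := g (fpsY A c) * g (fpsY A d).
have dxy : fps_diag e (in_u fpsX * in_v fpsX) = fpsX * fpsY A e.
  by rewrite rmorphM /= fps_diag_u fps_diag_v fps_shiftX.
have hbe : h (in_u fpsX * in_v fpsX) = w.
  have -> : w = g (fps_shift c (fpsX * fpsY A e)).
    by rewrite !rmorphM /= fps_shiftX fps_shiftY subnKC // ltnW.
  by rewrite /h /= dxy.
have hal : h (in_v fpsX - in_u fpsX) = e%:R * w.
  have E1 : fps_diag e (in_v fpsX - in_u fpsX) = e%:R * (fpsX * fpsY A e).
    rewrite rmorphB /= fps_diag_u fps_diag_v fps_shiftX.
    by rewrite {1}fpsYE addrAC subrr add0r mulrA.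
  by rewrite -hbe /h /= E1 -dxy rmorphM rmorphM /= !rmorph_nat.
have wC b : w * b = b * w by rewrite /w -mulrA (gY_central d) mulrA (gY_central c) -mulrA.
have wreg b : w * b = 0 -> b = 0.
  by rewrite /w -mulrA => /gY_reg/gY_reg.
have alC b : h (in_v fpsX - in_u fpsX) * b = b * h (in_v fpsX - in_u fpsX).
  by rewrite hal -mulrA wC !mulrA mulr_natl mulr_natr.
have beC b : h (in_u fpsX * in_v fpsX) * b = b * h (in_u fpsX * in_v fpsX).
  by rewrite hbe wC.
have := defect_exchange L_rel hZ alC beC.
have -> : map_mx h (map_mx (@in_u A) L) = map_mx g (shift_mx c L).
  by apply/matrixP => i j; rewrite !mxE /= fps_diag_u.
have -> : map_mx h (map_mx (@in_v A) L) = map_mx g (shift_mx d L).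
  by apply/matrixP => i j; rewrite !mxE /= fps_diag_v fps_shift_shift subnKC // ltnW.
rewrite hal hbe -/(gsite g _) -/(gsite g _) -/(y c) -/(y d) => ex.
have WF : scal (e%:R * w) * crB 0 - scal w = scal w * (e%:R *: crB 0 - 1).
  rewrite mulrBr mulr1 -scalerAr scalerAl; congr (_ * _ - _).
  by rewrite -siteZ scale_scalar_mx scaler_nat.
rewrite WF in ex.
apply/eqP; rewrite -subr_eq0; apply/eqP; apply: (scal_reg wreg).
rewrite mulrBr [X in _ - X]mulrA (site_scalar_central 0 wC (y d * _)).
by rewrite -[X in _ - X]mulrA -ex !mulrA subrr.
Qed.

End Shifted.

Local Notation BB := (fps (fps A)).
Local Notation scal2 b := (site 0 b%:M : chain N BB).
Let u := in_u (fpsX : fps A).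
Let v := in_v (fpsX : fps A).
Let iu : {rmorphism fps A -> BB} := @in_u A.
Let iv : {rmorphism fps A -> BB} := @in_v A.
Let y c : chain N BB := @gsite K N A BB iu (shift_mx c L).
Let z : chain N BB := @gsite K N A BB iv L.
Let q := scal2 (u * v).
Let d c := scal2 (v - u - c%:R * (u * v)).

Lemma u_central b : u * b = b * u.
Proof. apply: in_u_central => n x. exact: fpsX_coef_central. Qed.

Lemma v_central b : v * b = b * v.
Proof. apply: in_v_central. exact: fpsX_central. Qed.

Lemma Y_central c b : in_u (fpsY A c) * b = b * in_u (fpsY A c).
Proof. by apply: in_u_central => n x; exact: fpsY_coef_central. Qed.

Lemma uv_central b : u * v * b = b * (u * v).
Proof. exact: centralM u_central v_central b. Qed.

Lemma q_central X : q * X = X * q.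
Proof. exact: site_scalar_central uv_central X. Qed.

Lemma d_central c X : d c * X = X * d c.
Proof.
apply: site_scalar_central; apply: centralB; first exact: centralB v_central u_central.
exact: centralM (central_nat c) uv_central.
Qed.

Lemma dS c : d c.+1 = d c - q.
Proof.
by rewrite /d /q -scalB; congr (site 0 _%:M); rewrite -natr1 mulrDl mul1r opprD addrA.
Qed.

Lemma z_exchange c :
  (d c * cr BB R 0 - q) * y c * (cr BB R 0 * z * cr BB R 0) =
  z * (cr BB R 0 * y c * cr BB R 0) * (d c * cr BB R 0 - q).
Proof.
pose h : {rmorphism BB -> BB} := @fps_shift (fps A) c.
have hal : h (v - u) = v - in_u (fpsY A c).
  by rewrite rmorphB /= fps_shift_u fps_shift_v fps_shiftX.
have hbe : h (u * v) = in_u (fpsY A c) * v.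
  by rewrite rmorphM /= fps_shift_u fps_shift_v fps_shiftX.
have alC b : h (v - u) * b = b * h (v - u).
  by rewrite hal; apply: centralB => ?; [exact: v_central | exact: Y_central].
have beC b : h (u * v) * b = b * h (u * v).
  by rewrite hbe; apply: centralM => ?; [exact: Y_central | exact: v_central].
have := defect_exchange L_rel (fun k x => fps_shiftZ c k x) alC beC.
have -> : map_mx h (map_mx (@in_u A) L) = map_mx iu (shift_mx c L).
  by apply/matrixP => i j; rewrite !mxE /= fps_shift_u.
have -> : map_mx h (map_mx (@in_v A) L) = map_mx iv L.
  by apply/matrixP => i j; rewrite !mxE /= fps_shift_v.
rewrite hal hbe -/(gsite iu _) -/(gsite iv _) -/(y c) -/z => ex.
(* The shift of u gives the coefficient (u - c)^-1 v^-1, which depends on c. Multiplication by 1 - c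
   u^-1 turns it into u^-1 v^-1 for every c, as the recursion [dS] requires. *)
pose s := 1 - c%:R * u.
have sE : s = in_u (1 - c%:R * fpsX) by rewrite rmorphB rmorphM rmorph1 rmorph_nat.
have sY : s * in_u (fpsY A c) = u.
  by rewrite sE -rmorphM -[fpsY A c]mulr1 fpsYK mulr1.
have sC b : s * b = b * s.
  move: b; apply: centralB => [b|]; first by rewrite mul1r mulr1.
  exact: centralM (central_nat c) u_central.
have sv : s * (v - in_u (fpsY A c)) = v - u - c%:R * (u * v).
  by rewrite mulrBr sY /s mulrBl mul1r -mulrA addrAC.
have sYv : s * (in_u (fpsY A c) * v) = u * v by rewrite mulrA sY.
have := exchange_scale sC ex; rewrite sv sYv; exact.
Qed.

End SpectralExchange.

Lemma free_alg_ind (K : comNzRingType) (X : choiceType) (Q : free_alg K X -> Prop) :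
  Q 1 -> (forall x y, Q x -> Q y -> Q (x + y)) ->
  (forall x y, Q x -> Q y -> Q (x * y)) -> (forall c x, Q x -> Q (c *: x)) ->
  (forall x, Q (free_gen K x)) -> forall x, Q x.
Proof.
move=> Q1 QD QM QZ Qg x.
have Q0 : Q 0 by rewrite -(scale0r 1); exact: QZ.
have Qk (k : {fmonom X}) : Q << k >>.
  case: k => s; elim: s => [|i s IH].
    rewrite (_ : << _ >> = 1) //; congr (mkmalgU _ 1).
    by rewrite -fmoneE.
  rewrite (_ : << _ >> = free_gen K i * << FMonom s >> :> free_alg K X); first exact: QM.
  have := fgmulUU (1 : K) 1 (fmu i) (FMonom s); rewrite mulr1 => H.
  apply: etrans (esym H); congr (mkmalgU _ 1).
  by rewrite -[RHS]/(fmmul _ _) fmmulE fmuE.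
have QU (c : K) (k : {fmonom X}) : Q << c *g k >>.
  have -> : << c *g k >> = c *: (<< k >> : free_alg K X).
    have := mul_malgC c (<< k >> : {malg K[{fmonom X}]}); rewrite malgM_def fgmulUU mulr1 => <-.
    by congr (mkmalgU _ c); rewrite mul1m.
  exact: QZ.
rewrite (monalgE x); apply: (big_ind Q) => // k _; exact: QU.
Qed.

Section RtrLemmas.
Variables (K : numFieldType) (N : nat) (Psi : tensor_mx K N 2) (A : algType K).
Implicit Types X Y : 'M[fps A]_N.

Lemma mul_mx_scalarE X (b : fps A) i j : (X *m b%:M) i j = X i j * b.
Proof.
rewrite mxE (bigD1 j) //= big1 => [|k /negPf kj].
  by rewrite mxE eqxx addr0.
by rewrite mxE kj mulr0n mulr0.
Qed.

Lemma RtrD X Y : Rtr Psi (X + Y) = Rtr Psi X + Rtr Psi Y.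
Proof.
rewrite -big_split; apply: eq_bigr => i _; rewrite -big_split; apply: eq_bigr => j _ /=.
by rewrite [(X + Y) _ _]mxE scalerDr.
Qed.

Lemma Rtr_sum I (r : seq I) (F : I -> 'M[fps A]_N) :
  Rtr Psi (\sum_(i <- r) F i) = \sum_(i <- r) Rtr Psi (F i).
Proof.
apply: (big_morph (Rtr Psi (A := A))) => [X Y|]; first exact: RtrD.
by rewrite /Rtr big1 // => i _; rewrite big1 // => j _; rewrite [(0 : 'M_N) _ _]mxE scaler0.
Qed.

Lemma RtrMn X k : Rtr Psi (X *+ k) = Rtr Psi X *+ k.
Proof.
rewrite -[k]card_ord -!sumr_const; exact: Rtr_sum.
Qed.

Lemma RtrZ (b : fps A) X : Rtr Psi (b *: X) = b * Rtr Psi X.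
Proof.
rewrite mulr_sumr; apply: eq_bigr => i _; rewrite mulr_sumr; apply: eq_bigr => j _.
by rewrite [(b *: X) _ _]mxE scalerAr.
Qed.

Lemma Rtr_mul_scalar X (b : fps A) : Rtr Psi (X *m b%:M) = Rtr Psi X * b.
Proof.
rewrite mulr_suml; apply: eq_bigr => i _; rewrite mulr_suml; apply: eq_bigr => j _.
by rewrite mul_mx_scalarE scalerAl.
Qed.

Lemma Rtr_shift c X : Rtr Psi (shift_mx c X) = fps_shift c (Rtr Psi X).
Proof.
rewrite rmorph_sum; apply: eq_bigr => i _; rewrite rmorph_sum; apply: eq_bigr => j _.
by rewrite [shift_mx _ _ _ _]mxE /= fps_shiftZ.
Qed.

End RtrLemmas.

(** * Cayley-Hamilton-Newton, Newton and Cayley-Hamilton identities *)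

Section MainIdentities.
Variables (K : numFieldType) (N m : nat) (R Psi : tensor_mx K N.+1 2).
Hypothesis R_sym : involutive_symmetry R.
Hypothesis R_skew : skew_inverse R Psi.
Variables (A : algType K) (L : 'M[fps A]_N.+1).
Hypothesis L_rel : yangian_defect R L = 0.
Local Notation Lw := (skew_power R Psi L).
Local Notation Lp := (matrix_power R Psi L).
Local Notation e := (elem_sym R Psi L).
Local Notation p := (power_sum R Psi L).
Local Notation B := (fps A).
Local Notation E := (chain N B).
Local Notation T := (chain_tower B R_sym R_skew).
Let g : {rmorphism B -> B} := idfun.
Let y c : E := gsite g (shift_mx c L).

Lemma g_scale (c : K) x : g (c *: x) = c *: g x. Proof. by []. Qed.

Lemma gsite_id (X : 'M[B]_N.+1) : gsite g X = site 0 X.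
Proof. by congr (site 0 _); apply/matrixP => i j; rewrite mxE. Qed.

Lemma site_sum i I (r : seq I) (F : I -> 'M[B]_N.+1) :
  site i (\sum_(j <- r) F j) = \sum_(j <- r) site i (F j).
Proof.
apply: (big_morph (site i)) => [X Y|]; first exact: siteD.
by apply: chainP => f s; rewrite siteE big1 // => t _; rewrite mxE mul0r.
Qed.

Lemma siteMn i (X : 'M[B]_N.+1) k : site i (X *+ k) = k%:R *: site i X.
Proof.
rewrite scaler_nat -[k]card_ord -!sumr_const; exact: site_sum.
Qed.

Lemma site_sign i k (X : 'M[B]_N.+1) : site i ((-1) ^+ k *: X) = (-1) ^+ k *: site i X.
Proof. by rewrite -siteZ -in_algE rmorph_sign. Qed.

Lemma y_based c : based T (y c). Proof. exact: gsite_based. Qed.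

Lemma y_exchange c d : (c < d)%N ->
  ((d - c)%:R *: cr B R 0 - 1) * y c * (cr B R 0 * y d * cr B R 0) =
  y d * (cr B R 0 * y c * cr B R 0) * ((d - c)%:R *: cr B R 0 - 1).
Proof.
apply: gsite_exchange => //; first exact: fpsX_reg.
exact: fpsY_central.
Qed.

Lemma site_skew_power n : site 0 (Lw n.+1) = wedge T y 0 n.+1.
Proof. by rewrite (wedge_skew_power R_sym R_skew g_scale) gsite_id. Qed.

Lemma site_skew_power_gt0 k : (0 < k)%N -> site 0 (Lw k) = wedge T y 0 k.
Proof. by case: k => // k _; exact: site_skew_power. Qed.

Lemma site_elem_sym n : site 0 (e n)%:M = elemt T y 0 n.
Proof. by rewrite (elemt_elem_sym R_sym R_skew g_scale). Qed.

Lemma word_map (y' : nat -> E) f i s :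
  word T (fun c => y' (f c)) i s = word T y' i (map f s).
Proof. by elim: s i => //= c s IH i; rewrite IH. Qed.

(** The dictionary is applied with the shift by q as [g]; successive shifts add up, so the word in c
    becomes the word in q + c. *)
Lemma site_shift_matrix_power q n :
  site 0 (shift_mx q (Lp n.+1)) = mpow T y q n.+1.
Proof.
pose g' : {rmorphism B -> B} := @fps_shift A q.
have g'Z (c : K) x : g' (c *: x) = c *: g' x by exact: fps_shiftZ.
transitivity (gsite g' (Lp n.+1)); first by [].
rewrite -(mpow_matrix_power R_sym R_skew g'Z) /mpow -[q in RHS]addn0 iotaDl -map_rev.
rewrite -(word_map y); congr (trs _ _ _ (word _ _ _ _ * _)); apply/funext => c.
rewrite /y gsite_id; congr (site 0 _); apply/matrixP => i j.
by rewrite !mxE /= fps_shift_shift.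
Qed.

Lemma cayley_hamilton_newton k : (0 < k)%N ->
  (-1) ^+ k.+1 *: (Lw k *+ k) =
  \sum_(0 <= q < k) (-1) ^+ q *: (shift_mx q (Lp (k - q)) *m (e q)%:M).
Proof.
move=> k0; apply: (@site_inj K N B 0).
rewrite site_sign siteMn site_skew_power_gt0 //.
rewrite (cayley_hamilton_newton_tower y_based y_exchange) // site_sum.
apply: eq_big_nat => q /andP[_ qk]; rewrite site_sign siteM site_elem_sym.
by rewrite -[(k - q)%N]prednK ?subn_gt0 // site_shift_matrix_power.
Qed.

(** The R-trace of the Cayley-Hamilton-Newton identity: the e_q stand on the right and leave the
    trace. The index is reversed by j = k - q, which contributes the sign (-1)^k. *)
Lemma newton k : (0 < k)%N ->
  e k *+ k + \sum_(1 <= j < k.+1) (-1) ^+ j * (fps_shift (k - j) (p j) * e (k - j)%N) = 0.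
Proof.
move=> k0; have := congr1 (Rtr Psi (A := A)) (cayley_hamilton_newton k0).
rewrite RtrZ RtrMn Rtr_sum.
have -> : Rtr Psi (Lw k) = e k by case: (k) k0.
under eq_bigr => q _ do rewrite RtrZ Rtr_mul_scalar Rtr_shift.
move=> CHN; rewrite big_nat_rev /= big_add1 /=.
transitivity (e k *+ k + (-1) ^+ k * \sum_(0 <= q < k)
  (-1) ^+ q * (fps_shift q (p (k - q)) * e q)).
  congr (_ + _); rewrite mulr_sumr; apply: eq_big_nat => q /andP[_ qk].
  have -> : (1 + k.+1 - q.+2 = k - q)%N by lia.
  rewrite subKn 1?ltnW // mulrA -exprD -signr_odd -[in RHS]signr_odd; congr (_ ^+ _ * _).
  by rewrite oddB 1?ltnW // oddD.
by rewrite -CHN mulrA -exprD addnS exprS -signr_odd addnn odd_double expr0 mulr1 mulN1r subrr.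
Qed.

Hypothesis m_gt1 : (1 < m)%N.
Hypothesis R_rank : skewsym m.+1 R m.+1 = 0.

Lemma askew_rank (B' : algType K) : askew (chain_tower B' R_sym R_skew) 0 m.+1 = 0.
Proof.
rewrite -(loc_skewsym R_sym R_skew B' (leqnn _)) R_rank.
apply: chainP => f s; rewrite locE big1 // => t _.
by rewrite tentry_map /tentry mxE rmorph0 mul0r.
Qed.

Lemma cayley_hamilton :
  \sum_(0 <= q < m.+1) (-1) ^+ q *: (shift_mx q (Lp (m - q)) *m (e q)%:M) = 0.
Proof.
have m0 := ltnW m_gt1.
have Lwm : Lw m *+ m = (e m)%:M.
  apply: (@site_inj K N B 0); rewrite siteMn site_skew_power_gt0 //.
  rewrite site_elem_sym (cayley_hamilton_tower y_based y_exchange) //.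
  exact: askew_rank.
(* The last summand is (-1)^m e_m because L^[0] = I. The others are the Cayley-Hamilton-Newton sum
   for k = m, which is (-1)^(m+1) e_m by [Lwm]. *)
rewrite big_nat_recr //= -cayley_hamilton_newton // Lwm subnn.
have -> : shift_mx m (Lp 0) = 1%:M by exact: map_mx1.
by rewrite mul1mx exprS mulN1r scaleNr addNr.
Qed.

End MainIdentities.

(** * Centrality of the determinant *)

Section Determinant.
Variables (K : numFieldType) (N m : nat) (R Psi : tensor_mx K N.+1 2).
Hypothesis R_sym : involutive_symmetry R.
Hypothesis R_skew : skew_inverse R Psi.
Variables (A : algType K) (L : 'M[fps A]_N.+1).
Hypothesis L_rel : yangian_defect R L = 0.
Hypothesis m_gt1 : (1 < m)%N.
Hypothesis R_rank : skewsym m.+1 R m.+1 = 0.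
Local Notation e := (elem_sym R Psi L).

Section Target.
Variables (B : algType K) (g : {rmorphism fps A -> B}).
Hypothesis gZ : forall (c : K) x, g (c *: x) = c *: g x.
Hypothesis gX_reg : forall b, g fpsX * b = 0 -> b = 0.
Hypothesis gY_central : forall c b, g (fpsY A c) * b = b * g (fpsY A c).
Local Notation T := (chain_tower B R_sym R_skew).
Local Notation scal b := (site 0 b%:M : chain N B).
Local Notation crB := (cr B R).
Let y c : chain N B := gsite g (shift_mx c L).
Variables (Z : 'M[B]_N.+1) (d : nat -> B) (q : B).
Hypothesis d_central : forall c b, d c * b = b * d c.
Hypothesis q_central : forall b, q * b = b * q.
Hypothesis dS : forall c, d c.+1 = d c - q.
Hypothesis d_reg : forall c b, d c * b = 0 -> b = 0.
Hypothesis Z_exchange : forall c,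
  (scal (d c) * crB 0 - scal q) * y c * (crB 0 * site 0 Z * crB 0) =
  site 0 Z * (crB 0 * y c * crB 0) * (scal (d c) * crB 0 - scal q).

Lemma elem_sym_commutes : (g (e m))%:M *m Z = Z *m (g (e m))%:M.
Proof.
apply: (@site_inj K N B 0); rewrite !siteM -(elemt_elem_sym R_sym R_skew gZ).
have Z_based : based T (site 0 Z) by move=> j j0; apply: ccent_loc; lia.
have y_based c : based T (y c) by exact: gsite_based.
have y_ex := gsite_exchange L_rel gZ gX_reg gY_central.
have dC c := site_scalar_central (N := N) 0 (d_central c).
have dS' c : scal (d c.+1) = scal (d c) - scal q by rewrite dS scalB.
have := elemt_exchange (T := T) y_based y_ex m_gt1 (askew_rank R_sym R_skew R_rank B)
  Z_based (site_scalar_central 0 q_central) dC dS' Z_exchange.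
have reg k X : dprod (fun c => scal (d c)) k * X = 0 -> X = 0.
  elim: k X => [|k IH] X /=; first by rewrite mul1r.
  by rewrite -mulrA => /IH; apply: scal_reg; exact: d_reg.
(* The central scalars left by [elemt_exchange] are cancelled one by one, each being regular. *)
rewrite -mulrA => /reg/(scal_reg (@d_reg m)) H.
by apply/eqP; rewrite -subr_eq0 H.
Qed.

End Target.

Lemma determinant_commutes :
  (in_u (e m))%:M *m map_mx (@in_v A) L = map_mx (@in_v A) L *m (in_u (e m))%:M.
Proof.
pose iu : {rmorphism fps A -> fps (fps A)} := @in_u A.
pose iv : {rmorphism fps A -> fps (fps A)} := @in_v A.
have iuZ (c : K) x : iu (c *: x) = c *: iu x.
  apply/fpsP => r; apply/fpsP => -[|s]; first by [].
  by apply/esym; exact: scaler0.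
have X_reg b : iu fpsX * b = 0 -> b = 0.
  move=> Xb; apply: fpsX_reg; rewrite -Xb; congr (_ * _).
  by apply/fpsP => -[|[|n]]; apply/fpsP => -[|l].
pose v : fps (fps A) := in_v fpsX; pose u : fps (fps A) := in_u fpsX.
have dC c := centralB (centralB (@v_central K A) (@u_central K A))
  (centralM (central_nat c) (@uv_central K A)).
have dS' c : v - u - c.+1%:R * (u * v) = v - u - c%:R * (u * v) - u * v.
  by rewrite -natr1 mulrDl mul1r opprD addrA.
have := @elem_sym_commutes (fps (fps A)) iu iuZ X_reg (@Y_central K A) (map_mx iv L)
  (fun c => v - u - c%:R * (u * v)) (u * v) dC (@uv_central K A) dS' (@vu_regular A).
by apply; exact: z_exchange.
Qed.

Lemma in_u_in_v_coef (a b : fps A) r s : (in_u a * in_v b) r s = a r * b s.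
Proof. by rewrite fpsMC fpsCM. Qed.

Lemma in_v_in_u_coef (a b : fps A) r s : (in_v b * in_u a) r s = b s * a r.
Proof. by rewrite fpsCM fpsMC. Qed.

Lemma determinant_coef_commutes i j r s : e m r * L i j s = L i j s * e m r.
Proof.
have /matrixP/(_ i j) := determinant_commutes.
rewrite mul_scalar_mx mul_mx_scalarE !mxE => H.
by rewrite -in_u_in_v_coef H in_v_in_u_coef.
Qed.

End Determinant.

Lemma commrZ (K : pzRingType) (A : algType K) (c : K) (a x : A) :
  GRing.comm a x -> GRing.comm a (c *: x).
Proof. by rewrite /GRing.comm => ax; rewrite -scalerAr ax scalerAl. Qed.

Lemma yangian_ind (K : numFieldType) (N : nat) (R : tensor_mx K N 2)
    (Q : yangian R -> Prop) :
  Q 1 -> (forall x y, Q x -> Q y -> Q (x + y)) ->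
  (forall x y, Q x -> Q y -> Q (x * y)) -> (forall (c : K) x, Q x -> Q (c *: x)) ->
  (forall i j k, Q (yangian_L R i j k)) -> forall x, Q x.
Proof.
move=> Q1 QD QM QZ QL x.
have [z ->] : exists z, x = qpi (yangian_proper (R:=R)) z by exact: qpiP.
move: z; apply: free_alg_ind.
- by have -> : qpi (yangian_proper (R := R)) 1 = 1 by [].
- by move=> a b Qa Qb; rewrite raddfD; apply: QD.
- by move=> a b Qa Qb; rewrite rmorphM; apply: QM.
- by move=> c a Qa; rewrite linearZ; apply: QZ.
- by move=> [[i j] k]; have := QL i j k.+1; rewrite !mxE.
Qed.

Theorem proposition28 (K : numFieldType) (N m : nat) (R Psi : tensor_mx K N 2)
    (R_sym : involutive_symmetry R) (R_skew : skew_inverse R Psi)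
    (R_birank : birank_m0 R m) :
  let L : 'M[fps (yangian R)]_N := yangian_L R in
  let Lwedge := skew_power R Psi L in
  let Lpow := matrix_power R Psi L in
  let e := elem_sym R Psi L in
  let p := power_sum R Psi L in
  [/\ forall k, (1 <= k)%N ->
        (-1) ^+ k.+1 *: (Lwedge k *+ k) =
        \sum_(0 <= q < k)
           (-1) ^+ q *: (shift_mx q (Lpow (k - q)%N) *m (e q)%:M),
      \sum_(0 <= q < m.+1)
         (-1) ^+ q *: (shift_mx q (Lpow (m - q)%N) *m (e q)%:M) = 0,
      forall k, (1 <= k)%N ->
        e k *+ k +
        \sum_(1 <= j < k.+1)
           (-1) ^+ j * (fps_shift (k - j) (p j) * e (k - j)%N) = 0
    & (in_u (e m))%:M *m map_mx (@in_v _) L =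
        map_mx (@in_v _) L *m (in_u (e m))%:M
      /\ forall (r : nat) (y : yangian R), e m r * y = y * e m r].
Proof.
case: R_birank => m_gt1 Pm /(_ _ (ltnSn m)) Pm1.
case: N R Psi R_sym R_skew Pm Pm1 => [|N] R Psi R_sym R_skew Pm Pm1.
  (* For N = 0 there are no multi-indices of length m, so every operator on the m-th tensor power is
     zero and the bi-rank condition fails. *)
  case/eqP: Pm; apply/matrixP => a; case: (tnth (enum_val a) (Ordinal (ltnW m_gt1))).
  by case.
have L_rel := yangian_relations R.
split.
- exact: cayley_hamilton_newton R_sym R_skew _ _ L_rel.
- exact: cayley_hamilton R_sym R_skew _ _ L_rel m_gt1 Pm1.
- exact: newton R_sym R_skew _ _ L_rel.
split; first exact: determinant_commutes R_sym R_skew _ _ L_rel m_gt1 Pm1.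
(* The elements commuting with a given one form a subalgebra, so it suffices to treat the
   coefficients of L. *)
move=> r; apply: yangian_ind.
- exact: GRing.commr1.
- by move=> x y; exact: GRing.commrD.
- by move=> x y; exact: GRing.commrM.
- by move=> c x; exact: commrZ.
- move=> i j k; exact: determinant_coef_commutes R_sym R_skew _ _ L_rel m_gt1 Pm1 i j r k.
Qed.
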